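(* Let $F:\mathbb{C}\to\mathbb{C}$ be a real entire function such that: (i) $F$ has exponential type at most $2\pi$; (ii) $F(x)\ge \operatorname{sgn}(x)$ for all $x\in\mathbb{R}$; (iii) $F$ is non-decreasing on $(-\infty,0)$ and non-increasing on $(0,\infty)$. Then $$\int_{-\infty}^{\infty}\big\{F(x)-\operatorname{sgn}(x)\big\}\,dx\ \ge\ 2. \qquad (\ast)$$ Moreover, there exists a unique real entire function $M:\mathbb{C}\to\mathbb{C}$ satisfying properties (i), (ii) and (iii) for which equality holds in $(\ast)$. This function is given by $$M(z)=-2\int_{-\infty}^{z}\frac{\sin^2 \pi s}{\pi^2 s\,(s+1)^2}\,ds-1,$$ where the integral is taken along the path $(-\infty,0]\cup[0,z]$, with $[0,z]$ the line segment connecting $0$ to $z$.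
   Context: An entire function $F:\mathbb{C}\to\mathbb{C}$ is of exponential type if $\tau(F):=\limsup_{|z|\to\infty}|z|^{-1}\log|F(z)|<\infty$; the number $\tau(F)$ is then called the exponential type of $F$, and ''exponential type at most $2\pi$'' means $\tau(F)\le 2\pi$. An entire function is real entire if its restriction to $\mathbb{R}$ is real-valued. Here $\operatorname{sgn}$ is the signum function on $\mathbb{R}$ ($\operatorname{sgn}(x)=1$ for $x>0$, $-1$ for $x<0$, $\operatorname{sgn}(0)=0$). The integral of the non-negative function $F-\operatorname{sgn}$ is understood as a value in $[0,\infty]$. The integrand $\frac{\sin^2\pi s}{\pi^2 s(s+1)^2}$ has removable singularities at $s=0$ and $s=-1$ and is regarded as an entire function of $s$. *)

(* Defs.v *)
From HB Require Import structures.
From mathcomp Require Import all_boot all_order all_algebra.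
From mathcomp Require Import all_classical all_reals all_analysis.
From mathcomp.real_closed Require Export complex.
Export Order.TTheory GRing.Theory Num.Theory numFieldNormedType.Exports.

Set Implicit Arguments.
Unset Strict Implicit.
Unset Printing Implicit Defensive.

Local Open Scope classical_set_scope.
Local Open Scope ring_scope.
Local Open Scope complex_scope.

Section EntireFunctions.
Variable R : realType.
Local Notation C := R[i].
Local Notation mu := (@lebesgue_measure R).

(* The library puts a normed space structure over C on the regular module
   C^o; there, derivability in the direction 1 is complex differentiability,
   the increment h ranging over C. *)
Definition entire (F : C -> C) : Prop :=
  forall z : C, derivable (F : C^o -> C^o) z 1.

Definition real_entire (F : C -> C) : Prop :=
  entire F /\ forall x : R, complex.Im (F x%:C) = 0.

(* To be used for real entire functions: the imaginary part is dropped. *)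
Definition on_reals (F : C -> C) (x : R) : R := complex.Re (F x%:C).

(* The modulus as an element of R; the norm `|z| is an element of C. *)
Definition cabs (z : C) : R := Normc.normc z.

Definition cinfty_nbhs : set_system C^o :=
  filter_from setT (fun r : R => [set z | r < cabs z]).

(* Here [lne 0 = -oo], so a zero of F contributes -oo to the limsup. *)
Definition exp_type (F : C -> C) : \bar R :=
  limf_esup
    (fun z : C^o => ((cabs z)^-1%:E * lne (cabs (F z))%:E)%E) cinfty_nbhs.

Definition monotone_majorant (F : C -> C) : Prop :=
  [/\ real_entire F,
      (exp_type F <= (2 * pi)%:E)%E,
      forall x : R, Num.sg x <= on_reals F x,
      {in `]-oo, 0[ &, {homo on_reals F : x y / x <= y}} &
      {in `]0, +oo[ &, {homo on_reals F : x y /~ x <= y}}].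

Definition sgn_gap (F : C -> C) : \bar R :=
  (\int[mu]_x (on_reals F x - Num.sg x)%:E)%E.

Definition cexp (z : C) : C :=
  (expR (complex.Re z))%:C * (cos (complex.Im z) +i* sin (complex.Im z)).

Definition csin (z : C) : C :=
  (cexp ('i%C * z) - cexp (- ('i%C * z))) / (2 * 'i%C).

(* sin^2(pi s) / (pi^2 s (s + 1)^2) with its two removable singularities
   filled in by the limits 0 at s = 0 and -1 at s = -1. *)
Definition kernel_fun (s : C) : C :=
  if s == 0 then 0
  else if s == - 1 then - 1
  else csin ((pi : R)%:C * s) ^+ 2 / ((pi : R)%:C ^+ 2 * s * (s + 1) ^+ 2).

Definition cintegral (D : set R) (f : R -> C) : C :=
  (\int[mu]_(t in D) complex.Re (f t)) +i* (\int[mu]_(t in D) complex.Im (f t)).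

Definition segment_integral (f : C -> C) (a b : C) : C :=
  cintegral `[0, 1] (fun t => f (a + t%:C * (b - a)) * (b - a)).

Definition path_integral_from_ninfty (f : C -> C) (z : C) : C :=
  cintegral `]-oo, 0] (fun t => f t%:C) + segment_integral f 0 z.

Definition extremal_majorant (z : C) : C :=
  - 2 * path_integral_from_ninfty kernel_fun z - 1.

End EntireFunctions.

(* Main.v *)
(* A majorant F is bounded on the real line, so |F'(z)| <= A exp(2 pi |Im z|).
   For 0 < l < 1 the function g(x) = - (l x + l) F'(l x) has type less than
   2 pi, and it is nonnegative outside (-1, 0), so Poisson summation, in Fejer
   means and after damping by a sinc^2 factor, bounds the sum of g over the
   integers by its integral; g(-1) = 0 because of the weight, and the integral
   is computed by parts, which gives
     l g(t) <= (integral of F - sgn) - 2 l        for every integer t <> -1.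
   As l tends to 1 this is the inequality, and equality forces F' to vanish at
   all integers except -1. There F' has double zeros since its sign is constant
   on each side of 0. Hence F'(z) z (z + 1)^2 / sin^2(pi z) is entire, of
   polynomial growth on the circles |z| = n + 1/2, thus a polynomial; as
   (y + 1) F'(y) is integrable it is a constant, and the limits of F at both
   ends of the line determine F. For the function M of the statement,
   x M'(x) = - 2 sinc^2(x + 1), so the integral of M - sgn reduces by parts to
   that of sinc^2. *)

Require Import Defs.
From HB Require Import structures.
From mathcomp Require Import all_boot all_order all_algebra.
From mathcomp Require Import all_classical all_reals all_analysis.
From mathcomp.real_closed Require Import complex.
From mathcomp Require Import measurable_realfun ring lra.

Import Order.TTheory GRing.Theory Num.Theory numFieldNormedType.Exports.

Set Implicit Arguments.
Unset Strict Implicit.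
Unset Printing Implicit Defensive.

Local Open Scope classical_set_scope.
Local Open Scope ring_scope.
Local Open Scope complex_scope.

(** * Complex differentiation and real integration *)

(** The dilation by l < 1 leaves room, below type 2 pi, for the type 2 pi ep of the damping factor
    sinc^2(ep x): the product still has type 2 pi (l + ep) < 2 pi, so its nonzero integer
    frequencies disappear when the contour is moved. The linear weight answers the sign change of F'
    at 0: - (x + 1) F'(x) can be negative only on (-1, 0), between two consecutive nodes, and the
    summand vanishes at both of them, at -1 by the weight and at 0 because F'(0) = 0. The 2 l comes
    from the boundary terms of the integration by parts, where F is compared with 1 and -1. Cauchy's
    theorem on rectangles is carried to circles by the exponential. The Fejer kernel K_N is then
    used three times: for Cauchy's formula, through Fourier coefficients on circles; for the Poisson
    summation; and for the integral of sinc^2, read off from sinc^2(x) K_N(x) = N sinc^2(N x). The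
    limit 1 of M at +oo comes from the total integral of the kernel, equal to -1 because the kernel
    is a telescoping difference minus sinc^2(s + 1). *)

Section Modulus.
Variable R : realType.
Implicit Types (z w : R[i]) (x y : R).

Lemma normE_cabs z : `|z| = (cabs z)%:C.
Proof. by case: z. Qed.

Lemma cabs_ge0 z : 0 <= cabs z.
Proof. by case: z => a b; exact: sqrtr_ge0. Qed.

Lemma cabs0 : cabs (0 : R[i]) = 0. Proof. exact: Normc.normc0. Qed.
Lemma cabs1 : cabs (1 : R[i]) = 1. Proof. exact: Normc.normc1. Qed.
Lemma cabsM z w : cabs (z * w) = cabs z * cabs w.
Proof. exact: Normc.normcM. Qed.
Lemma cabsV z : cabs z^-1 = (cabs z)^-1.
Proof. exact: Normc.normcV. Qed.
Lemma cabsN z : cabs (- z) = cabs z. Proof. exact: normcN. Qed.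
Lemma cabsD z w : cabs (z + w) <= cabs z + cabs w.
Proof. exact: le_normcD. Qed.
Lemma cabsB z w : cabs (z - w) <= cabs z + cabs w.
Proof. by rewrite -(cabsN w) cabsD. Qed.
Lemma cabsC z w : cabs (z - w) = cabs (w - z).
Proof. by rewrite -cabsN opprB. Qed.
Lemma cabs_sub_le z w : cabs z - cabs w <= cabs (z - w).
Proof. by rewrite lerBlDr -{1}(subrK w z) cabsD. Qed.
Lemma cabsX z n : cabs (z ^+ n) = cabs z ^+ n.
Proof. by elim: n => [|n IH]; rewrite ?expr0 ?cabs1// !exprS cabsM IH. Qed.

Lemma cabs_eq0 z : (cabs z == 0) = (z == 0).
Proof.
by apply/eqP/eqP => [|->]; [exact: Normc.eq0_normc|exact: cabs0].
Qed.

Lemma cabs_gt0 z : (0 < cabs z) = (z != 0).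
Proof. by rewrite lt_neqAle cabs_ge0 andbT eq_sym cabs_eq0. Qed.

Lemma cabs_real x : cabs x%:C = `|x|.
Proof. by rewrite /cabs /= expr0n /= addr0 sqrtr_sqr. Qed.

Lemma cabs_sqr z : cabs z ^+ 2 = complex.Re z ^+ 2 + complex.Im z ^+ 2.
Proof. by case: z => a b; rewrite /cabs /= sqr_sqrtr// addr_ge0 ?sqr_ge0. Qed.

Lemma Re_le_cabs z : `|complex.Re z| <= cabs z.
Proof.
rewrite -(ler_pXn2r (_ : (0 < 2)%N)) ?nnegrE ?cabs_ge0//.
by rewrite cabs_sqr real_normK ?num_real// lerDl sqr_ge0.
Qed.

Lemma Im_le_cabs z : `|complex.Im z| <= cabs z.
Proof.
rewrite -(ler_pXn2r (_ : (0 < 2)%N)) ?nnegrE ?cabs_ge0//.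
by rewrite cabs_sqr real_normK ?num_real// lerDr sqr_ge0.
Qed.

Lemma cabs_le_ReIm z : cabs z <= `|complex.Re z| + `|complex.Im z|.
Proof.
rewrite -(ler_pXn2r (_ : (0 < 2)%N)) ?nnegrE ?cabs_ge0 ?addr_ge0//.
rewrite cabs_sqr sqrrD !real_normK ?num_real//.
by rewrite -[leLHS]addr0 -addrA [leRHS]addrAC -addrA lerD2l lerD2l mulrn_wge0// mulr_ge0.
Qed.

Lemma cabs_i : cabs ('i : R[i]) = 1.
Proof. by rewrite /cabs /= expr0n /= add0r expr1n sqrtr1. Qed.

Lemma complex_ext z w : complex.Re z = complex.Re w ->
  complex.Im z = complex.Im w -> z = w.
Proof. by case: z w => [a b] [c d] /= -> ->. Qed.

Lemma ReD z w : complex.Re (z + w) = complex.Re z + complex.Re w.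
Proof. by case: z w => [a b] [c d]. Qed.
Lemma ImD z w : complex.Im (z + w) = complex.Im z + complex.Im w.
Proof. by case: z w => [a b] [c d]. Qed.
Lemma ReN z : complex.Re (- z) = - complex.Re z.
Proof. by case: z. Qed.
Lemma ImN z : complex.Im (- z) = - complex.Im z.
Proof. by case: z. Qed.
Lemma ReM z w : complex.Re (z * w) =
  complex.Re z * complex.Re w - complex.Im z * complex.Im w.
Proof. by case: z w => [a b] [c d]. Qed.
Lemma ImM z w : complex.Im (z * w) =
  complex.Re z * complex.Im w + complex.Im z * complex.Re w.
Proof. by case: z w => [a b] [c d]. Qed.
Lemma ReMr x z : complex.Re (x%:C * z) = x * complex.Re z.
Proof. by rewrite ReM /= mul0r subr0. Qed.
Lemma ImMr x z : complex.Im (x%:C * z) = x * complex.Im z.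
Proof. by rewrite ImM /= mul0r addr0. Qed.

Lemma realCD x y : (x + y)%:C = x%:C + y%:C :> R[i]. Proof. exact: rmorphD. Qed.
Lemma realCB x y : (x - y)%:C = x%:C - y%:C :> R[i]. Proof. exact: rmorphB. Qed.
Lemma realCM x y : (x * y)%:C = x%:C * y%:C :> R[i]. Proof. exact: rmorphM. Qed.
Lemma realCN x : (- x)%:C = - x%:C :> R[i]. Proof. exact: rmorphN. Qed.
Lemma realCV x : (x^-1)%:C = (x%:C)^-1 :> R[i]. Proof. exact: fmorphV. Qed.
Lemma realCX x n : (x ^+ n)%:C = x%:C ^+ n :> R[i]. Proof. exact: rmorphXn. Qed.
Lemma realC_nat n : (n%:R)%:C = n%:R :> R[i]. Proof. exact: rmorph_nat. Qed.
Lemma realC_eq0 x : (x%:C == 0 :> R[i]) = (x == 0).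
Proof. by rewrite -[0]/(0%:C) (inj_eq (@complexI R)). Qed.

Lemma cabs_nat n : cabs (n%:R : R[i]) = n%:R.
Proof. by rewrite -realC_nat cabs_real ger0_norm. Qed.

End Modulus.

Arguments cabs : simpl never.

(** * Complex differentiability in epsilon-delta form *)

Section ComplexDerivative.
Variable R : realType.
Local Notation C := R[i].
Implicit Types (f g : C -> C) (z d : C).

(** The bound contains no quotient, covers [h = 0], and takes [e] and [del] in R, so that estimates
    are made with real moduli only. *)
Definition cder f z d := forall e : R, 0 < e -> exists2 del : R, 0 < del &
  forall h : C, cabs h < del -> cabs (f (z + h) - f z - d * h) <= e * cabs h.

(** A radius of a ball in C is an element of C, positive exactly when it is a positive real; this
    trades it for an element of R. *)
Lemma cnear0 (P : C -> Prop) : (\forall h \near (0 : C^o)^', P h) <->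
  exists2 del : R, 0 < del & forall h : C, h != 0 -> cabs h < del -> P h.
Proof.
split.
  move=> /nbhs_ballP [e /= e0 eP].
  have e'0 : 0 < complex.Re e by move: e0; rewrite ltcE => /andP[].
  exists (complex.Re e) => // h h0 hd; apply: eP => //.
  rewrite -ball_normE /ball_/= sub0r normrN normE_cabs.
  by move: e0 hd; rewrite !ltcE => /andP[/= /eqP ->] _ ->; rewrite eqxx.
case=> d d0 dP; apply/nbhs_ballP; exists d%:C; first by rewrite /= ltcR.
move=> h; rewrite -ball_normE /ball_/= sub0r normrN normE_cabs ltcR => hd h0.
exact: dP.
Qed.

Lemma cderP f z d : cder f z d <-> is_derive (z : C^o) 1 (f : C^o -> C^o) d.
Proof.
have E : cder f z d <-> ((fun h : C^o => h^-1 *: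
    (((f : C^o -> C^o) \o shift (z : C^o)) (h *: (1 : C^o)) - f z)) @ (0 : C^o)^' --> (d : C^o)).
  split.
    move=> fd; apply/cvgrPdist_le => e e0.
    have [e'0 eE] : 0 < complex.Re e /\ e = (complex.Re e)%:C.
      move: e0; rewrite ltcE => /andP[/= /eqP i0 ?]; split => //.
      by apply: complex_ext.
    apply/cnear0; have [del del0 H] := fd _ e'0; exists del => // h h0 hd.
    have := H h hd; rewrite normE_cabs eE lecR /=.
    rewrite -[h *: _]/(h * 1) mulr1 (addrC h) => /(ler_wpM2l (_ : 0 <= cabs h^-1)) K.
    have {K} := K (cabs_ge0 _); rewrite -cabsM [leRHS]mulrCA cabsV mulVf ?cabs_eq0// mulr1.
    by rewrite cabsC mulrBr [h^-1 * (d * h)]mulrC mulfK.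
  move/cvgrPdist_le => H e e0; have := H e%:C; rewrite ltcR => /(_ e0) /cnear0 [del del0 K].
  exists del => // h hd; have [->|h0] := eqVneq h 0.
    by rewrite addr0 mulr0 subrr subr0 cabs0 mulr0.
  have := K h h0 hd; rewrite normE_cabs lecR /= -[h *: 1]/(h * 1) mulr1 (addrC h).
  move=> /(ler_wpM2r (cabs_ge0 h)); rewrite -cabsM cabsC mulrBl.
  by rewrite -[h^-1 *: _]/(h^-1 * _) mulrAC mulVf// mul1r.
rewrite E; split.
  by move=> H; apply: DeriveDef; [apply/cvg_ex; exists d|exact: cvg_lim].
by case=> fd <-; exact: fd.
Qed.

Lemma entireP f : entire f <-> forall z, exists d, cder f z d.
Proof.
split=> H z; first by exists ('D_1 (f : C^o -> C^o) z); apply/cderP/derivableP/H.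
by have [d /cderP[]] := H z.
Qed.

Lemma cder_cst c z : cder (fun=> c) z 0.
Proof. by apply/cderP; exact: is_derive_cst. Qed.

Lemma cder_id z : cder id z 1.
Proof. by apply/cderP; exact: is_derive_id. Qed.

Lemma cderD f g z d d' : cder f z d -> cder g z d' ->
  cder (fun z => f z + g z) z (d + d').
Proof. by move=> /cderP ? /cderP ?; apply/cderP; exact: is_deriveD. Qed.

Lemma cderN f z d : cder f z d -> cder (fun z => - f z) z (- d).
Proof. by move=> /cderP ?; apply/cderP; exact: is_deriveN. Qed.

Lemma cderB f g z d d' : cder f z d -> cder g z d' ->
  cder (fun z => f z - g z) z (d - d').
Proof. by move=> fd gd; apply: cderD => //; exact: cderN. Qed.

Lemma cderM f g z d d' : cder f z d -> cder g z d' ->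
  cder (fun z => f z * g z) z (f z * d' + g z * d).
Proof. by move=> /cderP ? /cderP ?; apply/cderP; exact: is_deriveM. Qed.

Lemma cderV f z d : f z != 0 -> cder f z d ->
  cder (fun z => (f z)^-1) z (- (f z) ^- 2 * d).
Proof.
move=> fz /cderP ?; apply/cderP; apply: DeriveDef; first exact: derivableV.
by rewrite deriveV// derive_val.
Qed.

Lemma cder_cont f z d : cder f z d -> forall e : R, 0 < e ->
  exists2 del : R, 0 < del & forall h, cabs h < del -> cabs (f (z + h) - f z) < e.
Proof.
move=> fd e e0; have [del del0 H] := fd 1 ltr01.
have k0 : 0 < 1 + cabs d by rewrite ltr_pwDl ?cabs_ge0.
exists (Num.min del (e / (1 + cabs d))); first by rewrite lt_min del0 divr_gt0.
move=> h; rewrite lt_min ltr_pdivlMr// => /andP[/H hd he].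
rewrite -[f (z + h) - f z](subrK (d * h)); apply: (le_lt_trans (cabsD _ _)).
apply: le_lt_trans he; rewrite cabsM mulrDr mulr1 [cabs h * _]mulrC.
by rewrite lerD2r (le_trans hd)// mul1r.
Qed.

Lemma cder_comp f g z d d' : cder f z d -> cder g (f z) d' ->
  cder (fun z => g (f z)) z (d' * d).
Proof.
move=> fd gd e e0.
have k0 : 0 < 1 + cabs d by rewrite ltr_pwDl ?cabs_ge0.
have k1 : 0 < 1 + cabs d' by rewrite ltr_pwDl ?cabs_ge0.
have e1 : 0 < e / 2 / (1 + cabs d) by rewrite !divr_gt0.
have e2 : 0 < e / 2 / (1 + cabs d') by rewrite !divr_gt0.
have [d1 d10 H1] := gd _ e1.
have [d2 d20 H2] := cder_cont fd d10.
have [d3 d30 H3] := fd _ e2.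
have [d4 d40 H4] := fd _ ltr01.
exists (Num.min d2 (Num.min d3 d4)); first by rewrite !lt_min d20 d30.
move=> h; rewrite !lt_min => /and3P[h2 h3 h4].
have := H1 _ (H2 _ h2); rewrite subrKC => K1.
have := H3 _ h3 => K3.
have := H4 _ h4; rewrite mul1r => K4.
set u := f (z + h) - f z in K1 K3 K4 *.
(* The remainder of [g] at the increment [u], plus [d'] times the remainder of [f]; each receives
   half of [e]. *)
have -> : g (f (z + h)) - g (f z) - d' * d * h =
  (g (f (z + h)) - g (f z) - d' * u) + d' * (u - d * h) by ring.
have K5 : cabs u <= (1 + cabs d) * cabs h.
  by rewrite -[u](subrK (d * h)) (le_trans (cabsD _ _))// cabsM mulrDl mul1r lerD2r.
apply: (le_trans (cabsD _ _)); rewrite cabsM [e * _](_ : _ = e / 2 * cabs h + e / 2 * cabs h); last by field.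
apply: lerD.
  apply: (le_trans K1); apply: (le_trans (ler_wpM2l (ltW e1) K5)).
  by rewrite mulrA divfK// gt_eqF.
apply: (le_trans (ler_wpM2l (cabs_ge0 _) K3)).
rewrite mulrA ler_wpM2r ?cabs_ge0//.
rewrite mulrA ler_pdivrMr// [cabs d' * _]mulrC ler_wpM2l ?lerDr//.
by rewrite ltW// divr_gt0.
Qed.

Lemma cder_eq f z d d' : cder f z d -> d = d' -> cder f z d'.
Proof. by move=> ? <-. Qed.

Lemma cder_near f g z d (r : R) : 0 < r ->
  (forall w, cabs (w - z) < r -> f w = g w) -> cder f z d -> cder g z d.
Proof.
move=> r0 fg fd e e0; have [del del0 H] := fd e e0.
exists (Num.min del r); first by rewrite lt_min del0.
move=> h; rewrite lt_min => /andP[h1 h2].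
rewrite -!fg ?subrr ?cabs0//; first exact: H.
by rewrite addrC addKr.
Qed.

End ComplexDerivative.

(** * Real derivatives and continuity *)

Section RealDerivative.
Variable R : realType.
Implicit Types (f g : R -> R) (x y c d : R).

(* Not a type class, unlike [is_derive]: no instance search on these goals. *)
Definition rder f x d : Prop := is_derive x 1 f d.

Lemma rder_cst c x : rder (fun=> c) x 0. Proof. exact: is_derive_cst. Qed.
Lemma rder_id x : rder id x 1. Proof. exact: is_derive_id. Qed.

Lemma rderD f g x d d' : rder f x d -> rder g x d' ->
  rder (fun x => f x + g x) x (d + d').
Proof. exact: is_deriveD. Qed.

Lemma rderN f x d : rder f x d -> rder (fun x => - f x) x (- d).
Proof. exact: is_deriveN. Qed.

Lemma rderB f g x d d' : rder f x d -> rder g x d' ->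
  rder (fun x => f x - g x) x (d - d').
Proof. exact: is_deriveB. Qed.

Lemma rderM f g x d d' : rder f x d -> rder g x d' ->
  rder (fun x => f x * g x) x (f x * d' + g x * d).
Proof. exact: is_deriveM. Qed.

Lemma rderZ c f x d : rder f x d -> rder (fun x => c * f x) x (c * d).
Proof. exact: is_deriveZ. Qed.

Lemma rder_comp f g x d d' : rder f x d -> rder g (f x) d' ->
  rder (fun x => g (f x)) x (d' * d).
Proof. by move=> fd gd; exact: is_derive1_comp. Qed.

Lemma rder_affine c d x : rder (fun x => c * x + d) x c.
Proof.
by have := rderD (rderZ c (rder_id x)) (rder_cst d x); rewrite mulr1 addr0.
Qed.

Lemma rder_eq f x d d' : rder f x d -> d = d' -> rder f x d'.
Proof. by move=> ? <-. Qed.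

Lemma rder_continuous f x d : rder f x d -> {for x, continuous f}.
Proof.
by move=> [fd _]; apply: differentiable_continuous; apply/derivable1_diffP.
Qed.

Lemma rder_unique f x d d' : rder f x d -> rder f x d' -> d = d'.
Proof. by move=> [_ <-] [_ <-]. Qed.

Lemma derivable_rder f x : derivable f x 1 -> rder f x (f^`()%classic x).
Proof. by move=> df; apply: DeriveDef => //; rewrite derive1E. Qed.

Lemma near_rder f g x d : (\near x, f x = g x) -> rder f x d -> rder g x d.
Proof. exact: near_eq_is_derive. Qed.

Lemma cnst c : continuous (fun _ : R => c). Proof. by move=> ?; exact: cvg_cst. Qed.
Lemma cntD f g : continuous f -> continuous g -> continuous (fun x => f x + g x).
Proof. by move=> cf cg x; apply: continuousD; [exact: cf|exact: cg]. Qed.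
Lemma cntM f g : continuous f -> continuous g -> continuous (fun x => f x * g x).
Proof. by move=> cf cg x; apply: continuousM; [exact: cf|exact: cg]. Qed.
Lemma cntN f : continuous f -> continuous (fun x => - f x).
Proof. by move=> cf x; apply: continuousN; exact: cf. Qed.
Lemma cntB f g : continuous f -> continuous g -> continuous (fun x => f x - g x).
Proof. by move=> cf cg; apply: cntD => //; exact: cntN. Qed.

Lemma cnt_comp f g : continuous f -> continuous g -> continuous (fun x => g (f x)).
Proof. by move=> cf cg x; apply: continuous_comp; [exact: cf|exact: cg]. Qed.
Lemma cnt_affine (c d : R) : continuous (fun x => c * x + d).
Proof. by move=> x; exact: rder_continuous (rder_affine c d x). Qed.

End RealDerivative.

(** * Oriented integrals of continuous functions *)

Section RealIntegral.
Variable R : realType.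
Implicit Types (f g F : R -> R) (a b c x y : R).
Local Notation mu := (@lebesgue_measure R).

(** Oriented, so that additivity holds for endpoints in any order and affine changes of variable may
    reverse the interval. *)
Definition intR f a b : R :=
  if a <= b then \int[mu]_(x in `[a, b]) f x else - \int[mu]_(x in `[b, a]) f x.

Lemma continuous_itv_integrable f a b : continuous f ->
  mu.-integrable `[a, b] (EFin \o f).
Proof.
move=> cf; apply: continuous_compact_integrable; first exact: segment_compact.
exact: continuous_subspaceT.
Qed.

Lemma intR_FTC f F a b : continuous f -> (forall x, rder F x (f x)) ->
  intR f a b = F b - F a.
Proof.
move=> cf dF; have cF : continuous F by move=> x; exact: rder_continuous (dF x).
have H c d : c <= d -> \int[mu]_(x in `[c, d]) f x = F d - F c.
  rewrite le_eqVlt => /predU1P[->|cd].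
    by rewrite set_itv1 Rintegral_set1 subrr.
  rewrite /Rintegral (@continuous_FTC2 _ f F)//.
  - exact: continuous_subspaceT.
  - split.
    + by move=> x _; have [] := dF x.
    + exact: cvg_at_right_filter (cF c).
    + exact: cvg_at_left_filter (cF d).
  - by move=> x _; rewrite derive1E; have [_ ->] := dF x.
rewrite /intR; case: (leP a b) => ab; first exact: H.
by rewrite H ?ltW// opprB.
Qed.

Lemma intR_is_derive f : continuous f -> forall x, rder (intR f 0) x (f x).
Proof.
(* The lower bound [- c] lies to the left of both 0 and [x], so one integral [G] from [- c] gives
   the derivative whatever the sign of [x]. *)
move=> cf x; pose c : R := `|x| + 1.
have c0 : 0 < c by rewrite ltr_wpDl.
have cx : - c < x by rewrite /c ltrNl (le_lt_trans (ler_norm _))// normrN ltrDl.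
pose G y := \int[mu]_(t in `[- c, y]) f t.
have GE y : - c < y -> intR f 0 y = G y - G 0.
  move=> cy; rewrite /intR; case: (leP 0 y) => y0.
    rewrite /G Rintegral_itvB ?bnd_simp//; first by rewrite Rintegral_itv_obnd_cbnd//;
      apply: integrableS (continuous_itv_integrable 0 y cf) => //; exact: subset_itv_oc_cc.
    - exact: continuous_itv_integrable.
    - by rewrite ltW// oppr_lt0.
  rewrite -opprB; congr (- _); rewrite /G Rintegral_itvB ?bnd_simp//.
  - rewrite Rintegral_itv_obnd_cbnd//;
    apply: integrableS (continuous_itv_integrable y 0 cf) => //; exact: subset_itv_oc_cc.
  - exact: continuous_itv_integrable.
  - exact: ltW.
  - exact: ltW.
have [dG GD] := @continuous_FTC1_closed R f (- c) x (x + 1) (ltac:(by rewrite ltrDl))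
  (continuous_itv_integrable _ _ cf) cx (cf x).
have dG' : rder G x (f x) by rewrite -GD; exact: derivable_rder.
have := rderB dG' (rder_cst (G 0) x); rewrite subr0; apply: near_rder.
near=> y; rewrite /= GE//.
near: y; exact: lt_nbhsr.
Unshelve. all: by end_near. Qed.

(** Reduces identities between oriented integrals to algebra on a single primitive. *)
Lemma intRE f a b : continuous f -> intR f a b = intR f 0 b - intR f 0 a.
Proof. move=> cf; exact (@intR_FTC f (intR f 0) a b cf (intR_is_derive cf)). Qed.

Lemma intR_chasles f b a c : continuous f -> intR f a b + intR f b c = intR f a c.
Proof.
by move=> cf; rewrite (intRE a b cf) (intRE b c cf) (intRE a c cf) addrC subrKA.
Qed.

Lemma intR_swap f a b : continuous f -> intR f b a = - intR f a b.
Proof. by move=> cf; rewrite (intRE a b cf) (intRE b a cf) opprB. Qed.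

Lemma intR_le f g a b : continuous f -> continuous g -> a <= b ->
  (forall x, a <= x <= b -> f x <= g x) -> intR f a b <= intR g a b.
Proof.
move=> cf cg ab fg; rewrite /intR ab; apply: le_Rintegral => //; exact: continuous_itv_integrable.
Qed.

Lemma intR_cst c a b : intR (fun=> c) a b = c * (b - a).
Proof.
rewrite (@intR_FTC _ (fun x => c * x + 0)) ?addr0 ?mulrBr//; first exact: cnst.
by move=> x; exact: rder_affine.
Qed.

Lemma intR_ge0 f a b : continuous f -> a <= b ->
  (forall x, a <= x <= b -> 0 <= f x) -> 0 <= intR f a b.
Proof.
move=> cf ab f0; rewrite -[leLHS](mul0r (b - a)) -intR_cst.
by apply: intR_le => //; exact: cnst.
Qed.

Lemma intRD f g a b : continuous f -> continuous g ->
  intR (fun x => f x + g x) a b = intR f a b + intR g a b.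
Proof.
move=> cf cg; rewrite (@intR_FTC _ (fun x => intR f 0 x + intR g 0 x) a b (cntD cf cg)
  (fun x => rderD (intR_is_derive cf x) (intR_is_derive cg x))).
by rewrite (intRE a b cf) (intRE a b cg) /=; ring.
Qed.

Lemma intRZ c f a b : continuous f ->
  intR (fun x => c * f x) a b = c * intR f a b.
Proof.
move=> cf; rewrite (@intR_FTC _ (fun x => c * intR f 0 x) a b (cntM (@cnst R c) cf)
  (fun x => rderZ c (intR_is_derive cf x))).
by rewrite (intRE a b cf) mulrBr.
Qed.

Lemma intRN f a b : continuous f -> intR (fun x => - f x) a b = - intR f a b.
Proof.
move=> cf; rewrite -mulN1r -intRZ//; congr (intR _ _ _).
by apply/funext => x; rewrite mulN1r.
Qed.

Lemma intRB f g a b : continuous f -> continuous g ->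
  intR (fun x => f x - g x) a b = intR f a b - intR g a b.
Proof. by move=> cf cg; rewrite intRD ?intRN//; exact: cntN. Qed.

Lemma intR_affine f c d a b : continuous f ->
  c * intR (fun x => f (c * x + d)) a b = intR f (c * a + d) (c * b + d).
Proof.
move=> cf; have cA := cnt_comp (@cnt_affine R c d) cf.
rewrite -intRZ// (@intR_FTC _ (fun x => intR f 0 (c * x + d))).
- by rewrite /= -intRE.
- exact: cntM (@cnst R c) cA.
- move=> x; apply: rder_eq (mulrC _ _).
  exact: rder_comp (rder_affine c d x) (intR_is_derive cf _).
Qed.

Lemma intR_parts F G f g a b : continuous f -> continuous g ->
  (forall x, rder F x (f x)) -> (forall x, rder G x (g x)) ->
  intR (fun x => f x * G x) a b = F b * G b - F a * G a - intR (fun x => F x * g x) a b.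
Proof.
move=> cf cg dF dG.
have cF : continuous F by move=> x; exact: rder_continuous (dF x).
have cG : continuous G by move=> x; exact: rder_continuous (dG x).
have c1 := cntM cf cG; have c2 := cntM cF cg.
apply: (@addIr _ (intR (fun x => F x * g x) a b)); rewrite subrK -intRD//.
apply: (@intR_FTC _ (fun x => F x * G x)); first exact: cntD.
by move=> x; apply: rder_eq (rderM (dF x) (dG x)) _; rewrite addrC mulrC.
Qed.

End RealIntegral.

(** * Integrals of complex-valued functions of a real variable *)

Section ComplexIntegral.
Variable R : realType.
Local Notation C := R[i].
Implicit Types (f g G : R -> C) (a b c x y : R).

Lemma continuousP_eps (f : R -> R) x : {for x, continuous f} <->
  forall e : R, 0 < e -> exists2 del : R, 0 < del &
    forall y, `|y - x| < del -> `|f y - f x| < e.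
Proof.
split.
  move=> /cvgrPdist_lt H e e0; have /nbhs_ballP[del /= d0 K] := H e e0.
  exists del => // y xy; rewrite distrC; apply: K.
  by rewrite -ball_normE /ball_/= distrC.
move=> H; apply/cvgrPdist_lt => e e0; have [del d0 K] := H e e0.
apply/nbhs_ballP; exists del => // y; rewrite -?ball_normE /ball_/= => xy.
by rewrite distrC K// distrC.
Qed.

Lemma rder_eps (f : R -> R) x d :
  (forall e : R, 0 < e -> exists2 del : R, 0 < del &
    forall h, `|h| < del -> `|f (x + h) - f x - d * h| <= e * `|h|) -> rder f x d.
Proof.
move=> H.
have E : (fun h : R => h^-1 *: ((f \o shift x) (h *: (1 : R)) - f x)) @ (0 : R)^' --> d.
  apply/cvgrPdist_le => e e0; have [del d0 K] := H e e0.
  apply/nbhs_ballP; exists del => // h; rewrite -?ball_normE /ball_/= sub0r normrN => hd h0.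
  have := K h hd; rewrite -[h *: _]/(h * 1) mulr1 (addrC h).
  rewrite -[h^-1 *: _]/(h^-1 * _) -ler_pdivrMr ?normr_gt0// -normf_div distrC.
  by rewrite mulrBl mulfK// mulrC.
by apply: DeriveDef; [apply/cvg_ex; exists d|exact: cvg_lim].
Qed.

Definition ccont f := continuous (@complex.Re R \o f) /\ continuous (@complex.Im R \o f).

Definition cint f a b : C :=
  intR (@complex.Re R \o f) a b +i* intR (@complex.Im R \o f) a b.

Definition rcder f x (d : C) := rder (@complex.Re R \o f) x (complex.Re d) /\
  rder (@complex.Im R \o f) x (complex.Im d).

Lemma rcder_eps f x d :
  (forall e : R, 0 < e -> exists2 del : R, 0 < del &
    forall h, `|h| < del -> cabs (f (x + h) - f x - d * h%:C) <= e * `|h|) ->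
  rcder f x d.
Proof.
move=> H; split; apply: rder_eps => e /H[del d0 K]; exists del => // h /K;
  apply: le_trans.
- by apply: le_trans (Re_le_cabs _); rewrite !(ReD, ReN) [d * _]mulrC ReMr [h * _]mulrC.
- by apply: le_trans (Im_le_cabs _); rewrite !(ImD, ImN) [d * _]mulrC ImMr [h * _]mulrC.
Qed.

Lemma cder_line (F : C -> C) (z w d : C) x : cder F (z + x%:C * w) d ->
  rcder (fun t => F (z + t%:C * w)) x (d * w).
Proof.
move=> Fd; apply: rcder_eps => e e0.
have k0 : 0 < 1 + cabs w by rewrite ltr_pwDl ?cabs_ge0.
have [del d0 K] := Fd _ (divr_gt0 e0 k0).
exists (del / (1 + cabs w)); first by rewrite divr_gt0.
move=> h; rewrite ltr_pdivlMr// => hd.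
have hw : cabs (h%:C * w) <= `|h| * (1 + cabs w).
  by rewrite cabsM cabs_real ler_wpM2l// lerDr.
have := K (h%:C * w) (le_lt_trans hw hd).
rewrite realCD mulrDl addrA (_ : d * (h%:C * w) = d * w * h%:C); last by ring.
move=> /le_trans; apply.
apply: (le_trans (ler_wpM2l (ltW (divr_gt0 e0 k0)) hw)).
by rewrite mulrCA divfK ?gt_eqF// mulrC.
Qed.

Lemma cder_real (F : C -> C) d x : cder F x%:C d -> rcder (fun t => F t%:C) x d.
Proof.
move=> Fd; have /cder_line : cder F (0 + x%:C * 1) d by rewrite mulr1 add0r.
by rewrite mulr1; under eq_fun do rewrite mulr1 add0r.
Qed.

Lemma rcder_ccont f g : (forall x, rcder f x (g x)) -> ccont f.
Proof.
by move=> H; split=> x; [exact: rder_continuous (H x).1|exact: rder_continuous (H x).2].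
Qed.

Lemma entire_ccont (F : C -> C) (z w : C) : entire F ->
  ccont (fun t => F (z + t%:C * w)).
Proof.
move=> /entireP H; have [F' F'E] := choice H.
by apply: rcder_ccont => x; exact: cder_line.
Qed.

Lemma entire_ccont_real (F : C -> C) : entire F -> ccont (fun t => F t%:C).
Proof.
move=> /(@entire_ccont F 0 1); by under eq_fun do rewrite mulr1 add0r.
Qed.

Lemma ccontD f g : ccont f -> ccont g -> ccont (fun x => f x + g x).
Proof.
move=> [fr fi] [gr gi]; split.
- rewrite (_ : _ \o _ = fun x => complex.Re (f x) + complex.Re (g x)); first exact: cntD.
  by apply/funext => x; rewrite /= ReD.
- rewrite (_ : _ \o _ = fun x => complex.Im (f x) + complex.Im (g x)); first exact: cntD.
  by apply/funext => x; rewrite /= ImD.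
Qed.

Lemma ccontM f g : ccont f -> ccont g -> ccont (fun x => f x * g x).
Proof.
move=> [fr fi] [gr gi]; split.
- rewrite (_ : _ \o _ = fun x => complex.Re (f x) * complex.Re (g x)
    - complex.Im (f x) * complex.Im (g x)); first exact: (cntB (cntM fr gr) (cntM fi gi)).
  by apply/funext => x; rewrite /= ReM.
- rewrite (_ : _ \o _ = fun x => complex.Re (f x) * complex.Im (g x)
    + complex.Im (f x) * complex.Re (g x)); first exact: (cntD (cntM fr gi) (cntM fi gr)).
  by apply/funext => x; rewrite /= ImM.
Qed.

Lemma ccont_cst (z : C) : ccont (fun=> z).
Proof. by split; exact: cnst. Qed.

Lemma ccont_real (f : R -> R) : continuous f -> ccont (fun x => (f x)%:C).
Proof. by move=> cf; split; [exact: cf|exact: cnst]. Qed.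

Lemma ccont_cabs f : ccont f -> continuous (fun x => cabs (f x)).
Proof.
move=> [fr fi] x; apply/continuousP_eps => e e0.
have [d1 d10 H1] := (continuousP_eps _ _).1 (fr x) (e / 2) (divr_gt0 e0 (ltr0n _ 2)).
have [d2 d20 H2] := (continuousP_eps _ _).1 (fi x) (e / 2) (divr_gt0 e0 (ltr0n _ 2)).
exists (Num.min d1 d2) => [|y]; first by rewrite lt_min d10.
rewrite lt_min => /andP[/H1 h1 /H2 h2].
apply: (@le_lt_trans _ _ (cabs (f y - f x))).
  rewrite ler_norml lerNl opprB (cabsC (f y)) cabs_sub_le /= (cabsC (f x)).
  exact: cabs_sub_le.
apply: (le_lt_trans (cabs_le_ReIm _)).
by rewrite !(ReD, ImD, ReN, ImN) [e]splitr ltrD.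
Qed.

Lemma cint_FTC f G a b : ccont f -> (forall x, rcder G x (f x)) ->
  cint f a b = G b - G a.
Proof.
move=> [fr fi] GD; rewrite /cint (@intR_FTC _ _ (@complex.Re R \o G) a b fr (fun x => (GD x).1)).
rewrite (@intR_FTC _ _ (@complex.Im R \o G) a b fi (fun x => (GD x).2)) /=.
by apply: complex_ext; rewrite /= !(ReD, ReN, ImD, ImN).
Qed.

Lemma cintD f g a b : ccont f -> ccont g ->
  cint (fun x => f x + g x) a b = cint f a b + cint g a b.
Proof.
move=> [fr fi] [gr gi]; apply: complex_ext; rewrite /= ?ReD ?ImD /= -intRD//; congr intR.
- by apply/funext => x; rewrite /= ReD.
- by apply/funext => x; rewrite /= ImD.
Qed.

Lemma cintZ (z : C) f a b : ccont f -> cint (fun x => z * f x) a b = z * cint f a b.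
Proof.
case: z => u v [fr fi]; apply: complex_ext.
- rewrite ReM /= -!intRZ// -intRB; [|exact: cntM (@cnst R _) _ ..].
  by congr intR; apply/funext => x; rewrite /= ReM.
- rewrite ImM /= -!intRZ// -intRD; [|exact: cntM (@cnst R _) _ ..].
  by congr intR; apply/funext => x; rewrite /= ImM.
Qed.

Lemma cintZr (z : C) f a b : ccont f -> cint (fun x => f x * z) a b = cint f a b * z.
Proof. by move=> cf; rewrite mulrC -cintZ//; congr cint; apply/funext => x; rewrite mulrC. Qed.

Lemma cintN f a b : ccont f -> cint (fun x => - f x) a b = - cint f a b.
Proof.
by move=> cf; rewrite -mulN1r -cintZ//; congr cint; apply/funext => x; rewrite mulN1r.
Qed.

Lemma ccontN f : ccont f -> ccont (fun x => - f x).
Proof.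
move=> cf; have := ccontM (ccont_cst (- 1)) cf.
by under eq_fun do rewrite mulN1r.
Qed.

Lemma ccontB f g : ccont f -> ccont g -> ccont (fun x => f x - g x).
Proof. by move=> cf cg; apply: ccontD => //; exact: ccontN. Qed.

Lemma cintB f g a b : ccont f -> ccont g ->
  cint (fun x => f x - g x) a b = cint f a b - cint g a b.
Proof. by move=> cf cg; rewrite cintD ?cintN//; exact: ccontN. Qed.

Lemma ccont_sum n (F : nat -> R -> C) : (forall i, ccont (F i)) ->
  ccont (fun x => \sum_(i < n) F i x).
Proof.
move=> cF; elim: n => [|n IH].
  by under eq_fun do rewrite big_ord0; exact: ccont_cst.
by under eq_fun do rewrite big_ord_recr/=; exact: ccontD.
Qed.

Lemma cint_sum n (F : nat -> R -> C) a b : (forall i, ccont (F i)) ->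
  cint (fun x => \sum_(i < n) F i x) a b = \sum_(i < n) cint (F i) a b.
Proof.
move=> cF; elim: n => [|n IH].
  rewrite big_ord0; under eq_fun do rewrite big_ord0.
  by apply: complex_ext; rewrite /= intR_cst mul0r.
rewrite big_ord_recr /= -IH -cintD//; last exact: ccont_sum.
by under eq_fun do rewrite big_ord_recr.
Qed.

Lemma cint_chasles f b a c : ccont f -> cint f a b + cint f b c = cint f a c.
Proof.
by move=> [fr fi]; apply: complex_ext; rewrite ?ReD ?ImD /= intR_chasles.
Qed.

Lemma cint_swap f a b : ccont f -> cint f b a = - cint f a b.
Proof.
by move=> [fr fi]; apply: complex_ext; rewrite ?ReN ?ImN /= intR_swap.
Qed.

Lemma cint_cst (z : C) a b : cint (fun=> z) a b = z * (b - a)%:C.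
Proof.
case: z => u v; apply: complex_ext; rewrite ?ReM ?ImM /= intR_cst ?mulr0 ?subr0//.
by rewrite add0r.
Qed.

Lemma cint_affine f c d a b : ccont f ->
  c%:C * cint (fun x => f (c * x + d)) a b = cint f (c * a + d) (c * b + d).
Proof.
move=> [fr fi]; apply: complex_ext; rewrite ?ReMr ?ImMr /=.
- by rewrite -[RHS]intR_affine.
- by rewrite -[RHS]intR_affine.
Qed.

Lemma cint_real (f : R -> R) a b : cint (fun x => (f x)%:C) a b = (intR f a b)%:C.
Proof.
by apply: complex_ext => //=; rewrite (_ : _ \o _ = fun=> 0) ?intR_cst ?mul0r.
Qed.

Lemma Re_cint f a b : complex.Re (cint f a b) = intR (fun x => complex.Re (f x)) a b.
Proof. by []. Qed.

(** Multiplication by a unit [u] turns the integral into its modulus; the real part of [u * f] is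
    then at most [cabs f] pointwise. *)
Lemma cint_bound f (h : R -> R) a b : ccont f -> continuous h -> a <= b ->
  (forall x, a <= x <= b -> cabs (f x) <= h x) -> cabs (cint f a b) <= intR h a b.
Proof.
move=> cf ch ab fh; set I := cint f a b.
have [I0|I0] := eqVneq I 0.
  rewrite I0 cabs0; apply: intR_ge0 => // x /fh; exact: le_trans (cabs_ge0 _).
have n0 : 0 < cabs I by rewrite cabs_gt0.
pose u := ((cabs I)^-1)%:C * conjc I.
have uI : u * I = (cabs I)%:C.
  rewrite /u -mulrA [conjc I * _]mulrC -sqr_normc normE_cabs -realCX -realCM.
  by rewrite expr2 mulKf// gt_eqF.
have u1 : cabs u = 1.
  by apply: (mulIf (lt0r_neq0 n0)); rewrite mul1r -cabsM uI cabs_real ger0_norm// ltW.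
rewrite (_ : cabs I = complex.Re (u * I)) ?uI// -uI -cintZ// Re_cint.
have cuf := ccontM (ccont_cst u) cf.
apply: intR_le => //; first exact: cuf.1.
move=> x /fh; apply: le_trans; rewrite -[leRHS]mul1r -u1 -cabsM.
exact: le_trans (ler_norm _) (Re_le_cabs _).
Qed.

Lemma cint_bound_cst f (M : R) a b : ccont f -> a <= b ->
  (forall x, a <= x <= b -> cabs (f x) <= M) -> cabs (cint f a b) <= M * (b - a).
Proof.
by move=> cf ab H; rewrite -intR_cst; apply: cint_bound => //; exact: cnst.
Qed.

End ComplexIntegral.

Arguments cint : simpl never.

(** * Cauchy's theorem *)

Section Goursat.
Variable R : realType.
Local Notation C := R[i].
Implicit Types (F G : C -> C) (a b c d x y : R).

Lemma pt_line_h x y : x +i* y = (0 +i* y) + x%:C * 1 :> C.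
Proof. by rewrite mulr1; simpc. Qed.

Lemma pt_line_v x y : x +i* y = x%:C + y%:C * 'i :> C.
Proof. by simpc. Qed.

Lemma ccont_h F y : entire F -> ccont (fun x => F (x +i* y)).
Proof.
by move=> /(@entire_ccont _ F (0 +i* y) 1); under eq_fun do rewrite -pt_line_h.
Qed.

Lemma ccont_v F x : entire F -> ccont (fun y => F (x +i* y)).
Proof.
by move=> /(@entire_ccont _ F x%:C 'i); under eq_fun do rewrite -pt_line_v.
Qed.

(** The counterclockwise contour integral along the boundary of [a, b] x [c, d]. *)
Definition rectint F a b c d : C :=
  cint (fun x => F (x +i* c)) a b + 'i * cint (fun y => F (b +i* y)) c d
  - cint (fun x => F (x +i* d)) a b - 'i * cint (fun y => F (a +i* y)) c d.

Arguments rectint : simpl never.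

Lemma cint_h F G a b y : entire F -> (forall z, cder G z (F z)) ->
  cint (fun x => F (x +i* y)) a b = G (b +i* y) - G (a +i* y).
Proof.
move=> eF GD; rewrite (@cint_FTC _ _ (fun x => G (x +i* y)))//; first exact: ccont_h.
move=> x; have := @cder_line _ G (0 +i* y) 1 (F (x +i* y)) x.
rewrite -pt_line_h mulr1 => /(_ (GD _)).
by under eq_fun do rewrite -pt_line_h.
Qed.

Lemma cint_v F G c d x : entire F -> (forall z, cder G z (F z)) ->
  'i * cint (fun y => F (x +i* y)) c d = G (x +i* d) - G (x +i* c).
Proof.
move=> eF GD; rewrite -cintZ; last exact: ccont_v.
rewrite (@cint_FTC _ _ (fun y => G (x +i* y)))//.
  exact: ccontM (ccont_cst _) (ccont_v _ eF).
move=> y; have := @cder_line _ G x%:C 'i (F (x +i* y)) y.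
rewrite -pt_line_v mulrC => /(_ (GD _)).
by under eq_fun do rewrite -pt_line_v.
Qed.

Lemma rectint_primitive F G a b c d : entire F -> (forall z, cder G z (F z)) ->
  rectint F a b c d = 0.
Proof.
by move=> eF GD; rewrite /rectint !(cint_h _ _ _ eF GD) !(cint_v _ _ _ eF GD); ring.
Qed.

Lemma entireB F G : entire F -> entire G -> entire (fun z => F z - G z).
Proof.
move=> /entireP eF /entireP eG; apply/entireP => z.
by have [d ?] := eF z; have [d' ?] := eG z; exists (d - d'); exact: cderB.
Qed.

Lemma rectintB F G a b c d : entire F -> entire G ->
  rectint (fun z => F z - G z) a b c d = rectint F a b c d - rectint G a b c d.
Proof.
move=> eF eG; rewrite /rectint !cintB; try exact: ccont_h; try exact: ccont_v.
by ring.
Qed.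

Lemma rectint_bound F a b c d (M : R) : entire F -> a <= b -> c <= d ->
  (forall x y, a <= x <= b -> c <= y <= d -> cabs (F (x +i* y)) <= M) ->
  cabs (rectint F a b c d) <= M * (2 * ((b - a) + (d - c))).
Proof.
move=> eF ab cd FM.
have h1 y : c <= y <= d -> cabs (cint (fun x => F (x +i* y)) a b) <= M * (b - a).
  by move=> ycd; apply: cint_bound_cst => //; [exact: ccont_h|move=> x ?; exact: FM].
have v1 x : a <= x <= b -> cabs ('i * cint (fun y => F (x +i* y)) c d) <= M * (d - c).
  move=> xab; rewrite cabsM cabs_i mul1r.
  by apply: cint_bound_cst => //; [exact: ccont_v|move=> y ?; exact: FM].
rewrite /rectint; apply: (le_trans (cabsB _ _)).
rewrite (_ : M * _ = M * (b - a) + M * (d - c) + M * (b - a) + M * (d - c)); last by ring.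
apply: lerD; last by rewrite v1// lexx.
apply: (le_trans (cabsB _ _)); apply: lerD; last by rewrite h1// lexx andbT.
apply: (le_trans (cabsD _ _)); apply: lerD; first by rewrite h1// lexx.
by rewrite v1// lexx andbT.
Qed.

Lemma rectint_split F a m b c k d : entire F ->
  rectint F a b c d = rectint F a m c k + rectint F m b c k
    + rectint F a m k d + rectint F m b k d.
Proof.
move=> eF; rewrite /rectint.
rewrite -!(cint_chasles m a b (ccont_h _ eF)) -!(cint_chasles k c d (ccont_v _ eF)).
by ring.
Qed.

Lemma nested_intervals (u v : nat -> R) : (forall n, u n <= u n.+1) ->
  (forall n, v n.+1 <= v n) -> (forall n, u n <= v n) ->
  exists x, forall n, u n <= x <= v n.
Proof.
move=> hu hv uv.
have mu : {homo u : m n / (m <= n)%N >-> m <= n} by exact: homo_leq le_trans hu.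
have mv : {homo v : m n / (m <= n)%N >-> n <= m}.
  by apply: homo_leq => // y x z xy yz; exact: le_trans yz xy.
have uvmn m n : u m <= v n.
  apply: le_trans (mu _ _ (leq_maxl m n)) _; apply: le_trans (uv _) _.
  exact: mv (leq_maxr m n).
have h0 : has_sup (range u).
  by split; [exists (u 0%N); exists 0%N|exists (v 0%N) => _ [m _ <-]; exact: uvmn].
exists (sup (range u)) => n; apply/andP; split.
  by apply: ub_le_sup; [exact: h0.2|exists n].
by apply: ge_sup; [exact: h0.1|move=> _ [m _ <-]; exact: uvmn].
Qed.

Lemma dist_itv (a t u v : R) : a <= u <= a + t -> a <= v <= a + t -> `|u - v| <= t.
Proof. by move=> *; rewrite ler_norml; apply/andP; split; lra. Qed.

Lemma expr2_gt n : n%:R < 2 ^+ n :> R.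
Proof. by rewrite -natrX ltr_nat ltn_expl. Qed.

(** Repeated quartering keeps at least a quarter of the modulus each time. At the common point of
    the nested rectangles [F] is affine up to a small multiple of the distance, and an affine
    function has integral zero, which leaves less than any multiple of the area. *)
Theorem goursat F a b c d : entire F -> a <= b -> c <= d -> rectint F a b c d = 0.
Proof.
move=> eF ab cd; pose w := b - a; pose h := d - c.
have w0 : 0 <= w by rewrite subr_ge0.
have h0 : 0 <= h by rewrite subr_ge0.
have two n : 0 < 2 ^+ n :> R by rewrite exprn_gt0.
(* The subrectangles of generation [n] are determined by their lower left corner [p]. *)
pose Q n (p : R * R) := rectint F p.1 (p.1 + w / 2 ^+ n) p.2 (p.2 + h / 2 ^+ n).
have half n (t : R) : t / 2 ^+ n = t / 2 ^+ n.+1 + t / 2 ^+ n.+1.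
  by rewrite exprS; field; rewrite lt0r_neq0.
have quarter (t q1 q2 q3 q4 : R) : t <= q1 + q2 + q3 + q4 -> 4 * q1 < t ->
    4 * q2 < t -> 4 * q3 < t -> t <= 4 * q4 by lra.
have split1 (np : nat * (R * R)) : exists q : R * R,
    [/\ cabs (Q np.1 np.2) <= 4 * cabs (Q np.1.+1 q),
     np.2.1 <= q.1 <= np.2.1 + w / 2 ^+ np.1.+1 &
     np.2.2 <= q.2 <= np.2.2 + h / 2 ^+ np.1.+1].
  case: np => n [x y] /=; set w' := w / 2 ^+ n.+1; set h' := h / 2 ^+ n.+1.
  have w'0 : 0 <= w' by rewrite divr_ge0// ltW.
  have h'0 : 0 <= h' by rewrite divr_ge0// ltW.
  have QE : Q n (x, y) = Q n.+1 (x, y) + Q n.+1 (x + w', y)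
      + Q n.+1 (x, y + h') + Q n.+1 (x + w', y + h').
    rewrite /Q /= (half n w) (half n h) -/w' -/h' [x + (_ + _)]addrA [y + (_ + _)]addrA.
    exact: rectint_split.
  have T : cabs (Q n (x, y)) <= cabs (Q n.+1 (x, y)) + cabs (Q n.+1 (x + w', y))
      + cabs (Q n.+1 (x, y + h')) + cabs (Q n.+1 (x + w', y + h')).
    rewrite QE; do 3 (apply: (le_trans (cabsD _ _)); apply: lerD => //).
  have [A1|A1] := leP (cabs (Q n (x, y))) (4 * cabs (Q n.+1 (x, y))).
    by exists (x, y); rewrite /= !lexx !lerDl.
  have [A2|A2] := leP (cabs (Q n (x, y))) (4 * cabs (Q n.+1 (x + w', y))).
    by exists (x + w', y); rewrite /= !lexx !lerDl w'0.
  have [A3|A3] := leP (cabs (Q n (x, y))) (4 * cabs (Q n.+1 (x, y + h'))).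
    by exists (x, y + h'); rewrite /= !lexx !lerDl h'0.
  exists (x + w', y + h'); rewrite /= !lexx !lerDl w'0 h'0; split => //.
  exact: quarter T A1 A2 A3.
have [next nextP] := choice split1.
pose p := fix p n := if n is m.+1 then next (m, p m) else (a, c).
have pP n := nextP (n, p n).
have [x xP] : exists x, forall n, (p n).1 <= x <= (p n).1 + w / 2 ^+ n.
  apply: nested_intervals => n.
  - by have [_ /andP[]] := pP n.
  - have [_ /andP[_ /= +] _] := pP n; rewrite (half n w) addrA.
    by rewrite lerD2r.
  - by rewrite lerDl divr_ge0// ltW.
have [y yP] : exists y, forall n, (p n).2 <= y <= (p n).2 + h / 2 ^+ n.
  apply: nested_intervals => n.
  - by have [_ _ /andP[]] := pP n.
  - have [_ _ /andP[_ /= +]] := pP n; rewrite (half n h) addrA.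
    by rewrite lerD2r.
  - by rewrite lerDl divr_ge0// ltW.
have Q0 n : cabs (Q 0%N (a, c)) <= 4 ^+ n * cabs (Q n (p n)).
  elim: n => [|n IH]; first by rewrite expr0 mul1r.
  apply: (le_trans IH); rewrite exprSr -mulrA ler_wpM2l ?exprn_ge0//.
  by have [] := pP n.
have -> : rectint F a b c d = Q 0%N (a, c).
  by rewrite /Q /= expr0 !divr1 /w /h !subrKC.
apply/eqP; rewrite -cabs_eq0 eq_le cabs_ge0 andbT.
apply/ler_addgt0Pl => e e0; rewrite addr0.
pose s := w + h; have s0 : 0 <= s by exact: addr_ge0.
have [D FD] := (entireP F).1 eF (x +i* y).
(* At generation [n] the distances are at most s / 2^n and the perimeter is 2 s / 2^n, whence 2 s^2;
   the 1 keeps the denominator positive for a degenerate rectangle. *)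
have e'0 : 0 < e / (2 * s ^+ 2 + 1) by rewrite divr_gt0// ltr_wpDl// mulr_ge0// sqr_ge0.
have [del del0 K] := FD _ e'0.
have [n nP] : exists n, s / 2 ^+ n < del.
  exists (Num.trunc (s / del)).+1; rewrite ltr_pdivrMr// mulrC -ltr_pdivrMr//.
  by apply: lt_le_trans (ltW (expr2_gt _)); rewrite truncnS_gt.
apply: (le_trans (Q0 n)); move: (p n) (xP n) (yP n) => {Q0 xP yP pP p} [px py] /= xPn yPn.
(* The affine approximation of [F] at the common point, and a primitive of it. *)
pose L z := F (x +i* y) + D * (z - (x +i* y)).
pose L1 z := F (x +i* y) * z + D * ((z - (x +i* y)) ^+ 2 / 2).
have L1D z : cder L1 z (L z).
  have H1 : cder (fun z => z - (x +i* y)) z 1.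
    by apply: cder_eq (cderB (cder_id z) (cder_cst _ _)) _; rewrite subr0.
  apply: cder_eq (cderD (cderM (cder_cst _ _) (cder_id z))
    (cderM (cder_cst _ _) (cderM (cderM H1 H1) (cder_cst _ _)))) _.
  by rewrite /L; field.
have eL : entire L.
  apply/entireP => z; exists D.
  apply: cder_eq (cderD (cder_cst _ _) (cderM (cder_cst _ _)
    (cderB (cder_id z) (cder_cst _ _)))) _; by ring.
have -> : Q n (px, py) = rectint (fun z => F z - L z) px (px + w / 2 ^+ n)
    py (py + h / 2 ^+ n).
  by rewrite rectintB// (rectint_primitive _ _ _ _ eL L1D) subr0.
have wn0 : 0 <= w / 2 ^+ n by rewrite divr_ge0// ltW.
have hn0 : 0 <= h / 2 ^+ n by rewrite divr_ge0// ltW.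
apply: (@le_trans _ _ (4 ^+ n * (e / (2 * s ^+ 2 + 1) * (s / 2 ^+ n) * (2 * (s / 2 ^+ n))))).
  apply: ler_wpM2l; first exact: exprn_ge0.
  have B := @rectint_bound (fun z => F z - L z) px (px + w / 2 ^+ n) py (py + h / 2 ^+ n)
    (e / (2 * s ^+ 2 + 1) * (s / 2 ^+ n)) (entireB eF eL).
  have SE : (px + w / 2 ^+ n - px) + (py + h / 2 ^+ n - py) = s / 2 ^+ n.
    by rewrite /s; ring.
  rewrite SE in B.
  have : px <= px + w / 2 ^+ n by rewrite lerDl.
  have : py <= py + h / 2 ^+ n by rewrite lerDl.
  move=> hy hx; apply: (B hx hy).
  move=> u v uP vP.
    have {uP vP} [uP vP xn yn] : [/\ px <= u <= px + w / 2 ^+ n, py <= v <= py + h / 2 ^+ n,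
    px <= x <= px + w / 2 ^+ n & py <= y <= py + h / 2 ^+ n] by [].
  have S : cabs ((u +i* v) - (x +i* y)) <= s / 2 ^+ n.
    apply: (le_trans (cabs_le_ReIm _)); rewrite /s mulrDl /=; apply: lerD.
      exact: dist_itv uP xn.
    exact: dist_itv vP yn.
  have E : F (u +i* v) - L (u +i* v) =
      F (u +i* v) - F (x +i* y) - D * ((u +i* v) - (x +i* y)).
    by rewrite /L opprD addrA.
  rewrite E; apply: le_trans (ler_wpM2l (ltW e'0) S).
  have := K _ (le_lt_trans S nP).
  by have -> : (x +i* y) + ((u +i* v) - (x +i* y)) = u +i* v by rewrite subrKC.
have -> : 4 ^+ n = 2 ^+ n * 2 ^+ n :> R by rewrite -exprMn; congr (_ ^+ _); ring.
rewrite (_ : _ * _ = e * ((2 * s ^+ 2) / (2 * s ^+ 2 + 1))); last first.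
  have s1 : 2 * s ^+ 2 + 1 != 0 by rewrite lt0r_neq0// ltr_wpDl// mulr_ge0// sqr_ge0.
  by field; rewrite s1 lt0r_neq0.
rewrite ler_piMr ?(ltW e0)// ler_pdivrMr ?mul1r ?lerDl//.
by rewrite ltr_wpDl// mulr_ge0// sqr_ge0.
Qed.

End Goursat.

(** * The complex exponential and the mean value property *)

Section Exponential.
Variable R : realType.
Local Notation C := R[i].
Implicit Types (F G : C -> C) (a b c d x y : R) (z w : C).

Lemma rderP (f : R -> R) x d : rder f x d ->
  forall e : R, 0 < e -> exists2 del : R, 0 < del &
    forall h, `|h| < del -> `|f (x + h) - f x - d * h| <= e * `|h|.
Proof.
move=> [/derivable1_diffP/diff_locallyP fd <-] e e0.
have [df fE] : derivable f x 1 /\ 'D_1 f x = 'D_1 f x.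
  by split => //; apply/derivable1_diffP/diff_locallyP.
have /cvgrPdist_le/(_ e e0)/nbhs_ballP[del /= d0 K] :
    (fun h : R => h^-1 *: ((f \o shift x) (h *: (1 : R)) - f x)) @ (0 : R)^' --> 'D_1 f x.
  exact: df.
exists del => // h hd; have [->|h0] := eqVneq h 0.
  by rewrite addr0 mulr0 subrr subr0 normr0 mulr0.
have := K h; rewrite -?ball_normE /ball_/= sub0r normrN => /(_ hd h0).
rewrite -[h *: _]/(h * 1) mulr1 (addrC h) -[h^-1 *: _]/(h^-1 * _).
move=> /(ler_wpM2r (normr_ge0 h)); rewrite -normrM distrC mulrBl mulrAC mulVf// mul1r.
by [].
Qed.

Lemma cexpD z w : cexp (z + w) = cexp z * cexp w.
Proof.
case: z w => [a b] [c d]; rewrite /cexp /= expRD cosD sinD; simpc.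
by apply: complex_ext => /=; ring.
Qed.

Lemma cexp0 : cexp (0 : C) = 1.
Proof. by rewrite /cexp /= expR0 cos0 sin0 mulr1. Qed.

Lemma cexp_neq0 z : cexp z != 0.
Proof.
have H : cexp z * cexp (- z) = 1 by rewrite -cexpD subrr cexp0.
by apply/eqP => z0; move/eqP: H; rewrite z0 mul0r eq_sym oner_eq0.
Qed.

Lemma cexpN z : cexp (- z) = (cexp z)^-1.
Proof. by apply: (mulfI (cexp_neq0 z)); rewrite -cexpD subrr cexp0 divff// cexp_neq0. Qed.

Lemma cexpMn z n : cexp (n%:R * z) = cexp z ^+ n.
Proof.
elim: n => [|n IH]; first by rewrite mul0r cexp0 expr0.
by rewrite -natr1 mulrDl mul1r cexpD IH exprSr.
Qed.

Lemma cabs_cexp z : cabs (cexp z) = expR (complex.Re z).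
Proof.
rewrite /cexp cabsM cabs_real ger0_norm ?expR_ge0// /cabs /= cos2Dsin2 sqrtr1.
by rewrite mulr1.
Qed.

Lemma cexp_imag x : cexp (0 +i* x) = cos x +i* sin x.
Proof. by rewrite /cexp /= expR0 mul1r. Qed.

(** The functional equation reduces the claim to the point 0, where it follows from the real
    derivatives of exp, cos and sin. *)
Lemma cder_cexp z : cder (@cexp R) z (cexp z).
Proof.
suff H0 : cder (@cexp R) 0 1.
  have H1 : cder (fun w => w - z) z 1.
    by apply: cder_eq (cderB (cder_id z) (cder_cst _ _)) _; rewrite subr0.
  have H2 : cder (fun w => cexp (w - z)) z 1.
    by rewrite -[X in cder _ _ X](mulr1 1); apply: (cder_comp H1); rewrite subrr.
  have := cderM (cder_cst (cexp z) z) H2; rewrite mulr0 addr0 mulr1.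
  by apply: (cder_near (ltr01 : 0 < (1 : R))) => w _; rewrite -cexpD subrKC.
(* The error terms add up to 1 + 2 times [e' * cabs h] in the real part and 2 + 1 times in the
   imaginary part. *)
move=> e e0; pose e' := Num.min 1 (e / 6).
have e'0 : 0 < e' by rewrite lt_min ltr01 divr_gt0.
have e'1 : e' <= 1 by rewrite ge_min lexx.
have e'2 : 6 * e' <= e by rewrite mulrC -ler_pdivlMr// ge_min lexx orbT.
have [d1 d10 H1] := rderP (is_derive_expR 0 : rder _ _ _) e'0.
have [d2 d20 H2] := rderP (is_derive_cos 0 : rder _ _ _) e'0.
have [d3 d30 H3] := rderP (is_derive_sin 0 : rder _ _ _) e'0.
exists (Num.min (Num.min d1 d2) (Num.min d3 (e' / 2))).
  by rewrite !lt_min d10 d20 d30 divr_gt0.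
move=> h; rewrite !lt_min => /andP[/andP[h1 h2] /andP[h3 h4]].
have ra : `|complex.Re h| <= cabs h := Re_le_cabs h.
have rb : `|complex.Im h| <= cabs h := Im_le_cabs h.
have := H1 _ (le_lt_trans ra h1); have := H2 _ (le_lt_trans rb h2).
have := H3 _ (le_lt_trans rb h3).
rewrite !add0r cexp0 /cexp cos0 sin0 expR0 oppr0 !mul0r !mul1r !subr0 addr0.
move: ra rb; set A := complex.Re h; set B := complex.Im h; set N := cabs h in h1 h2 h3 h4 *.
move=> ra rb S K E.
have N0 : 0 <= N := cabs_ge0 h.
have S' : `|sin B - B| <= e' * N by apply: (le_trans S); rewrite ler_wpM2l// ltW.
have K' : `|cos B - 1| <= e' * N by apply: (le_trans K); rewrite ler_wpM2l// ltW.
have E' : `|expR A - 1 - A| <= e' * N by apply: (le_trans E); rewrite ler_wpM2l// ltW.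
have N1 : 2 * N <= e' by rewrite mulrC -ler_pdivlMr// ltW.
have E2 : `|expR A - 1| <= e'.
  rewrite -[_ - 1](subrK A); apply: (le_trans (ler_normD _ _)).
  apply: (le_trans (lerD E' ra)); apply: le_trans N1.
  by rewrite [2]mulr2n mulrDl mul1r lerD2r ler_piMl.
have E3 : `|expR A| <= 2.
  by rewrite -[expR A](subrK 1) (le_trans (ler_normD _ _))// normr1 [2]mulr2n lerD2r (le_trans E2).
have RE : complex.Re ((expR A)%:C * (cos B +i* sin B) - 1 - h) =
    (expR A - 1 - A) + expR A * (cos B - 1).
  by rewrite !(ReD, ReN, ReMr) /= /A; ring.
have IM : complex.Im ((expR A)%:C * (cos B +i* sin B) - 1 - h) =
    expR A * (sin B - B) + (expR A - 1) * B.
  by rewrite !(ImD, ImN, ImMr) /= /B; ring.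
apply: (le_trans (cabs_le_ReIm _)); rewrite {}RE {}IM.
apply: (@le_trans _ _ (6 * e' * N)); last by rewrite ler_wpM2r.
rewrite (_ : 6 * e' * N = (e' * N + 2 * (e' * N)) + (2 * (e' * N) + e' * N)); last by ring.
apply: lerD; apply: (le_trans (ler_normD _ _)); rewrite ?normrM; apply: lerD => //.
- by apply: ler_pM.
- by apply: ler_pM.
- by apply: ler_pM.
Qed.

Lemma entire_cst z : entire (fun=> z).
Proof. by apply/entireP => w; exists 0; exact: cder_cst. Qed.

Lemma entire_id : entire (@id C).
Proof. by apply/entireP => w; exists 1; exact: cder_id. Qed.

Lemma entireD F G : entire F -> entire G -> entire (fun z => F z + G z).
Proof.
move=> /entireP eF /entireP eG; apply/entireP => z.
by have [d ?] := eF z; have [d' ?] := eG z; exists (d + d'); exact: cderD.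
Qed.

Lemma entireM F G : entire F -> entire G -> entire (fun z => F z * G z).
Proof.
move=> /entireP eF /entireP eG; apply/entireP => z.
have [d Fd] := eF z; have [d' Gd] := eG z.
by exists (F z * d' + G z * d); exact: cderM.
Qed.

Lemma entireN F : entire F -> entire (fun z => - F z).
Proof. by move=> /entireP eF; apply/entireP => z; have [d H] := eF z; exists (- d); exact: (cderN H). Qed.

Lemma entire_comp F G : entire F -> entire G -> entire (fun z => F (G z)).
Proof.
move=> /entireP eF /entireP eG; apply/entireP => z.
by have [d ?] := eG z; have [d' ?] := eF (G z); exists (d' * d); exact: cder_comp.
Qed.

Lemma entireV F : entire F -> (forall z, F z != 0) -> entire (fun z => (F z)^-1).
Proof.
move=> /entireP eF F0; apply/entireP => z; have [d ?] := eF z.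
by eexists; apply: cderV; [exact: F0|eassumption].
Qed.

Lemma entireX F n : entire F -> entire (fun z => F z ^+ n).
Proof.
move=> eF; elim: n => [|n IH].
  by under eq_fun do rewrite expr0; exact: entire_cst.
by under eq_fun do rewrite exprS; exact: entireM.
Qed.

Lemma entire_cexp : entire (@cexp R).
Proof. by apply/entireP => z; exists (cexp z); exact: cder_cexp. Qed.

Definition cderiv F z : C := 'D_1 (F : C^o -> C^o) z.

Lemma cderivP F z : entire F -> cder F z (cderiv F z).
Proof. by move=> eF; apply/cderP/derivableP/eF. Qed.

Lemma cderivE F z (d : C) : cder F z d -> cderiv F z = d.
Proof. by move=> /cderP[_ <-]. Qed.

Lemma ccontV (f : R -> C) : ccont f -> (forall x, f x != 0) ->
  ccont (fun x => (f x)^-1).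
Proof.
move=> cf f0; have [fr fi] := cf.
have cn : continuous (fun x => (cabs (f x) ^+ 2)^-1).
  have c2 : continuous (fun x => cabs (f x) ^+ 2).
    exact: (@cntM _ (fun x => cabs (f x)) (fun x => cabs (f x)) (ccont_cabs cf) (ccont_cabs cf)).
  by move=> x; apply: (cvgV _ (c2 x)); rewrite expf_neq0// cabs_eq0.
have fV x : (f x)^-1 = ((cabs (f x) ^+ 2)^-1)%:C * (complex.Re (f x) -i* complex.Im (f x)).
  by rewrite invc_norm normE_cabs -realCX -realCV; case: (f x).
under eq_fun do rewrite fV.
apply: ccontM; first exact: ccont_real.
by split; [exact: fr|exact: cntN].
Qed.

(** exp(2 pi i x). The period is 1, so Fourier coefficients are plain means over [0, 1], and the
    equation [expi t = 1] expresses that [t] is an integer. *)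
Definition expi x : C := cexp (x%:C * (0 +i* (2 * pi))).

Lemma expiE x : expi x = cos (2 * pi * x) +i* sin (2 * pi * x).
Proof.
rewrite /expi (_ : _ * _ = 0 +i* (2 * pi * x)) ?cexp_imag//.
by simpc; rewrite mulrC.
Qed.

Lemma expiD x y : expi (x + y) = expi x * expi y.
Proof. by rewrite /expi realCD mulrDl cexpD. Qed.

Lemma expi0 : expi 0 = 1.
Proof. by rewrite /expi mul0r cexp0. Qed.

Lemma expi1 : expi 1 = 1.
Proof. by rewrite expiE mulr1 mulr_natl cos2pi sin2pi. Qed.

Lemma expi_neq0 x : expi x != 0. Proof. exact: cexp_neq0. Qed.

Lemma expiN x : expi (- x) = (expi x)^-1.
Proof. by rewrite /expi realCN mulNr cexpN. Qed.

Lemma expi_nat n : expi n%:R = 1.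
Proof.
by elim: n => [|n IH]; rewrite ?expi0// -natr1 expiD IH expi1 mulr1.
Qed.

Lemma expiMn n x : expi (n%:R * x) = expi x ^+ n.
Proof. by rewrite /expi realCM realC_nat -mulrA cexpMn. Qed.

Lemma cabs_expi x : cabs (expi x) = 1.
Proof. by rewrite expiE /cabs /= cos2Dsin2 sqrtr1. Qed.

Lemma conjc_expi x : conjc (expi x) = expi (- x).
Proof. by rewrite !expiE mulrN cosN sinN. Qed.

Lemma ccont_circle F z (r : R) : entire F -> ccont (fun t => F (z + r%:C * expi t)).
Proof.
move=> eF; exact (entire_ccont_real (entire_comp eF (entireD (@entire_cst z)
  (entireM (@entire_cst r%:C) (entire_comp entire_cexp
    (entireM entire_id (@entire_cst (0 +i* (2 * pi))))))))).
Qed.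

Lemma ccont_expi (k : R) : ccont (fun t => expi (k * t)).
Proof.
have := @entire_ccont _ (@cexp R) 0 (k%:C * (0 +i* (2 * pi))) entire_cexp.
by under eq_fun do rewrite add0r mulrCA mulrA -realCM.
Qed.

Lemma ccont_expi1 : ccont expi.
Proof. by have := ccont_expi 1; under eq_fun do rewrite mul1r. Qed.

(* Goursat's theorem for [H \o cexp], on the rectangle of height [2 * pi]
   whose horizontal sides carry the same values. *)
Lemma circle_mean_indep (H : C -> C) (r s : R) : entire (fun w => H (cexp w)) ->
  0 < r -> 0 < s -> cint (fun t => H (r%:C * expi t)) 0 1 = cint (fun t => H (s%:C * expi t)) 0 1.
Proof.
move=> eH.
have pi2 : 0 < 2 * pi :> R by rewrite mulr_gt0// pi_gt0.
have V u : 'i * cint (fun y => H (cexp (u +i* y))) 0 (2 * pi) =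
    'i * (2 * pi)%:C * cint (fun t => H ((expR u)%:C * expi t)) 0 1.
  rewrite -mulrA; congr (_ * _).
  have cH : ccont (fun y => H (cexp (u +i* y))) by exact: (ccont_v _ eH).
  have := @cint_affine _ (fun y => H (cexp (u +i* y))) (2 * pi) 0 0 1 cH.
  rewrite !mulr0 !addr0 mulr1 => <-; congr (_ * _); congr cint.
  by apply/funext => t; rewrite addr0 /cexp /= expiE.
have posE t : 0 < t -> exists u, t = expR u.
  by move=> t0; exists (ln t); rewrite lnK// posrE.
move=> /posE[{}r ->] /posE[{}s ->].
wlog rs : r s / r <= s => [W|].
  by have [rs|/ltW sr] := leP r s; [exact: W|apply/esym; exact: W].
have := @goursat _ (fun w => H (cexp w)) r s 0 (2 * pi) eH rs (ltW pi2).
rewrite /rectint (V s) (V r).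
have -> : (fun x => H (cexp (x +i* (2 * pi)))) = (fun x => H (cexp (x +i* 0))).
  by apply/funext => x; rewrite /cexp /= mulr_natl cos2pi sin2pi cos0 sin0.
rewrite [X in X - _ - _]addrC addrK => /eqP; rewrite subr_eq0 => /eqP.
have n0 : 'i * (2 * pi)%:C != 0 :> C.
  by rewrite -cabs_eq0 cabsM cabs_i mul1r cabs_real normr_eq0 lt0r_neq0.
by move=> /(mulfI n0) ->.
Qed.

(** The mean does not depend on the radius, and for a small radius continuity brings it close to
    [F 0]. *)
Lemma mean_value F (r : R) : entire F -> 0 < r ->
  cint (fun t => F (r%:C * expi t)) 0 1 = F 0.
Proof.
move=> eF r0; apply/eqP; rewrite -subr_eq0 -cabs_eq0 eq_le cabs_ge0 andbT.
apply/ler_addgt0Pl => e e0; rewrite addr0.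
have [del del0 K] := cder_cont (cderivP 0 eF) e0.
have eE : entire (fun w => F (cexp w)) by exact (entire_comp eF entire_cexp).
rewrite (@circle_mean_indep F r (del / 2) eE r0 (divr_gt0 del0 (ltr0n _ 2))).
have cF : ccont (fun t => F ((del / 2)%:C * expi t)).
  by have := ccont_circle 0 (del / 2) eF; under eq_fun do rewrite add0r.
have -> : F 0 = cint (fun=> F 0) (0 : R) 1 by rewrite cint_cst subr0 mulr1.
rewrite -cintB//; last exact: ccont_cst.
have := @cint_bound_cst _ (fun t => F ((del / 2)%:C * expi t) - F 0) e 0 1
  (ccontB cF (ccont_cst _)) ler01; rewrite subr0 mulr1; apply.
move=> t _; apply: ltW; have := K ((del / 2)%:C * expi t); rewrite add0r; apply.
rewrite cabsM cabs_expi mulr1 cabs_real ger0_norm; last by rewrite ltW// divr_gt0.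
by rewrite ltr_pdivrMr// ltr_pMr// ltr1n.
Qed.

End Exponential.

(** * The Fejer kernel as an approximate identity *)

Section Fejer.
Variable R : realType.
Local Notation C := R[i].
Implicit Types (a b x y : R) (z w : C) (N : nat).

Lemma cint_expi (k a : R) : expi k = 1 -> k != 0 ->
  cint (fun x => expi (k * x)) a (a + 1) = 0.
Proof.
move=> k1 k0; pose u : C := k%:C * (0 +i* (2 * pi)).
have pi2 : 2 * pi != 0 :> R by rewrite mulf_neq0// lt0r_neq0// pi_gt0.
have u0 : u != 0.
  rewrite /u mulf_neq0 ?realC_eq0//; apply/eqP => -[] /eqP; exact/negP.
have E x : expi (k * x) = cexp (0 + x%:C * u).
  by rewrite add0r /expi /u realCM mulrCA mulrA.
rewrite (@cint_FTC _ _ (fun x => expi (k * x) * u^-1)).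
- by rewrite mulrDr mulr1 expiD k1 mulr1 subrr.
- exact: ccont_expi.
- move=> x; have H : cder (fun z => cexp z * u^-1) (0 + x%:C * u) (cexp (0 + x%:C * u) * u^-1).
    apply: cder_eq (cderM (cder_cexp _) (cder_cst _ _)) _.
    by rewrite mulr0 add0r mulrC.
  have := cder_line H; rewrite -mulrA mulVf// mulr1 -E.
  by under eq_fun do rewrite -E.
Qed.

Definition fejer N x : R := N%:R^-1 * cabs (\sum_(j < N) expi (j%:R * x)) ^+ 2.

Lemma fejer_ge0 N x : 0 <= fejer N x.
Proof. by rewrite mulr_ge0 ?invr_ge0// sqr_ge0. Qed.

Lemma fejerE N x : (fejer N x)%:C =
  N%:R^-1 * \sum_(l < N) \sum_(j < N) expi ((j%:R - l%:R) * x).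
Proof.
rewrite /fejer realCM realCV realC_nat realCX -normE_cabs sqr_normc; congr (_ * _).
rewrite mulrC rmorph_sum mulr_suml; apply: eq_bigr => l _.
rewrite mulr_sumr; apply: eq_bigr => j _.
by rewrite [X in X * _](conjc_expi (l%:R * x)) -expiD mulrBl addrC.
Qed.

Lemma fejer_continuous N : continuous (fejer N).
Proof.
have cS := @ccont_sum R N (fun j x => expi (j%:R * x)) (fun j => ccont_expi _).
have cA := ccont_cabs cS.
exact: (cntM (@cnst R _) (cntM cA cA)).
Qed.

Lemma cint_fejer (g : R -> C) N a b : ccont g ->
  cint (fun x => g x * (fejer N x)%:C) a b =
  N%:R^-1 * \sum_(l < N) \sum_(j < N) cint (fun x => g x * expi ((j%:R - l%:R) * x)) a b.
Proof.
move=> cg.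
have c1 (l j : nat) : ccont (fun x => g x * expi ((j%:R - l%:R) * x)).
  exact: ccontM cg (ccont_expi _).
have c2 (l : nat) := @ccont_sum R N (fun j x => g x * expi ((j%:R - l%:R) * x)) (c1 l).
rewrite (_ : (fun x => _) = (fun x => N%:R^-1 *
    \sum_(l < N) \sum_(j < N) g x * expi ((j%:R - l%:R) * x))); last first.
  apply/funext => x; rewrite fejerE mulrCA; congr (_ * _).
  by rewrite mulr_sumr; apply: eq_bigr => l _; rewrite mulr_sumr.
rewrite cintZ; last exact: (@ccont_sum R N (fun l x => \sum_(j < N) g x * expi ((j%:R - l%:R) * x))).
congr (_ * _).
rewrite (@cint_sum R N (fun l x => \sum_(j < N) g x * expi ((j%:R - l%:R) * x)))//.
by apply: eq_bigr => l _; rewrite (@cint_sum R N (fun j x => g x * expi ((j%:R - l%:R) * x))).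
Qed.

(** Of the N^2 exponentials in [fejerE] only the N diagonal ones have a nonzero mean over a
    period. *)
Lemma intR_fejer N a : (0 < N)%N -> intR (fejer N) a (a + 1) = 1.
Proof.
move=> N0; apply: (@complexI R); rewrite -cint_real.
have := @cint_fejer (fun=> 1) N a (a + 1) (ccont_cst 1).
under eq_fun do rewrite mul1r.
move=> ->.
rewrite (eq_bigr (fun=> 1)) => [|l _]; last first.
  rewrite (bigD1 l)//= big1 => [|j jl].
    under eq_fun do rewrite subrr mul0r expi0 mulr1.
    by rewrite cint_cst addrAC subrr add0r addr0 mulr1.
  under eq_fun do rewrite mul1r.
  apply: cint_expi; first by rewrite expiD expiN !expi_nat invr1 mulr1.
  by rewrite subr_eq0 eqr_nat.
by rewrite big_const_ord iter_addr_0 mulVf// pnatr_eq0 -lt0n.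
Qed.

Lemma cabs_expi_sub1 x : cabs (expi x - 1) ^+ 2 = 2 - 2 * cos (2 * pi * x).
Proof.
rewrite expiE cabs_sqr /= oppr0 addr0.
by have := cos2Dsin2 (2 * pi * x); set c := cos _; set s := sin _ => H; lra.
Qed.

(** The geometric sum has numerator at most 2 in modulus, and its denominator satisfies |exp(2 pi i
    x) - 1|^2 = 2 - 2 cos(2 pi x), which is increasing in |x| up to 1/2. *)
Lemma fejer_le N x (d : R) : (0 < N)%N -> 0 < d -> d <= `|x| <= 1 / 2 ->
  fejer N x <= N%:R^-1 * (4 / (2 - 2 * cos (2 * pi * d))).
Proof.
move=> N0 d0 /andP[dx x12]; have p0 := pi_gt0 R.
have pi2 : 0 < 2 * pi :> R by rewrite mulr_gt0.
have d12 : d <= 1 / 2 := le_trans dx x12.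
have itv y : 0 <= y <= 1 / 2 -> 2 * pi * y \in `[0, pi : R].
  move=> /andP[y0 y1]; rewrite in_itv/= mulr_ge0 ?(ltW pi2)//=.
  by rewrite -[leRHS]mulr1 mulrAC mulrC ler_wpM2l ?(ltW p0)//; lra.
have cd : cos (2 * pi * d) < 1.
  have i0 : 0 \in `[0, pi : R] by rewrite in_itv/= lexx (ltW p0).
  by rewrite -[X in _ < X]cos0 ltr_cos ?mulr_gt0 ?itv ?(ltW d0).
have cx : cos (2 * pi * x) <= cos (2 * pi * d).
  rewrite -(cos_norm (2 * pi * x)) normrM (ger0_norm (ltW pi2)).
  rewrite leNgt ltr_cos ?itv ?(ltW d0) ?normr_ge0//.
  by rewrite ltr_pM2l// -leNgt.
rewrite ler_wpM2l ?invr_ge0// ler_pdivlMr; last by lra.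
apply: (@le_trans _ _ (cabs (\sum_(j < N) expi (j%:R * x)) ^+ 2 * (2 - 2 * cos (2 * pi * x)))).
  by rewrite ler_wpM2l ?sqr_ge0//; lra.
rewrite -cabs_expi_sub1 -exprMn -cabsM mulrC.
have -> : (expi x - 1) * (\sum_(j < N) expi (j%:R * x)) = expi x ^+ N - 1.
  by rewrite subrX1; congr (_ * _); apply: eq_bigr => j _; rewrite expiMn.
have -> : 4 = 2 ^+ 2 :> R by ring.
rewrite ler_pXn2r ?nnegrE ?cabs_ge0//.
by rewrite (le_trans (cabsB _ _))// cabsX cabs_expi expr1n cabs1.
Qed.

(** Near 0 the continuity of [g] is integrated against a kernel of mass 1; away from 0 the kernel is
    O(1/N) and [g] is bounded. *)
Theorem fejer_cvg (g : R -> C) (e : R) : ccont g -> 0 < e ->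
  exists N0, forall N, (N0 <= N)%N -> (0 < N)%N ->
    cabs (cint (fun x => g x * (fejer N x)%:C) (- (1 / 2)) (1 / 2) - g 0) <= e.
Proof.
move=> cg e0.
have cd : ccont (fun x => g x - g 0) by exact: ccontB cg (ccont_cst _).
have cn := ccont_cabs cd.
have hh : - (1 / 2) <= 1 / 2 :> R by lra.
have [c _ cmax] := EVT_max hh (continuous_subspaceT cn).
set B := cabs (g c - g 0) in cmax.
have B0 : 0 <= B by exact: cabs_ge0.
have [d d0 gd] := (continuousP_eps _ _).1 (cn 0) (e / 2) (divr_gt0 e0 (ltr0n _ 2)).
pose M := 4 / (2 - 2 * cos (2 * pi * d)).
have M0 : 0 <= M.
  by rewrite divr_ge0// subr_ge0 ger_pMr// cos_le1.
exists (Num.trunc (2 * (B * M) / e)).+1 => N NN N0.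
have Npos : 0 < N%:R :> R by rewrite ltr0n.
have NB : B * M / N%:R <= e / 2.
  have t : 2 * (B * M) / e < N%:R by apply: lt_le_trans (truncnS_gt _) _; rewrite ler_nat.
  by rewrite ler_pdivrMr//; move: t; rewrite ltr_pdivrMr//; move: (B * M) => u; lra.
have cf := @fejer_continuous N.
have cK := ccont_real cf.
have I1 : intR (fejer N) (- (1 / 2)) (1 / 2) = 1.
  by have := intR_fejer (- (1 / 2)) N0; have -> : - (1 / 2) + 1 = 1 / 2 :> R by lra.
have -> : cint (fun x => g x * (fejer N x)%:C) (- (1 / 2)) (1 / 2) - g 0 =
    cint (fun x => (g x - g 0) * (fejer N x)%:C) (- (1 / 2)) (1 / 2).
  under [in RHS]eq_fun do rewrite mulrBl.
  rewrite cintB ?cintZ ?cint_real ?I1 ?mulr1//; first exact: ccontM.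
  exact: ccontM (ccont_cst _) cK.
(* A single continuous majorant: its first term serves for [|x| < d], its second elsewhere. *)
apply: (@le_trans _ _ (intR (fun x => e / 2 * fejer N x + B * M / N%:R) (- (1 / 2)) (1 / 2))).
  apply: cint_bound => //; first exact: ccontM.
    exact: (cntD (cntM (@cnst R _) cf) (@cnst R _)).
  move=> x xi; rewrite cabsM cabs_real (ger0_norm (fejer_ge0 _ _)).
  have BM : 0 <= B * M / N%:R by rewrite !mulr_ge0 ?invr_ge0// ltW.
  have [xd|dx] := ltP `|x| d.
    rewrite ler_wpDr// ler_wpM2r ?fejer_ge0//.
    have := gd x; rewrite subr0 => /(_ xd).
    by rewrite subrr cabs0 subr0 ger0_norm ?cabs_ge0// => /ltW.
  have e2 : 0 <= e / 2 by rewrite divr_ge0// ltW.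
  rewrite ler_wpDl ?(mulr_ge0 e2) ?fejer_ge0//.
  rewrite -mulrA [M / _]mulrC; apply: ler_pM; rewrite ?cabs_ge0 ?fejer_ge0//.
    by apply: cmax; rewrite in_itv.
  by apply: fejer_le; rewrite // dx ler_norml.
have cf2 := cntM (@cnst R (e / 2)) cf.
rewrite (intRD _ _ cf2 (@cnst R _)) (intRZ _ _ _ cf) intR_cst I1.
have -> : 1 / 2 - - (1 / 2) = 1 :> R by lra.
by rewrite !mulr1 [leRHS]splitr lerD2l.
Qed.

End Fejer.

(** * Cauchy's integral formula from Fourier coefficients on circles *)

Section CauchyFormula.
Variable R : realType.
Local Notation C := R[i].
Implicit Types (F : C -> C) (a b x y r : R) (z w : C) (N : nat).

(** The range of [acos] is exactly the range of arguments in the closed upper half plane; the bounds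
    on [phi] locate the point in a sector later on. *)
Lemma polar_upper z : 0 <= complex.Im z ->
  exists2 phi, 0 <= phi <= pi & z = (cabs z)%:C * (cos phi +i* sin phi).
Proof.
move=> Imz; have [->|z0] := eqVneq z 0.
  by exists 0; [rewrite lexx pi_ge0|rewrite cabs0 mul0r].
have n0 : 0 < cabs z by rewrite cabs_gt0.
pose x := complex.Re z / cabs z.
have x1 : -1 <= x <= 1.
  by rewrite -ler_norml normrM normfV (ger0_norm (ltW n0)) ler_pdivrMr// mul1r Re_le_cabs.
exists (acos x); first by rewrite acos_ge0// acos_lepi.
have sE : sin (acos x) = complex.Im z / cabs z.
  rewrite sin_acos// -[RHS]ger0_norm ?divr_ge0 ?(ltW n0)// -sqrtr_sqr; congr Num.sqrt.
  have := cabs_sqr z => H; rewrite /x !expr_div_n.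
  have -> : complex.Im z ^+ 2 = cabs z ^+ 2 - complex.Re z ^+ 2 by rewrite H; ring.
  by rewrite mulrBl divff// expf_neq0// lt0r_neq0.
rewrite sE acosK ?in_itv//; apply: complex_ext; rewrite ?ReMr ?ImMr /=.
  by rewrite /x mulrC divfK// lt0r_neq0.
by rewrite mulrC divfK// lt0r_neq0.
Qed.

Lemma polar z : exists t, z = (cabs z)%:C * expi t.
Proof.
have p0 := lt0r_neq0 (pi_gt0 R).
have [z0|/ltW z0] := leP 0 (complex.Im z).
  have [phi _ zE] := polar_upper z0; exists (phi / (2 * pi)).
  by rewrite expiE [2 * pi * _]mulrC divfK ?mulf_neq0.
have z'0 : 0 <= complex.Im (conjc z) by case: (z) z0 => u v /=; rewrite oppr_ge0.
have [phi _ zE] := polar_upper z'0; exists (- (phi / (2 * pi))).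
have nE : cabs (conjc z) = cabs z by case: (z) => u v; rewrite /cabs /= sqrrN.
rewrite expiE mulrN cosN sinN [2 * pi * _]mulrC divfK ?mulf_neq0//.
by rewrite -[LHS]conjcK {1}zE nE; apply: complex_ext; rewrite /= ?mul0r; ring.
Qed.

Lemma cint_shift (f : R -> C) a : ccont f -> (forall x, f (x + 1) = f x) ->
  cint f a (a + 1) = cint f 0 1.
Proof.
move=> cf f1; rewrite -(cint_chasles 0 a _ cf) -(cint_chasles 1 0 (a + 1) cf).
have := cint_affine 1 1 0 a cf; rewrite rmorph1 !mul1r add0r => <-.
rewrite (_ : (fun x => _) = f); last by apply/funext => x; rewrite mul1r f1.
by rewrite (cint_swap 0 a cf) addrCA addNr addr0.
Qed.

Lemma expi_period x : expi (x + 1) = expi x :> C.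
Proof. by rewrite expiD expi1 mulr1. Qed.

Lemma ccont_circle0 F r : entire F -> ccont (fun t => F (r%:C * expi t)).
Proof. by move=> /(ccont_circle 0 r); under eq_fun do rewrite add0r. Qed.

Lemma ccont_circ (r : R) : ccont (fun t => r%:C * expi t : C).
Proof. exact: ccontM (ccont_cst _) (@ccont_expi1 R). Qed.

Lemma ccontX (f : R -> C) n : ccont f -> ccont (fun t => f t ^+ n).
Proof.
move=> cf; elim: n => [|n IH]; first by under eq_fun do rewrite expr0; exact: ccont_cst.
by under eq_fun do rewrite exprS; exact: ccontM.
Qed.

Lemma circ_neq0 r t : 0 < r -> r%:C * expi t != 0 :> C.
Proof. by move=> r0; rewrite mulf_neq0 ?expi_neq0// realC_eq0 lt0r_neq0. Qed.

Lemma entire_mulX F n : entire F -> entire (fun w => F w * w ^+ n).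
Proof. by move=> eF; exact (entireM eF (@entireX R _ n (@entire_id R))). Qed.

(** The Taylor coefficient of degree [n] of [F] at 0, computed on the circle of radius [s]. *)
Definition laurent F n (s : R) : C :=
  cint (fun t => F (s%:C * expi t) / (s%:C * expi t) ^+ n) 0 1.

Lemma ccont_laurent F n s : entire F -> 0 < s ->
  ccont (fun t => F (s%:C * expi t) / (s%:C * expi t) ^+ n).
Proof.
move=> eF s0; apply: ccontM (ccont_circle0 _ eF) _.
apply: ccontV; first exact: ccontX (ccont_circ _).
by move=> t; rewrite expf_neq0// circ_neq0.
Qed.

(** The pole at 0 is harmless: independence of the radius only asks that the composite with [cexp],
    which omits 0, be entire. *)
Lemma laurent_indep F n r s : entire F -> 0 < r -> 0 < s ->
  laurent F n r = laurent F n s.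
Proof.
move=> eF; apply: (@circle_mean_indep _ (fun w => F w / w ^+ n)).
apply: entireM; first exact (entire_comp eF (@entire_cexp R)).
apply: entireV; first exact (@entireX R _ n (@entire_cexp R)).
by move=> w; rewrite expf_neq0// cexp_neq0.
Qed.

(** The mean value property of a function that vanishes at 0. *)
Lemma laurent_neg F n s : entire F -> 0 < s ->
  cint (fun t => F (s%:C * expi t) * (s%:C * expi t) ^+ n.+1) 0 1 = 0.
Proof.
move=> eF s0; have := mean_value (@entire_mulX F n.+1 eF) s0.
by rewrite expr0n mulr0.
Qed.

(** Rotating the circle turns the exponential into a power of [u / z]: for [j <= l] the result is
    the Taylor monomial of degree [l - j] at [z], and for [j > l] a coefficient of negative index,
    which is zero. *)
Lemma fourier_circle F r (th : R) (j l : nat) : entire F -> 0 < r ->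
  cint (fun x => F (r%:C * expi (th + x)) * expi ((j%:R - l%:R) * x)) (- (1 / 2)) (1 / 2) =
  if (j <= l)%N then (r%:C * expi th) ^+ (l - j) * laurent F (l - j) r else 0.
Proof.
move=> eF r0; set z := r%:C * expi th.
have z0 : z != 0 by exact: circ_neq0.
pose f t := F (r%:C * expi t) * ((r%:C * expi t) / z) ^+ j / ((r%:C * expi t) / z) ^+ l.
have E x : F (r%:C * expi (th + x)) * expi ((j%:R - l%:R) * x) = f (1 * x + th).
  have zE : (r%:C * expi (th + x)) / z = expi x.
    by rewrite expiD mulrA -/z mulrAC divff// mul1r.
  by rewrite mul1r [x + th]addrC /f zE mulrBl [expi (_ - _)]expiD expiN !expiMn mulrA.
have cf : ccont f.
  have cz : ccont (fun t => (r%:C * expi t) / z : C) := ccontM (ccont_circ r) (ccont_cst _).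
  apply: ccontM; first exact: ccontM (ccont_circle0 _ eF) (ccontX _ cz).
  apply: ccontV; first exact: ccontX.
  by move=> t; rewrite expf_neq0// mulf_neq0 ?invr_eq0// circ_neq0.
under eq_fun do rewrite E.
have := cint_affine 1 th (- (1 / 2)) (1 / 2) cf; rewrite rmorph1 [1 * cint _ _ _]mul1r => ->.
have -> : 1 * (1 / 2) + th = (1 * - (1 / 2) + th) + 1 by lra.
have fp x : f (x + 1) = f x by rewrite /f expi_period.
rewrite (@cint_shift f _ cf fp).
case: leqP => jl.
  rewrite /laurent -cintZ; last exact: ccont_laurent.
  congr cint; apply/funext => t; rewrite /f.
  have u0 : r%:C * expi t != 0 :> C := circ_neq0 t r0.
  move: (r%:C * expi t) u0 => u u0; rewrite -{1}(subnK jl) exprD !expr_div_n.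
  move: (expf_neq0 j u0) (expf_neq0 (l - j) u0) (expf_neq0 j z0) (expf_neq0 (l - j) z0).
  move: (u ^+ j) (u ^+ (l - j)) (z ^+ j) (z ^+ (l - j)) => a b c d ha hb hc hd.
  by field; rewrite ha hb hc hd.
have [m mE] : exists m, (j = m.+1 + l)%N by exists (j - l).-1; rewrite prednK ?subn_gt0// subnK// ltnW.
have := laurent_neg m eF r0 => /(congr1 (fun w => z ^- m.+1 * w)); rewrite mulr0 => <-.
rewrite -cintZ; last exact: ccontM (ccont_circle0 _ eF) (ccontX _ (ccont_circ _)).
congr cint; apply/funext => t; rewrite /f mE exprD.
have u0 : r%:C * expi t != 0 :> C := circ_neq0 t r0.
move: (r%:C * expi t) u0 => u u0.
rewrite mulrA mulfK ?expf_neq0 ?mulf_neq0 ?invr_eq0// expr_div_n.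
by rewrite [RHS]mulrC mulrA.
Qed.

(** The left side is the Cesaro mean of the geometric series minus its sum; the remainder is O(1/N)
    as long as [w] stays in a smaller disc. *)
Lemma cesaro_geom N w : (0 < N)%N -> w != 1 ->
  N%:R^-1 * (\sum_(l < N) \sum_(j < N) (if (j <= l)%N then w ^+ (l - j) else 0))
  - (1 - w)^-1 = - (N%:R^-1 * (\sum_(l < N) w ^+ l.+1) / (1 - w)).
Proof.
move=> N0 w1; have w10 : 1 - w != 0 by rewrite subr_eq0 eq_sym.
have E (l : 'I_N) : \sum_(j < N) (if (j <= l)%N then w ^+ (l - j) else 0) =
    (1 - w ^+ l.+1) / (1 - w).
  rewrite -big_mkcond/= (eq_bigl (fun j : 'I_N => (j < l.+1)%N))//.
  rewrite -(@big_ord_widen _ _ _ _ _ (fun j => w ^+ (l - j))) ?ltn_ord//.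
  rewrite (reindex_inj rev_ord_inj)/=.
  rewrite (eq_bigr (fun j : 'I_l.+1 => w ^+ j)) => [|j _]; last first.
    by rewrite subSS subKn// -ltnS.
  by apply: (mulIf w10); rewrite divfK// -[RHS]opprB subrX1 -mulNr opprB mulrC.
rewrite (eq_bigr _ (fun l _ => E l)) -mulr_suml sumrB big_const_ord iter_addr_0.
have n0 : N%:R != 0 :> C by rewrite pnatr_eq0 -lt0n.
by field; rewrite n0 w10.
Qed.

Lemma cabs_sum n (f : nat -> C) : cabs (\sum_(i < n) f i) <= \sum_(i < n) cabs (f i).
Proof.
elim: n => [|n IH]; first by rewrite !big_ord0 cabs0.
by rewrite !big_ord_recr/= (le_trans (cabsD _ _))// lerD2r.
Qed.

(** The Fejer means of [F] on the circle through [z] tend to [F z]. Their coefficients may be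
    computed on the larger circle, where the means become Cesaro means of the geometric series in z
    / u and tend uniformly to 1 / (1 - z / u). The factor u in the integrand comes from du = 2 pi i
    u dt. *)
Theorem cauchy_formula F r z : entire F -> cabs z < r ->
  F z = cint (fun t => F (r%:C * expi t) * (r%:C * expi t) / (r%:C * expi t - z)) 0 1.
Proof.
move=> eF zr; have r0 : 0 < r by exact: le_lt_trans (cabs_ge0 _) zr.
have [->|z0] := eqVneq z 0.
  rewrite -(mean_value eF r0); congr cint; apply/funext => t.
  by rewrite subr0 mulfK// circ_neq0.
have rho0 : 0 < cabs z by rewrite cabs_gt0.
have [th zE] := polar z; set rho := cabs z in zE rho0 zr.
pose q := rho / r.
have q0 : 0 <= q by rewrite divr_ge0// ltW.
have q1 : q < 1 by rewrite ltr_pdivrMr// mul1r.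
pose w t := z / (r%:C * expi t).
have wq t : cabs (w t) = q.
  by rewrite /w cabsM cabsV cabsM cabs_expi mulr1 cabs_real ger0_norm// ltW.
have w1 t : w t != 1.
  by apply/eqP => W; have := wq t; rewrite W cabs1 => Q; rewrite -Q ltxx in q1.
have cF := ccont_circle0 r eF.
have cw : ccont w.
  apply: ccontM (ccont_cst _) (ccontV (ccont_circ r) _) => t; exact: circ_neq0.
have cw1 : ccont (fun t => (1 - w t)^-1).
  apply: ccontV; first exact: ccontB (ccont_cst _) cw.
  by move=> t; rewrite subr_eq0 eq_sym.
rewrite (_ : (fun t => _) = (fun t => F (r%:C * expi t) * (1 - w t)^-1)); last first.
  apply/funext => t; rewrite -mulrA; congr (_ * _); rewrite /w.
  have u0 : r%:C * expi t != 0 :> C := circ_neq0 t r0.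
  have := w1 t; rewrite /w; move: (r%:C * expi t) u0 => u u0 h.
  have h2 : u - z != 0.
    rewrite subr_eq0; apply: contra h => /eqP ->.
    by rewrite divff.
  by field; rewrite u0 h2.
set I := cint _ 0 1.
have hh : - (1 / 2) <= 1 / 2 :> R by lra.
have [c _ cmax] := EVT_max (ler01 : (0 : R) <= 1) (continuous_subspaceT (ccont_cabs cF)).
set B := cabs (F (r%:C * expi c)) in cmax.
have B0 : 0 <= B by exact: cabs_ge0.
pose S N t := N%:R^-1 * (\sum_(l < N) \sum_(j < N) (if (j <= l)%N then w t ^+ (l - j) else 0)).
have cSj (l j : nat) : ccont (fun t => if (j <= l)%N then w t ^+ (l - j) else 0).
  by case: leqP => _; [exact: ccontX|exact: ccont_cst].
have cS N : ccont (S N).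
  apply: ccontM (ccont_cst _) _.
  apply: (@ccont_sum R N (fun l t => \sum_(j < N) (if (j <= l)%N then w t ^+ (l - j) else 0))) => l.
  exact: (@ccont_sum R N (fun j t => if (j <= l)%N then w t ^+ (l - j) else 0)).
have cg : ccont (fun x => F (rho%:C * expi (th + x))).
  have -> : (fun x => F (rho%:C * expi (th + x))) = (fun t => F (z * expi t)).
    by apply/funext => x; rewrite expiD mulrA -zE.
  exact (entire_ccont_real (entire_comp eF (entireM (@entire_cst R z)
    (entire_comp (@entire_cexp R) (entireM (@entire_id R) (@entire_cst R (0 +i* (2 * pi)))))))).
(* Passage from the circle of radius [rho] to that of radius [r], one coefficient at a time. *)
have IN N : cint (fun x => F (rho%:C * expi (th + x)) * (fejer N x)%:C) (- (1 / 2)) (1 / 2) =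
    cint (fun t => F (r%:C * expi t) * S N t) 0 1.
  rewrite cint_fejer//.
  have cT (l j : nat) : ccont (fun t => F (r%:C * expi t) *
      (if (j <= l)%N then w t ^+ (l - j) else 0)) by exact: ccontM.
  rewrite [in RHS](_ : (fun t => _) = (fun t => N%:R^-1 * \sum_(l < N) \sum_(j < N)
      (F (r%:C * expi t) * (if (j <= l)%N then w t ^+ (l - j) else 0)))); last first.
    apply/funext => t; rewrite /S mulrCA; congr (_ * _).
    by rewrite mulr_sumr; apply: eq_bigr => l _; rewrite mulr_sumr.
  have cTl (l : nat) := @ccont_sum R N (fun j t => F (r%:C * expi t) *
    (if (j <= l)%N then w t ^+ (l - j) else 0)) (cT l).
  rewrite cintZ; last exact: (@ccont_sum R N (fun l t => \sum_(j < N) (F (r%:C * expi t) *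
    (if (j <= l)%N then w t ^+ (l - j) else 0)))).
  congr (_ * _).
  rewrite (@cint_sum R N (fun l t => \sum_(j < N) (F (r%:C * expi t) *
    (if (j <= l)%N then w t ^+ (l - j) else 0))))//.
  apply: eq_bigr => l _.
  rewrite (@cint_sum R N (fun j t => F (r%:C * expi t) *
    (if (j <= l)%N then w t ^+ (l - j) else 0)))//.
  apply: eq_bigr => j _; rewrite fourier_circle// -zE (laurent_indep _ eF rho0 r0).
  case: leqP => jl; last first.
    by under eq_fun do rewrite mulr0; rewrite cint_cst mul0r.
  rewrite /laurent -cintZ; last exact: ccont_laurent.
  congr cint; apply/funext => t; rewrite /w expr_div_n; ring.
apply/eqP; rewrite -subr_eq0 -cabs_eq0 eq_le cabs_ge0 andbT.
apply/ler_addgt0Pl => e e0; rewrite addr0.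
have [N0 HN] := fejer_cvg cg (divr_gt0 e0 (ltr0n _ 2)).
rewrite addr0 -zE in HN.
have q10 : 0 < (1 - q) by rewrite subr_gt0.
pose D := B * (1 - q)^-1.
have D0 : 0 <= D by rewrite mulr_ge0// invr_ge0 ltW.
(* Large enough for the Fejer error and for the Cesaro remainder D / ((1 - q) N), each at most
   [e / 2]. *)
pose N := (N0 + (Num.trunc (2 * D / (1 - q) / e)).+1)%N.
have Npos : (0 < N)%N by rewrite /N addnS.
have {HN} := HN N (leq_addr _ _) Npos; rewrite IN => HN.
have NR : 0 < N%:R :> R by rewrite ltr0n.
have ND : D / (1 - q) / N%:R <= e / 2.
  have t : 2 * D / (1 - q) / e < N%:R.
    by apply: lt_le_trans (truncnS_gt _) _; rewrite ler_nat leq_addl.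
  rewrite ler_pdivrMr//; move: t; rewrite ltr_pdivrMr// -[2 * D / _]mulrA.
  by move: (D / (1 - q)) => u; lra.
rewrite -(subrK (cint (fun t => F (r%:C * expi t) * S N t) 0 1) (F z)) -addrA.
apply: (le_trans (cabsD _ _)); rewrite [e]splitr; apply: lerD; first by rewrite cabsC.
have cFS : ccont (fun t => F (r%:C * expi t) * S N t) := ccontM cF (cS N).
have cFw : ccont (fun t => F (r%:C * expi t) * (1 - w t)^-1) := ccontM cF cw1.
rewrite -cintB//; apply: le_trans ND.
have := @cint_bound_cst _ (fun t => F (r%:C * expi t) * S N t - F (r%:C * expi t) * (1 - w t)^-1)
  (D / (1 - q) / N%:R) 0 1 (ccontB cFS cFw) ler01.
rewrite subr0 mulr1; apply => t t01.
rewrite -mulrBr cabsM /S cesaro_geom// cabsN !cabsM !cabsV cabs_nat.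
have B1 : cabs (F (r%:C * expi t)) <= B by apply: cmax; rewrite in_itv.
have W1 : 1 - q <= cabs (1 - w t).
  by rewrite -(wq t) -{1}(@cabs1 R) cabs_sub_le.
have G : cabs (\sum_(l < N) w t ^+ l.+1) <= (1 - q)^-1.
  apply: (le_trans (cabs_sum _ (fun l => w t ^+ l.+1))).
  rewrite (eq_bigr (fun l : 'I_N => q ^+ l * q)) => [|l _]; last by rewrite cabsX wq exprSr.
  rewrite -mulr_suml -(ler_pM2l q10) mulfV ?lt0r_neq0// mulrA.
  have -> : (1 - q) * \sum_(l < N) q ^+ l = 1 - q ^+ N.
    by rewrite -[RHS]opprB subrX1; ring.
  have : 0 <= q ^+ N by rewrite exprn_ge0.
  move: (q ^+ N) => qN qN0; nra.
have V1 : (cabs (1 - w t))^-1 <= (1 - q)^-1.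
  by rewrite lef_pV2 ?posrE// (lt_le_trans q10).
rewrite /D -!mulrA; apply: ler_pM => //; rewrite ?cabs_ge0 ?mulr_ge0 ?invr_ge0 ?cabs_ge0//.
rewrite [leRHS](_ : _ = N%:R^-1 * ((1 - q)^-1 * (1 - q)^-1)); last by rewrite mulrA mulrC.
rewrite ler_wpM2l ?invr_ge0// ler_pM ?cabs_ge0 ?invr_ge0 ?cabs_ge0//.
Qed.

End CauchyFormula.

(** * Regularity of entire functions, Cauchy estimates, division and Liouville *)

Section CauchyConsequences.
Variable R : realType.
Local Notation C := R[i].
Implicit Types (F : C -> C) (a b x y r : R) (z w : C).

Lemma cder_quadratic F z (d : C) (del K : R) : 0 < del ->
  (forall h, cabs h < del -> cabs (F (z + h) - F z - d * h) <= K * cabs h ^+ 2) ->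
  cder F z d.
Proof.
move=> del0 H e e0; have K1 : 0 < `|K| + 1 by rewrite ltr_wpDl.
exists (Num.min del (e / (`|K| + 1))); first by rewrite lt_min del0 divr_gt0.
move=> h; rewrite lt_min ltr_pdivlMr// => /andP[hd he].
apply: (le_trans (H h hd)); rewrite expr2 mulrA ler_wpM2r ?cabs_ge0//.
apply: le_trans (ltW he); rewrite mulrC ler_wpM2l ?cabs_ge0//.
by rewrite (le_trans (ler_norm _))// lerDl.
Qed.

(** Differentiation under the integral sign, where a quadratic remainder uniform in [t] plays the
    part of a dominating function. *)
Lemma cder_cint (f : R -> C -> C) (f' : R -> C) z (del K : R) : 0 < del ->
  (forall h, cabs h < del -> ccont (fun t => f t (z + h))) -> ccont f' ->
  (forall t h, 0 <= t <= 1 -> cabs h < del ->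
     cabs (f t (z + h) - f t z - f' t * h) <= K * cabs h ^+ 2) ->
  cder (fun w => cint (fun t => f t w) 0 1) z (cint f' 0 1).
Proof.
move=> del0 cf cf' H; apply: (@cder_quadratic _ _ _ del K del0) => h hd.
have c0 : ccont (fun t => f t z) by have := cf 0; rewrite cabs0 addr0; apply.
have c1 := cf h hd.
have c2 : ccont (fun t => f' t * h) := ccontM cf' (ccont_cst _).
rewrite -cintZr// -cintB// -cintB//; last exact: ccontB.
have := @cint_bound_cst _ (fun t => f t (z + h) - f t z - f' t * h) (K * cabs h ^+ 2)
  0 1 (ccontB (ccontB c1 c0) c2) ler01.
by rewrite subr0 mulr1; apply => t ?; exact: H.
Qed.

Section CauchyType.
Variables (r : R) (phi : R -> C).
Hypothesis cphi : ccont phi.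

Let u t := r%:C * expi t : C.

Lemma circ_dist z t : 0 < r -> r - cabs z <= cabs (u t - z).
Proof.
move=> r0; apply: le_trans (cabs_sub_le _ _).
by rewrite /u cabsM cabs_expi mulr1 cabs_real ger0_norm// ltW.
Qed.

Lemma circ_sub_neq0 z t : cabs z < r -> u t - z != 0.
Proof.
move=> zr; rewrite -cabs_gt0; apply: lt_le_trans (circ_dist z t _).
  by rewrite subr_gt0.
exact: le_lt_trans (cabs_ge0 _) zr.
Qed.

Lemma ccont_cauchy z n : cabs z < r -> ccont (fun t => phi t / (u t - z) ^+ n).
Proof.
move=> zr; apply: ccontM => //; apply: ccontV.
  by apply: ccontX; exact: ccontB (ccont_circ _) (ccont_cst _).
by move=> t; rewrite expf_neq0// circ_sub_neq0.
Qed.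

Lemma phi_bounded : exists2 B, 0 <= B & forall t, 0 <= t <= 1 -> cabs (phi t) <= B.
Proof.
have [c _ cmax] := EVT_max (ler01 : (0 : R) <= 1) (continuous_subspaceT (ccont_cabs cphi)).
by exists (cabs (phi c)) => [|t t01]; [exact: cabs_ge0|apply: cmax; rewrite in_itv].
Qed.

Lemma cauchy_type1_quad (rho : R) : rho < r -> exists K, forall t z h, 0 <= t <= 1 ->
  cabs z <= rho -> cabs (z + h) <= rho ->
  cabs (phi t / (u t - (z + h)) - phi t / (u t - z) - phi t / (u t - z) ^+ 2 * h)
  <= K * cabs h ^+ 2.
Proof.
move=> rr; have [B B0 HB] := phi_bounded.
exists (B / (r - rho) ^+ 3) => t z h t01 z1 z2.
have r0 : 0 < r by apply: le_lt_trans rr; exact: le_trans (cabs_ge0 _) z1.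
have d0 : 0 < r - rho by rewrite subr_gt0.
have A1 : r - rho <= cabs (u t - z) by apply: le_trans (circ_dist _ _ r0); rewrite lerD2l lerN2.
have A2 : r - rho <= cabs (u t - (z + h)) by apply: le_trans (circ_dist _ _ r0); rewrite lerD2l lerN2.
have n1 : u t - z != 0 by rewrite -cabs_gt0 (lt_le_trans d0).
have n2 : u t - (z + h) != 0 by rewrite -cabs_gt0 (lt_le_trans d0).
rewrite (_ : _ - _ - _ = phi t * ((u t - z) ^+ 2 * (u t - (z + h)))^-1 * h ^+ 2); last first.
  by field; rewrite n1 n2.
rewrite !cabsM cabsV cabsM !cabsX ler_wpM2r ?sqr_ge0//.
apply: ler_pM; rewrite ?cabs_ge0 ?invr_ge0 ?mulr_ge0 ?sqr_ge0 ?cabs_ge0 ?HB//.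
rewrite lef_pV2 ?posrE ?mulr_gt0 ?exprn_gt0 ?(lt_le_trans d0)//.
rewrite exprSr; apply: ler_pM; rewrite ?exprn_ge0 ?(ltW d0)//.
by rewrite ler_pXn2r ?nnegrE ?cabs_ge0 ?(ltW d0).
Qed.

(** With a = u - z and b = a - h the remainder is phi h^2 (2 b + a) / (a^3 b^2), and |2 b + a| is
    bounded by a multiple of [r + rho]. *)
Lemma cauchy_type2_quad (rho : R) : rho < r -> exists K, forall t z h, 0 <= t <= 1 ->
  cabs z <= rho -> cabs (z + h) <= rho ->
  cabs (phi t / (u t - (z + h)) ^+ 2 - phi t / (u t - z) ^+ 2
     - 2 * (phi t / (u t - z) ^+ 3) * h) <= K * cabs h ^+ 2.
Proof.
move=> rr; have [B B0 HB] := phi_bounded.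
exists (B * (5 * (r + rho)) / (r - rho) ^+ 5) => t z h t01 z1 z2.
have rho0 : 0 <= rho := le_trans (cabs_ge0 _) z1.
have r0 : 0 < r by exact: le_lt_trans rr.
have d0 : 0 < r - rho by rewrite subr_gt0.
have A1 : r - rho <= cabs (u t - z) by apply: le_trans (circ_dist _ _ r0); rewrite lerD2l lerN2.
have A2 : r - rho <= cabs (u t - (z + h)) by apply: le_trans (circ_dist _ _ r0); rewrite lerD2l lerN2.
have n1 : u t - z != 0 by rewrite -cabs_gt0 (lt_le_trans d0).
have n2 : u t - (z + h) != 0 by rewrite -cabs_gt0 (lt_le_trans d0).
have ur : cabs (u t) = r by rewrite /u cabsM cabs_expi mulr1 cabs_real ger0_norm// ltW.
rewrite (_ : _ - _ - _ = phi t * (2 * (u t - (z + h)) + (u t - z))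
   * ((u t - z) ^+ 3 * (u t - (z + h)) ^+ 2)^-1 * h ^+ 2); last first.
  by field; rewrite n1 n2.
rewrite !cabsM cabsV cabsM !cabsX ler_wpM2r ?sqr_ge0//.
apply: ler_pM; rewrite ?invr_ge0 ?mulr_ge0 ?exprn_ge0 ?cabs_ge0//.
  apply: ler_pM; rewrite ?cabs_ge0 ?HB//.
  apply: (le_trans (cabsD _ _)); rewrite cabsM cabs_nat.
  have := cabsB (u t) z; have := cabsB (u t) (z + h); rewrite ur; lra.
rewrite lef_pV2 ?posrE ?mulr_gt0 ?exprn_gt0 ?(lt_le_trans d0)//.
rewrite -[5%N]/(3 + 2)%N exprD.
by apply: ler_pM; rewrite ?exprn_ge0 ?(ltW d0)// ler_pXn2r ?nnegrE ?cabs_ge0 ?(ltW d0).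
Qed.

Lemma cauchy_type1_cder z : cabs z < r ->
  cder (fun w => cint (fun t => phi t / (u t - w)) 0 1) z
    (cint (fun t => phi t / (u t - z) ^+ 2) 0 1).
Proof.
move=> zr; pose rho := (cabs z + r) / 2.
have rr : rho < r by rewrite /rho; lra.
have zz : cabs z < rho by rewrite /rho; lra.
have [K HK] := cauchy_type1_quad rr.
have hz h : cabs h < rho - cabs z -> cabs (z + h) <= rho.
  by move=> hd; apply: (le_trans (cabsD _ _)); rewrite -lerBrDl ltW.
apply: (@cder_cint (fun t w => phi t / (u t - w)) _ _ (rho - cabs z) K).
- by rewrite subr_gt0.
- move=> h /hz hd; have := @ccont_cauchy (z + h) 1 (le_lt_trans hd rr).
  by under eq_fun do rewrite expr1.
- exact: ccont_cauchy.
- by move=> t h t01 /hz hd; apply: HK => //; exact: ltW.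
Qed.

Lemma cauchy_type2_cder z : cabs z < r ->
  cder (fun w => cint (fun t => phi t / (u t - w) ^+ 2) 0 1) z
    (cint (fun t => 2 * (phi t / (u t - z) ^+ 3)) 0 1).
Proof.
move=> zr; pose rho := (cabs z + r) / 2.
have rr : rho < r by rewrite /rho; lra.
have zz : cabs z < rho by rewrite /rho; lra.
have [K HK] := cauchy_type2_quad rr.
have hz h : cabs h < rho - cabs z -> cabs (z + h) <= rho.
  by move=> hd; apply: (le_trans (cabsD _ _)); rewrite -lerBrDl ltW.
apply: (@cder_cint (fun t w => phi t / (u t - w) ^+ 2) _ _ (rho - cabs z) K).
- by rewrite subr_gt0.
- by move=> h /hz hd; apply: ccont_cauchy; exact: le_lt_trans rr.
- by apply: ccontM (ccont_cst _) _; exact: ccont_cauchy.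
- by move=> t h t01 /hz hd; apply: HK => //; exact: ltW.
Qed.

End CauchyType.

Lemma cderiv_cauchy F r z : entire F -> cabs z < r ->
  cderiv F z = cint (fun t => F (r%:C * expi t) * (r%:C * expi t) / (r%:C * expi t - z) ^+ 2) 0 1.
Proof.
move=> eF zr; apply: cderivE.
have cphi : ccont (fun t => F (r%:C * expi t) * (r%:C * expi t)).
  exact: ccontM (ccont_circle0 _ eF) (ccont_circ _).
have d0 : 0 < r - cabs z by rewrite subr_gt0.
apply: cder_near d0 _ (cauchy_type1_cder cphi zr) => w wz.
rewrite (@cauchy_formula _ F r w)//.
have := cabsD (w - z) z; rewrite subrK; lra.
Qed.

(** The derivative is again an integral of Cauchy type, with a squared denominator, hence
    differentiable. *)
Lemma entire_cderiv F : entire F -> entire (cderiv F).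
Proof.
move=> eF; apply/entireP => z; pose r := cabs z + 1.
have zr : cabs z < r by rewrite ltrDl.
have cphi : ccont (fun t => F (r%:C * expi t) * (r%:C * expi t)).
  exact: ccontM (ccont_circle0 _ eF) (ccont_circ _).
have d0 : 0 < r - cabs z by rewrite subr_gt0.
eexists; apply: cder_near d0 _ (cauchy_type2_cder cphi zr) => w wz.
rewrite (@cderiv_cauchy F r w)//.
have := cabsD (w - z) z; rewrite subrK; lra.
Qed.

(** Uniformity of [K] on the disc is what allows differentiation under the integral sign for the
    primitive along a segment. *)
Lemma entire_quad F rho : entire F -> exists K, forall z h,
  cabs z <= rho -> cabs (z + h) <= rho ->
  cabs (F (z + h) - F z - cderiv F z * h) <= K * cabs h ^+ 2.
Proof.
move=> eF; pose r := rho + 1; have rr : rho < r by rewrite ltrDl.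
have cphi : ccont (fun t => F (r%:C * expi t) * (r%:C * expi t)).
  exact: ccontM (ccont_circle0 _ eF) (ccont_circ _).
have [K HK] := cauchy_type1_quad cphi rr; exists K => z h z1 z2.
have zr := le_lt_trans z1 rr; have zhr := le_lt_trans z2 rr.
rewrite (cauchy_formula eF zr) (cauchy_formula eF zhr) (cderiv_cauchy eF zr).
have c1 := @ccont_cauchy r _ cphi z 1 zr.
have c2 := @ccont_cauchy r _ cphi (z + h) 1 zhr.
move: c1 c2; under eq_fun do rewrite expr1; move=> c1.
under eq_fun do rewrite expr1; move=> c2.
have c3 := @ccont_cauchy r _ cphi z 2 zr.
have c3h := ccontM c3 (ccont_cst h).
rewrite -cintZr// -cintB// -cintB//; last exact: ccontB.
have := cint_bound_cst (ccontB (ccontB c2 c1) c3h) ler01 (fun t t01 => HK t z h t01 z1 z2).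
by rewrite subr0 mulr1.
Qed.

Lemma entire_bounded F r : entire F ->
  exists2 B, 0 <= B & forall z, cabs z <= r -> cabs (F z) <= B.
Proof.
move=> eF; have [r0|r0] := ltP r 0.
  by exists 0 => // z /le_lt_trans/(_ r0); rewrite ltNge cabs_ge0.
pose s := r + 1; have s0 : 0 < s by rewrite ltr_wpDl.
have cphi : ccont (fun t => F (s%:C * expi t) * (s%:C * expi t)).
  exact: ccontM (ccont_circle0 _ eF) (ccont_circ _).
have [B B0 HB] := phi_bounded cphi; exists B => // z zr.
have zs : cabs z < s by rewrite (le_lt_trans zr)// ltrDl.
rewrite (cauchy_formula eF zs).
have c1 := @ccont_cauchy s _ cphi z 1 zs; move: c1.
under eq_fun do rewrite expr1; move=> c1.
have := @cint_bound_cst _ _ B _ _ c1 ler01; rewrite subr0 mulr1; apply => t t01.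
rewrite cabsM cabsV ler_pdivrMr; last by rewrite cabs_gt0 circ_sub_neq0.
apply: (le_trans (HB t t01)); rewrite ler_peMr//.
apply: le_trans (circ_dist _ _ s0); rewrite /s; lra.
Qed.

(** Cauchy's estimate on the unit circle about [z]. *)
Lemma cderiv_bound F z (M : R) : entire F ->
  (forall w, cabs (w - z) <= 1 -> cabs (F w) <= M) -> cabs (cderiv F z) <= M.
Proof.
move=> eF H; pose G w := F (z + w).
have eG : entire G.
  exact (entire_comp eF (entireD (@entire_cst R z) (@entire_id R))).
have zE : cderiv F z = cderiv G 0.
  apply/esym/cderivE; have H1 : cder (fun w => z + w) 0 1.
    by apply: cder_eq (cderD (cder_cst z 0) (cder_id 0)) _; rewrite add0r.
  rewrite -[X in cder _ _ X](mulr1 (cderiv F z)); apply: (cder_comp H1).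
  by rewrite addr0; exact: cderivP.
have z1 : cabs (0 : C) < 1 by rewrite cabs0.
have cphi : ccont (fun t => G (1%:C * expi t) * (1%:C * expi t)).
  exact: ccontM (ccont_circle0 _ eG) (ccont_circ _).
rewrite zE (cderiv_cauchy eG z1).
have := @cint_bound_cst _ _ M _ _ (@ccont_cauchy 1 _ cphi 0 2 z1) ler01.
rewrite subr0 mulr1; apply => t _.
have e1 : cabs (1%:C * expi t : C) = 1 by rewrite cabsM cabs_expi cabs1 mulr1.
rewrite subr0 cabsM cabsM cabsV cabsX e1 expr1n invr1 !mulr1 /G; apply: H.
by rewrite [z + _]addrC addrK e1.
Qed.

Definition divdiff F (p : C) z : C := if z == p then cderiv F p else (F z - F p) / (z - p).

Lemma divdiffE F (p : C) z : F z = F p + (z - p) * divdiff F p z.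
Proof.
rewrite /divdiff; case: eqVneq => [->|za]; first by rewrite subrr mul0r addr0.
by rewrite mulrC divfK ?subr_eq0// subrKC.
Qed.

(** Since (u / (u - w) - 1) / w = 1 / (u - w), the difference of two Cauchy formulas divided by [w]
    is itself of Cauchy type, and this expression is regular at w = 0 too. *)
Lemma entire_divdiff F (p : C) : entire F -> entire (divdiff F p).
Proof.
move=> eF; pose G w := F (p + w).
have eG : entire G.
  exact (entire_comp eF (entireD (@entire_cst R p) (@entire_id R))).
have dG : cderiv F p = cderiv G 0.
  apply/esym/cderivE; have H1 : cder (fun w => p + w) 0 1.
    by apply: cder_eq (cderD (cder_cst p 0) (cder_id 0)) _; rewrite add0r.
  rewrite -[X in cder _ _ X](mulr1 (cderiv F p)); apply: (cder_comp H1).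
  by rewrite addr0; exact: cderivP.
apply/entireP => z; pose r := cabs (z - p) + 1.
have zr : cabs (z - p) < r by rewrite ltrDl.
have r0 : 0 < r by exact: le_lt_trans (cabs_ge0 _) zr.
have cphi : ccont (fun t => G (r%:C * expi t)) := ccont_circle0 r eG.
have H1 : cder (fun w => w - p) z 1.
  by apply: cder_eq (cderB (cder_id z) (cder_cst _ _)) _; rewrite subr0.
eexists; apply: cder_near (cder_comp H1 (cauchy_type1_cder cphi zr)).
  exact: ltr01.
move=> w wz; have wr : cabs (w - p) < r.
  by have := cabsD (w - z) (z - p); rewrite addrA subrK /r; lra.
have c0r : cabs (0 : C) < r by rewrite cabs0.
rewrite /divdiff; case: eqVneq => [->|wa].
  rewrite dG (cderiv_cauchy eG c0r) subrr; congr cint; apply/funext => t.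
  have := @circ_neq0 R r t r0; rewrite !subr0; move: (r%:C * expi t) => u u0.
  by field.
have -> : F w = G (w - p) by rewrite /G subrKC.
have -> : F p = G 0 by rewrite /G addr0.
rewrite (cauchy_formula eG wr) (cauchy_formula eG c0r).
have cphi' : ccont (fun t => G (r%:C * expi t) * (r%:C * expi t)).
  exact: ccontM (ccont_circle0 _ eG) (ccont_circ _).
have c1 := @ccont_cauchy r _ cphi' (w - p) 1 wr.
have c2 := @ccont_cauchy r _ cphi' 0 1 c0r.
move: c1 c2; under eq_fun do rewrite expr1; move=> c1.
under eq_fun do rewrite expr1; move=> c2.
rewrite -cintB// -cintZr; last exact: ccontB.
congr cint; apply/funext => t; rewrite subr0.
have u0 := @circ_neq0 R r t r0; have u1 := @circ_sub_neq0 r (w - p) t wr.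
have wa0 : w - p != 0 by rewrite subr_eq0.
move: u0 u1; move: (r%:C * expi t) => u u0 u1.
by field; rewrite u0 wa0 u1.
Qed.

(** The bound is needed only on a sequence of circles, which can be chosen to avoid the zeros of the
    sine. *)
Lemma liouville_zero F (K : R) (rad : nat -> R) : entire F ->
  (forall n, n%:R < rad n) ->
  (forall n z, cabs z = rad n -> cabs (F z) <= K / rad n) ->
  forall z, F z = 0.
Proof.
move=> eF radn HF z; apply/eqP; rewrite -cabs_eq0 eq_le cabs_ge0 andbT.
apply/ler_addgt0Pl => e e0; rewrite addr0.
(* The integrand is at most |K| / (r - |z|), hence at most [e] once r exceeds |z| + |K| / e. *)
pose n := (Num.trunc (cabs z + `|K| / e)).+1; pose r := rad n.
have rn : cabs z + `|K| / e < r by apply: lt_trans (truncnS_gt _) (radn n).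
have zr : cabs z < r.
  by apply: le_lt_trans rn; rewrite lerDl mulr_ge0// invr_ge0 ltW.
have r0 : 0 < r := le_lt_trans (cabs_ge0 _) zr.
rewrite (cauchy_formula eF zr).
have cphi : ccont (fun t => F (r%:C * expi t) * (r%:C * expi t)).
  exact: ccontM (ccont_circle0 _ eF) (ccont_circ _).
have c1 := @ccont_cauchy r _ cphi z 1 zr; move: c1; under eq_fun do rewrite expr1; move=> c1.
have := @cint_bound_cst _ _ e _ _ c1 ler01; rewrite subr0 mulr1; apply => t t01.
rewrite cabsM cabsV ler_pdivrMr; last by rewrite cabs_gt0 circ_sub_neq0.
have ur : cabs (r%:C * expi t) = r by rewrite cabsM cabs_expi mulr1 cabs_real ger0_norm// ltW.
rewrite cabsM ur; apply: (@le_trans _ _ `|K|).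
  rewrite -ler_pdivlMr//; apply: (le_trans (HF n _ ur)).
  by rewrite ler_wpM2r ?invr_ge0 ?ler_norm// ltW.
apply: (@le_trans _ _ (e * (r - cabs z))).
  by rewrite mulrC -ler_pdivrMr// lerBrDl ltW.
by rewrite ler_wpM2l ?(ltW e0)// circ_dist.
Qed.

End CauchyConsequences.

(** * Functions of exponential type *)

Section PhragmenLindelof.
Variable R : realType.
Local Notation C := R[i].
Implicit Types (F : C -> C) (a b c d x y u v r : R) (z w : C).

Lemma rectangle_EVT_max (f : R -> R -> R) a b c d : a <= b -> c <= d ->
  (forall x y e, 0 < e -> exists2 del, 0 < del & forall x' y',
     `|x' - x| < del -> `|y' - y| < del -> `|f x' y' - f x y| < e) ->
  exists x0 y0, [/\ a <= x0 <= b, c <= y0 <= d &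
    forall x y, a <= x <= b -> c <= y <= d -> f x y <= f x0 y0].
Proof.
move=> ab cd cf; pose A : set (R * R) := `[a, b]%classic `*` `[c, d]%classic.
have A0 : A !=set0 by exists (a, c); split => /=; rewrite in_itv/= lexx.
have cA : compact A by apply: compact_setX; exact: segment_compact.
pose g (p : R * R) := f p.1 p.2.
have cg : continuous g.
  move=> p; apply/cvgrPdist_lt => e e0; have [del d0 K] := cf p.1 p.2 e e0.
  apply: (filterS _ (nbhsx_ballx p del d0)) => q [q1 q2]; rewrite distrC; apply: K.
    by move: q1; rewrite -?ball_normE /ball_/= distrC.
  by move: q2; rewrite -?ball_normE /ball_/= distrC.
have [p pA pmax] := compact_EVT_max A0 cA (continuous_subspaceT cg).
move: pA; rewrite inE => -[p1 p2]; exists p.1, p.2; split.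
- by move: p1; rewrite /= in_itv.
- by move: p2; rewrite /= in_itv.
- by move=> x y xab ycd; apply: (pmax (x, y)); rewrite inE; split; rewrite /= in_itv.
Qed.

(** The cross term has mean zero over the circle, so the average of |z|^2 exceeds its value at the
    centre by r^2. *)
Lemma cabs_circle_sqr (p : C) r t : 0 < r -> cabs (p + r%:C * expi t) ^+ 2 =
  (cabs p ^+ 2 + r ^+ 2) + 2 * complex.Re (conjc p * (r%:C * expi t)).
Proof.
move=> r0; have := cabs_sqr (r%:C * expi t).
rewrite cabsM cabs_expi mulr1 cabs_real real_normK ?num_real// => ->.
rewrite !cabs_sqr ReD ImD ReM; case: p => p1 p2 /=; ring.
Qed.

(* A maximum point [p] of [|F z| + del |z|^2] cannot be interior: averaging over
   a circle of radius [r] centred at [p] gains [del r^2]. *)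
Theorem maximum_modulus F a b c d (B : R) : entire F -> a <= b -> c <= d ->
  (forall x y, a <= x <= b -> c <= y <= d ->
     x = a \/ x = b \/ y = c \/ y = d -> cabs (F (x +i* y)) <= B) ->
  forall x y, a <= x <= b -> c <= y <= d -> cabs (F (x +i* y)) <= B.
Proof.
move=> eF ab cd HB x1 y1 x1ab y1cd.
pose M := `|a| + `|b| + `|c| + `|d|.
apply/ler_addgt0Pl => e e0.
(* On the rectangle |z|^2 is at most M^2, so the perturbation costs at most [e]. *)
pose del := e / (M ^+ 2 + 1).
have M1 : 0 < M ^+ 2 + 1 by rewrite ltr_wpDl// sqr_ge0.
have del0 : 0 < del by rewrite divr_gt0.
have delM : del * (M ^+ 2 + 1) = e by rewrite divfK// lt0r_neq0.
clearbody del.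
pose f x y := cabs (F (x +i* y)) + del * (x ^+ 2 + y ^+ 2).
have cf x y e' : 0 < e' -> exists2 dl, 0 < dl & forall x' y',
     `|x' - x| < dl -> `|y' - y| < dl -> `|f x' y' - f x y| < e'.
  move=> e'0.
  have [d1 d10 H1] := cder_cont (cderivP (x +i* y) eF) (divr_gt0 e'0 (ltr0n _ 2)).
  pose N := 2 * (`|x| + `|y| + 1) * del.
  have N0 : 0 <= N by apply: mulr_ge0 (ltW del0); rewrite mulr_ge0// !addr_ge0.
  have N1 : 0 < 2 * N + 1 by rewrite ltr_wpDl// mulr_ge0.
  exists (Num.min (d1 / 2) (Num.min 1 (e' / 2 / (2 * N + 1)))).
    by rewrite !lt_min ltr01 !divr_gt0.
  move=> x' y'; rewrite !lt_min => /and3P[x1' x2' x3'] /and3P[y1' y2' y3'].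
  have hd : cabs ((x' +i* y') - (x +i* y)) < d1.
    apply: (le_lt_trans (cabs_le_ReIm _)); rewrite /= [d1]splitr; exact: ltrD.
  have := H1 _ hd; rewrite subrKC => H2.
  have H3 : `|cabs (F (x' +i* y')) - cabs (F (x +i* y))| < e' / 2.
    apply: le_lt_trans H2; rewrite ler_norml lerNl opprB cabs_sub_le andbT.
    by rewrite cabsC cabs_sub_le.
  have sq (s s' : R) : `|s' - s| < 1 -> `|s' - s| < e' / 2 / (2 * N + 1) ->
      `|s| + 1 <= `|x| + `|y| + 1 ->
      `|del * (s' ^+ 2 - s ^+ 2)| < e' / 4.
    move=> s1 s2 sxy; rewrite subr_sqr !normrM (ger0_norm (ltW del0)).
    have S : `|s' + s| <= 2 * (`|x| + `|y| + 1).
      have -> : s' + s = (s' - s) + 2 * s by ring.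
      apply: (le_trans (ler_normD _ _)); rewrite normrM (ger0_norm (ler0n R 2)).
      by have := normr_ge0 s; lra.
    apply: (@le_lt_trans _ _ (N * `|s' - s|)).
      rewrite (_ : N * _ = del * (`|s' - s| * (2 * (`|x| + `|y| + 1)))); last by rewrite /N; ring.
      by rewrite ler_wpM2l ?(ltW del0)// ler_wpM2l.
    move: s2; rewrite ltr_pdivlMr// => s2.
    have := normr_ge0 (s' - s); nra.
  have sx := sq x x' x2' x3'; have sy := sq y y' y2' y3'.
  have {}sx := sx (ltac:(by have := normr_ge0 y; lra)).
  have {}sy := sy (ltac:(by have := normr_ge0 x; lra)).
  have -> : f x' y' - f x y = (cabs (F (x' +i* y')) - cabs (F (x +i* y))) +
     (del * (x' ^+ 2 - x ^+ 2) + del * (y' ^+ 2 - y ^+ 2)) by rewrite /f; ring.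
  apply: (le_lt_trans (ler_normD _ _)); rewrite [e']splitr; apply: ltrD => //.
  by apply: (le_lt_trans (ler_normD _ _)); lra.
have [x0 [y0 [x0ab y0cd fmax]]] := rectangle_EVT_max ab cd cf.
have sqM x y : a <= x <= b -> c <= y <= d -> x ^+ 2 + y ^+ 2 <= M ^+ 2.
  have nb (t : R) : - `|t| <= t <= `|t| by rewrite -ler_norml.
  have na (t : R) : 0 <= `|t| := normr_ge0 t.
  move=> xab ycd; have : `|x| <= `|a| + `|b|.
    by rewrite ler_norml; move: (nb a) (nb b) (na a) (na b) xab; lra.
  have : `|y| <= `|c| + `|d|.
    by rewrite ler_norml; move: (nb c) (nb d) (na c) (na d) ycd; lra.
  rewrite -(real_normK (num_real x)) -(real_normK (num_real y)) /M.
  have := normr_ge0 x; have := normr_ge0 y.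
  move: `|x| `|y| => X Y Y0 X0 HY HX; rewrite [leRHS](_ : _ = ((`|a| + `|b|) + (`|c| + `|d|)) ^+ 2); last by ring.
  move: (`|a| + `|b|) (`|c| + `|d|) HX HY => P S; nra.
have fin x y : a <= x <= b -> c <= y <= d -> del * (x ^+ 2 + y ^+ 2) <= e.
  move=> /sqM H /H {}H; apply: (@le_trans _ _ (del * (M ^+ 2 + 1))).
    by rewrite ler_wpM2l ?(ltW del0)//; lra.
  by rewrite delM.
have fle : cabs (F (x1 +i* y1)) <= f x0 y0.
  apply: le_trans (fmax _ _ x1ab y1cd); rewrite /f lerDl mulr_ge0 ?(ltW del0)//.
  by rewrite addr_ge0 ?sqr_ge0.
have [bd|/not_orP[xa /not_orP[xb /not_orP[yc yd]]]] :=
    pselect (x0 = a \/ x0 = b \/ y0 = c \/ y0 = d).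
  apply: (le_trans fle); rewrite /f addrC; apply: lerD; first exact: fin.
  exact: HB.
exfalso.
have {}xa : a < x0 by rewrite lt_neqAle eq_sym; move/eqP: xa => ->; case/andP: x0ab.
have {}xb : x0 < b by rewrite lt_neqAle; move/eqP: xb => ->; case/andP: x0ab.
have {}yc : c < y0 by rewrite lt_neqAle eq_sym; move/eqP: yc => ->; case/andP: y0cd.
have {}yd : y0 < d by rewrite lt_neqAle; move/eqP: yd => ->; case/andP: y0cd.
pose r := Num.min (Num.min (x0 - a) (b - x0)) (Num.min (y0 - c) (d - y0)).
have r0 : 0 < r by rewrite /r !lt_min !subr_gt0 xa xb yc yd.
have [r1 r2 r3 r4] : [/\ r <= x0 - a, r <= b - x0, r <= y0 - c & r <= d - y0].
  by rewrite /r !ge_min !lexx !orbT.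
pose p := x0 +i* y0 : C.
have wt t : cabs (F (p + r%:C * expi t)) <= f x0 y0 - del * cabs (p + r%:C * expi t) ^+ 2.
  have cu : cabs (r%:C * expi t) = r by rewrite cabsM cabs_expi mulr1 cabs_real gtr0_norm.
  have := Re_le_cabs (r%:C * expi t); have := Im_le_cabs (r%:C * expi t).
  rewrite cu cabs_sqr ReD ImD; case: (r%:C * expi t) => s1 s2 /=; rewrite !ler_norml.
  move=> h2 h1; rewrite lerBrDr; apply: (fmax (x0 + s1) (y0 + s2)); lra.
pose Q t := complex.Re (conjc p * (r%:C * expi t)).
have cu : ccont (fun t => conjc p * (r%:C * expi t)) := ccontM (ccont_cst _) (ccont_circ _).
have cQ : continuous Q := cu.1.
have IQ : intR Q 0 1 = 0.
  have := Re_cint (fun t => conjc p * (r%:C * expi t)) 0 1.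
  by rewrite (cintZ _ _ _ (ccont_circ r)) (mean_value (@entire_id R) r0) mulr0 => <-.
have cF := ccont_circle p r eF.
(* Equals |F p| - del r^2, because f x0 y0 = |F p| + del |p|^2; bounding |F p| by it is the
   contradiction. *)
pose K := f x0 y0 - del * (cabs p ^+ 2 + r ^+ 2).
have cK := cntD (@cnst R K) (cntM (@cnst R (- (2 * del))) cQ).
have := cint_bound cF cK ler01 (fun t _ => _).
have -> : cint (fun t => F (p + r%:C * expi t)) 0 1 = F p.
  have eG : entire (fun w => F (p + w)) by exact (entire_comp eF (entireD (@entire_cst R p) (@entire_id R))).
  by rewrite (mean_value eG r0) addr0.
rewrite (intRD _ _ (@cnst R K) (cntM (@cnst R (- (2 * del))) cQ)) (intRZ _ _ _ cQ) IQ intR_cst.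
rewrite subr0 mulr1 mulr0 addr0 => H.
have : cabs (F p) <= K.
  apply: H => t; apply: (le_trans (wt t)); rewrite (cabs_circle_sqr _ _ r0) /K -/(Q t).
  move: (f x0 y0) (Q t) => f0 Qt; lra.
rewrite /K /f cabs_sqr /= -/p.
have : 0 < del * r ^+ 2 by rewrite mulr_gt0 ?exprn_gt0.
lra.
Qed.

End PhragmenLindelof.

(** * Phragmen-Lindelof theorems for sectors, and growth off the real line *)

Section Growth.
Variable R : realType.
Local Notation C := R[i].
Implicit Types (F : C -> C) (a b c d x y u v r : R) (z w : C).

(** The limit as [h] tends to 0, made explicit: exp(-h S) >= 1 - h S, and [h] is chosen with x h |S|
    at most [e]. *)
Lemma le_expR_limit (x b S : R) : 0 <= x ->
  (forall h, 0 < h -> x <= b * expR (h * S)) -> x <= b.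
Proof.
move=> x0 H; apply/ler_addgt0Pl => e e0.
pose h := e / (x * `|S| + 1).
have D0 : 0 < x * `|S| + 1 by rewrite ltr_wpDl// mulr_ge0.
have h0 : 0 < h by rewrite divr_gt0.
have hE : h * (x * `|S| + 1) = e by rewrite divfK// lt0r_neq0.
have := H h h0; rewrite -ler_pdivrMr ?expR_gt0// -expRN.
have := @expR_ge1Dx R (- (h * S)).
have : h * S <= h * `|S| by rewrite ler_wpM2l ?(ltW h0)// ler_norm.
move: (h * S) (expR (- (h * S))) hE => t E hE t1 E1 E2.
have : x * (1 + - t) <= b by apply: le_trans E2; rewrite ler_wpM2l.
have : x * t <= x * (h * `|S|) by rewrite ler_wpM2l.
lra.
Qed.

Lemma cos_ge_abs (t s : R) : `|t| <= s -> s <= pi -> cos s <= cos t.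
Proof.
move=> ts spi; rewrite -(cos_norm t) leNgt ltr_cos ?in_itv/= ?normr_ge0 ?(le_trans ts spi)//.
  by rewrite -leNgt.
by rewrite (le_trans (normr_ge0 t) ts) spi.
Qed.

(* The damping factor [exp (- h (e^(p w) + e^(- p w)))] is at most 1 in modulus
   on the strip, and beats the growth of [F] at both ends. *)
Theorem strip_phragmen_lindelof F (p beta B : R) : entire F ->
  0 < p -> 0 < beta -> p * beta < pi / 2 ->
  (forall u, cabs (F (u +i* beta)) <= B) -> (forall u, cabs (F (u +i* (- beta))) <= B) ->
  (forall e, 0 < e -> exists U, forall u v, U <= `|u| -> `|v| <= beta ->
     cabs (F (u +i* v)) <= B * expR (e * expR (p * `|u|))) ->
  forall u v, `|v| <= beta -> cabs (F (u +i* v)) <= B.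
Proof.
move=> eF p0 beta0 pb FB FNB FE u v vb.
have B0 : 0 <= B := le_trans (cabs_ge0 _) (FB 0).
(* The minimum of cos(p v) on the strip, positive because p beta < pi / 2. *)
pose k := cos (p * beta).
have pb0 : 0 < p * beta by rewrite mulr_gt0.
have k0 : 0 < k by apply: cos_gt0_pihalf; rewrite pb andbT; have := pi_gt0 R; lra.
have kv (v' : R) : `|v'| <= beta -> k <= cos (p * v').
  move=> v'b; apply: cos_ge_abs; last by have := pi_gt0 R; lra.
  by rewrite normrM (gtr0_norm p0) ler_wpM2l// ltW.
pose S (u' : R) := expR (p * u') + expR (- (p * u')).
have S0 u' : 0 <= S u' by rewrite addr_ge0 ?expR_ge0.
have SU u' : expR (p * `|u'|) <= S u'.
  rewrite /S; case: (ger0P u') => _; first by rewrite lerDl expR_ge0.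
  by rewrite mulrN lerDr expR_ge0.
pose E h w := cexp (- h%:C * (cexp (p%:C * w) + cexp (- (p%:C * w)))).
have eE h : entire (E h).
  have e1 := entireM (@entire_cst R p%:C) (@entire_id R).
  exact (entire_comp (@entire_cexp R) (entireM (@entire_cst R (- h%:C))
    (entireD (entire_comp (@entire_cexp R) e1)
      (entire_comp (@entire_cexp R) (entireN e1))))).
have EE h u' v' : cabs (E h (u' +i* v')) = expR (- (h * (cos (p * v') * S u'))).
  rewrite /E cabs_cexp; congr expR; rewrite /cexp /=; simpc => /=.
  by rewrite cosN /S; ring.
have EB h u' v' : 0 < h -> `|v'| <= beta -> cabs (E h (u' +i* v')) <= expR (- (h * (k * S u'))).
  move=> h0 v'b; rewrite EE ler_expR lerN2 ler_wpM2l ?(ltW h0)// ler_wpM2r//.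
  exact: kv.
have E1 h u' v' : 0 < h -> `|v'| <= beta -> cabs (E h (u' +i* v')) <= 1.
  move=> h0 /(EB h u' v' h0)/le_trans; apply.
  by rewrite -expR0 ler_expR oppr_le0 !mulr_ge0// ltW.
apply: (@le_expR_limit _ _ (cos (p * v) * S u) (cabs_ge0 _)) => h h0.
have [U HU] := FE _ (mulr_gt0 h0 k0).
(* The strip is cut at distance W, beyond U so that the growth hypothesis holds there, and beyond
   |u| so that the point stays inside. *)
pose W := `|U| + `|u|.
have W0 : 0 <= W by rewrite addr_ge0.
have WU : U <= W by rewrite (le_trans (ler_norm U))// lerDl.
have uW : - W <= u <= W.
  by rewrite -ler_norml lerDr.
have vbeta (v' : R) : (- beta <= v' <= beta) = (`|v'| <= beta) by rewrite ler_norml.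
have bb : - beta <= beta by lra.
have WW : - W <= W by lra.
have bdU u' v' : `|u'| = W -> `|v'| <= beta -> cabs (F (u' +i* v') * E h (u' +i* v')) <= B.
  move=> u'W v'b; rewrite cabsM.
  have := HU u' v'; rewrite u'W => /(_ WU v'b) => H1.
  apply: (le_trans (ler_pM (cabs_ge0 _) (cabs_ge0 _) H1 (EB h u' v' h0 v'b))).
  rewrite -mulrA -expRD -[leRHS]mulr1 ler_wpM2l// -expR0 ler_expR.
  have := SU u'; rewrite u'W -[h * k * _]mulrA => H2.
  have : h * (k * expR (p * W)) <= h * (k * S u').
    by rewrite !ler_wpM2l// ltW.
  lra.
have bdv u' v' : `|v'| = beta -> cabs (F (u' +i* v') * E h (u' +i* v')) <= B.
  move=> v'b; rewrite cabsM -[leRHS]mulr1; apply: ler_pM; rewrite ?cabs_ge0//.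
    have [->|->] : v' = beta \/ v' = - beta; [|exact: FB|exact: FNB].
    by move: v'b; case: (ger0P v') => _ <-; [left|right; rewrite opprK].
  by apply: E1; rewrite ?v'b.
have := @maximum_modulus _ (fun w => F w * E h w) (- W) W (- beta) beta B
  (entireM eF (eE h)) WW bb.
move=> /(_ _ u v uW); rewrite vbeta => MM.
have : cabs (F (u +i* v) * E h (u +i* v)) <= B.
  apply: MM => // u' v' u'W v'b; rewrite vbeta in v'b.
  case=> [->|[->|[->|->]]].
  - by apply: bdU; rewrite // normrN ger0_norm.
  - by apply: bdU; rewrite // ger0_norm.
  - by apply: bdv; rewrite normrN gtr0_norm.
  - by apply: bdv; rewrite gtr0_norm.
rewrite cabsM EE expRN => H; rewrite -ler_pdivrMr ?expR_gt0//.
Qed.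

(** Logarithmic coordinates: the sector of arguments in [0, 2 beta] corresponds to the strip |v| <=
    beta. *)
Lemma cexp_polar (z : C) (beta phi : R) : 0 < cabs z ->
  z = (cabs z)%:C * (cos phi +i* sin phi) ->
  z = cexp ((ln (cabs z) +i* (phi - beta)) + (0 +i* beta)).
Proof.
move=> z0 zE; rewrite {1}zE /cexp /= addr0 subrK lnK ?posrE//.
Qed.

Lemma entire_expshift F beta : entire F -> entire (fun w => F (cexp (w + (0 +i* beta)))).
Proof.
move=> eF; exact (entire_comp eF (entire_comp (@entire_cexp R)
  (entireD (@entire_id R) (@entire_cst R (0 +i* beta))))).
Qed.

Lemma cexp_shiftE u v beta : cexp ((u +i* v) + (0 +i* beta)) =
  (expR u)%:C * (cos (v + beta) +i* sin (v + beta)) :> C.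
Proof. by rewrite /cexp /= addr0. Qed.

Lemma cabs_cexp_shift u v beta : cabs (cexp ((u +i* v) + (0 +i* beta))) = expR u :> R.
Proof. by rewrite cabs_cexp /= addr0. Qed.

(** In the strip of half width pi / 4 the growth exp(tau |z|) becomes exp(tau e^u). The exponent p
    must exceed 1 to beat it and be below 2 to have p beta < pi / 2; 4/3 is such a value. *)
Theorem quadrant_phragmen_lindelof F (B K tau : R) : entire F -> 0 < B -> 0 < K -> 0 <= tau ->
  (forall z, cabs (F z) <= K * expR (tau * cabs z)) ->
  (forall x, 0 <= x -> cabs (F x%:C) <= B) -> (forall y, 0 <= y -> cabs (F (0 +i* y)) <= B) ->
  forall x y, 0 <= x -> 0 <= y -> cabs (F (x +i* y)) <= B.
Proof.
move=> eF B0 K0 tau0 FK FB FiB x y x0 y0.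
have p0 := pi_gt0 R.
pose beta : R := pi / 4; have beta0 : 0 < beta by rewrite divr_gt0.
pose G w := F (cexp (w + (0 +i* beta))).
have bb : beta + beta = pi / 2 by rewrite /beta; lra.
have GB : forall u v, `|v| <= beta -> cabs (G (u +i* v)) <= B.
  apply: (@strip_phragmen_lindelof G (4 / 3) beta B).
  - exact: entire_expshift.
  - by lra.
  - exact: beta0.
  - by rewrite /beta; lra.
  - move=> u; rewrite /G cexp_shiftE bb cos_pihalf sin_pihalf.
    have -> : (expR u)%:C * (0 +i* 1) = 0 +i* expR u :> C by simpc.
    by rewrite FiB// expR_ge0.
  - move=> u; rewrite /G cexp_shiftE addNr cos0 sin0 -realCM mulr1.
    by rewrite FB// expR_ge0.
  move=> e e0; pose L := `|ln (K / B)|; exists (3 * ((tau + L) / e)) => u v Uu vb.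
  rewrite /G; apply: (le_trans (FK _)); rewrite cabs_cexp_shift.
  have -> : K = B * expR (ln (K / B)).
    by rewrite lnK ?posrE ?divr_gt0// mulrC divfK// lt0r_neq0.
  rewrite -mulrA -expRD ler_wpM2l ?(ltW B0)// ler_expR.
  (* With this unit |z| is at most s^3 while the damping exponential is s^4, so one spare factor s
     absorbs every constant. *)
  pose s := expR (`|u| / 3).
  have s1 : 1 + `|u| / 3 <= s by exact: expR_ge1Dx.
  have s3 : expR `|u| = s ^+ 3 by rewrite -expRM_natl; congr expR; lra.
  have s4 : expR (4 / 3 * `|u|) = s ^+ 4 by rewrite -expRM_natl; congr expR; lra.
  rewrite s4; have H1 : expR u <= s ^+ 3 by rewrite -s3 ler_expR ler_norm.
  have H2 : ln (K / B) <= L := ler_norm _.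
  have L0 : 0 <= L := normr_ge0 _.
  have u0 : 0 <= `|u| := normr_ge0 u.
  have s1' : 1 <= s by apply: le_trans s1; lra.
  have H3 : (tau + L) <= e * s.
    rewrite mulrC -ler_pdivrMr//; apply: le_trans s1; lra.
  have s30 : 1 <= s ^+ 3 by rewrite exprn_ege1.
  have -> : e * s ^+ 4 = e * s * s ^+ 3 by rewrite [s ^+ 4]exprS mulrA.
  have : (tau + L) * s ^+ 3 <= e * s * s ^+ 3 by rewrite ler_wpM2r// exprn_ge0// (le_trans ler01).
  have : tau * expR u <= tau * s ^+ 3 by rewrite ler_wpM2l.
  have : L * 1 <= L * s ^+ 3 by rewrite ler_wpM2l.
  move: (s ^+ 3) (e * s) => A D; lra.
have [z0|z0] := eqVneq (x +i* y) (0 : C).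
  by rewrite z0; exact: (FB 0 (lexx 0)).
have n0 : 0 < cabs (x +i* y : C) by rewrite cabs_gt0.
have [phi /andP[phi0 phipi] zE] := polar_upper (y0 : 0 <= complex.Im (x +i* y)).
have phi2 : phi <= pi / 2.
  rewrite leNgt; apply/negP => phi2.
  have : cos phi < cos (pi / 2).
    rewrite ltr_cos ?in_itv/= ?phi0 ?phipi//; lra.
  rewrite cos_pihalf => c0.
  have xE : x = cabs (x +i* y : C) * cos phi by move/(congr1 (@complex.Re R)): zE; rewrite ReMr.
  by move: x0; rewrite xE pmulr_rge0// leNgt c0.
rewrite (cexp_polar beta n0 zE); apply: GB.
by rewrite ler_norml; move: bb; lra.
Qed.

(** A function already known to be bounded tolerates any p > 0, so the angle pi is allowed, with p =
    1/2; the gain is that the bound on the line replaces [K]. *)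
Theorem halfplane_phragmen_lindelof F (A K : R) : entire F -> 0 < A -> 0 < K ->
  (forall z, 0 <= complex.Im z -> cabs (F z) <= K) ->
  (forall x, cabs (F x%:C) <= A) ->
  forall z, 0 <= complex.Im z -> cabs (F z) <= A.
Proof.
move=> eF A0 K0 FK FA z Imz.
have p0 := pi_gt0 R.
pose beta : R := pi / 2; have beta0 : 0 < beta by rewrite divr_gt0.
pose G w := F (cexp (w + (0 +i* beta))).
have bb : beta + beta = pi by rewrite /beta; lra.
have GA : forall u v, `|v| <= beta -> cabs (G (u +i* v)) <= A.
  apply: (@strip_phragmen_lindelof G (1 / 2) beta A).
  - exact: entire_expshift.
  - by lra.
  - exact: beta0.
  - by rewrite /beta; lra.
  - by move=> u; rewrite /G cexp_shiftE bb cospi sinpi -realCM.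
  - by move=> u; rewrite /G cexp_shiftE addNr cos0 sin0 -realCM.
  move=> e e0; pose L := `|ln (K / A)|; exists (2 * (L / e)) => u v Uu.
  rewrite ler_norml => /andP[vb1 vb2].
  rewrite /G; apply: (@le_trans _ _ K).
    apply: FK; rewrite cexp_shiftE ImMr /= mulr_ge0 ?expR_ge0//.
    by apply: sin_ge0_pi; move: bb; lra.
  have -> : K = A * expR (ln (K / A)).
    by rewrite lnK ?posrE ?divr_gt0// mulrC divfK// lt0r_neq0.
  rewrite ler_wpM2l ?(ltW A0)// ler_expR; apply: (le_trans (ler_norm _)); rewrite -/L.
  have := @expR_ge1Dx R (1 / 2 * `|u|) => s1.
  rewrite mulrC -ler_pdivrMr//; apply: le_trans s1; lra.
have [->|z0] := eqVneq z 0; first exact: (FA 0).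
have n0 : 0 < cabs z by rewrite cabs_gt0.
have [phi /andP[phi0 phipi] zE] := polar_upper Imz.
rewrite (cexp_polar beta n0 zE); apply: GA.
by rewrite ler_norml; move: bb; lra.
Qed.

Definition exp_bounded (s : R) F := forall t, s < t ->
  exists2 K, 0 < K & forall z, cabs (F z) <= K * expR (t * cabs z).

(** For t > s the factor exp(i t z) makes [F] bounded on the positive imaginary axis and keeps its
    modulus on the real line. The two quadrants give some bound, the half plane improves it to [A],
    and t tends to s. *)
Lemma growth_upper F (A s : R) : entire F -> 0 < A -> 0 <= s -> exp_bounded s F ->
  (forall x, cabs (F x%:C) <= A) ->
  forall x y, 0 <= y -> cabs (F (x +i* y)) <= A * expR (s * y).
Proof.
move=> eF A0 s0 FE FA x y y0.
apply: (@le_expR_limit _ _ y (cabs_ge0 _)) => h h0; rewrite -mulrA -expRD.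
have -> : s * y + h * y = (s + h) * y by ring.
set t := s + h; have st : s < t by rewrite /t; lra.
have t0 : 0 <= t by rewrite /t; lra.
have [K K0 FK] := FE t st.
pose f z := F z * cexp (t%:C * 'i * z).
have ef : entire f.
  exact (entireM eF (entire_comp (@entire_cexp R)
    (entireM (@entire_cst R (t%:C * 'i)) (@entire_id R)))).
have fE x' y' : cabs (f (x' +i* y')) = cabs (F (x' +i* y')) * expR (- (t * y')).
  by rewrite /f cabsM cabs_cexp; congr (_ * expR _) => /=; ring.
pose B := Num.max A K.
have B0 : 0 < B by rewrite lt_max A0.
have fA x' : cabs (f x'%:C) <= A.
  by rewrite (fE x' 0) mulr0 oppr0 expR0 mulr1; exact: FA.
have fK y' : 0 <= y' -> cabs (f (0 +i* y')) <= K.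
  move=> y'0; rewrite fE expRN ler_pdivrMr ?expR_gt0//.
  have := FK (0 +i* y'); rewrite {2}/cabs /= expr0n add0r sqrtr_sqr ger0_norm//.
have AB : A <= B by rewrite le_max lexx.
have KB : K <= B by rewrite le_max lexx orbT.
have fG z : cabs (f z) <= K * expR ((t + t) * cabs z).
  rewrite /f cabsM cabs_cexp mulrDl expRD mulrA.
  apply: ler_pM; rewrite ?cabs_ge0 ?expR_ge0 ?FK// ler_expR.
  apply: (le_trans (ler_norm _)); apply: (le_trans (Re_le_cabs _)).
  by rewrite !cabsM cabs_i mulr1 cabs_real ger0_norm.
have tt0 : 0 <= t + t by rewrite addr_ge0.
have Q1 x' y' : 0 <= x' -> 0 <= y' -> cabs (f (x' +i* y')) <= B.
  apply: (@quadrant_phragmen_lindelof f B K (t + t)) => // [x'' _|y'' y''0].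
    exact: le_trans (fA _) AB.
  exact: le_trans (fK _ y''0) KB.
(* A quarter turn brings the second quadrant to the first. *)
have eg : entire (fun z => f ('i * z)).
  exact (entire_comp ef (entireM (@entire_cst R 'i) (@entire_id R))).
have iE x' y' : 'i * (x' +i* y') = (- y') +i* x' :> C by simpc.
have Q2 x' y' : 0 <= x' -> 0 <= y' -> cabs (f ((- y') +i* x')) <= B.
  rewrite -iE; apply: (@quadrant_phragmen_lindelof _ B K (t + t) eg) => //.
  - by move=> z; apply: (le_trans (fG _)); rewrite cabsM cabs_i mul1r.
  - move=> x'' x''0; rewrite iE oppr0; exact: le_trans (fK _ x''0) KB.
  - move=> y'' y''0; rewrite iE; exact: le_trans (fA _) AB.
have UB z : 0 <= complex.Im z -> cabs (f z) <= B.
  case: z => x' y' /= y'0; have [x'0|x'0] := leP 0 x'; first exact: Q1.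
  by have := Q2 y' (- x') y'0; rewrite opprK; apply; rewrite oppr_ge0 ltW.
have := halfplane_phragmen_lindelof ef A0 B0 UB fA.
move=> /(_ (x +i* y) y0); rewrite fE expRN ler_pdivrMr ?expR_gt0//.
Qed.

Theorem growth F (A s : R) : entire F -> 0 < A -> 0 <= s -> exp_bounded s F ->
  (forall x, cabs (F x%:C) <= A) ->
  forall z, cabs (F z) <= A * expR (s * `|complex.Im z|).
Proof.
move=> eF A0 s0 FE FA [x y] /=; case: (ger0P y) => [y0|/ltW y0].
  exact: growth_upper.
pose G z := F (- z).
have eG : entire G by exact (entire_comp eF (entireN (@entire_id R))).
have GE : exp_bounded s G.
  by move=> t /FE[K K0 FK]; exists K => // z; rewrite -(cabsN z); exact: FK.
have GA x' : cabs (G x'%:C) <= A by rewrite /G -realCN; exact: FA.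
have y0' : 0 <= - y by rewrite oppr_ge0.
have := growth_upper eG A0 s0 GE GA (- x) y0'.
have NE : - ((- x) +i* (- y)) = x +i* y :> C by simpc.
by rewrite /G NE.
Qed.

End Growth.

(** * Exponential type as a limsup and as a family of bounds *)

Section ExponentialType.
Variable R : realType.
Local Notation C := R[i].
Implicit Types (F : C -> C).

(** The limsup gives the estimate outside some disc; the maximum of [F] on that disc goes into the
    constant. *)
Lemma exp_type_exp_bounded F (s : R) : entire F -> 0 <= s ->
  (exp_type F <= s%:E)%E -> exp_bounded s F.
Proof.
move=> eF s0 Fs t st.
have /ereal_inf_lt[_ [V [r _ rV] <-] Vt] : (exp_type F < t%:E)%E.
  by apply: (le_lt_trans Fs); rewrite lte_fin.
have t0 : 0 <= t by rewrite (le_trans s0)// ltW.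
have [B B0 HB] := entire_bounded `|r| eF.
exists (B + 1) => [|z]; first by rewrite ltr_wpDl.
have E1 : 1 <= expR (t * cabs z) by rewrite -expR0 ler_expR mulr_ge0 ?cabs_ge0.
have [zr|rz] := leP (cabs z) `|r|.
  by have := HB z zr; nra.
have z0 : 0 < cabs z by apply: le_lt_trans rz.
(* A zero is set apart because [lne] takes the value -oo there. *)
have [->|Fz] := eqVneq (F z) 0.
  by rewrite cabs0 mulr_ge0 ?expR_ge0// addr_ge0.
have F0 : 0 < cabs (F z) by rewrite cabs_gt0.
have : (((cabs z)^-1%:E * lne (cabs (F z))%:E) < t%:E)%E.
  apply: le_lt_trans Vt; apply: ereal_sup_ubound; exists z => //.
  by apply: rV; rewrite /= (le_lt_trans (ler_norm _)).
rewrite lne_EFin// -EFinM lte_fin mulrC ltr_pdivrMr// => lnF.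
rewrite -[cabs (F z)]lnK ?posrE//; apply: (@le_trans _ _ (expR (t * cabs z))).
  by rewrite ler_expR ltW.
by rewrite ler_peMl ?expR_ge0// lerDr.
Qed.

Lemma exp_bounded_exp_type F (s : R) : exp_bounded s F -> (exp_type F <= s%:E)%E.
Proof.
move=> Fs; apply/lee_addgt0Pr => e e0.
pose t := s + e / 2; have st : s < t by rewrite ltrDl divr_gt0.
have [K K0 FK] := Fs t st.
(* Beyond this radius ln K is at most (e / 2) |z|. *)
pose r := `|ln K| / (e / 2).
have r0 : 0 <= r by rewrite divr_ge0// divr_ge0// ltW.
apply: (@le_trans _ _ (ereal_sup ((fun z : C^o => ((cabs z)^-1%:E * lne (cabs (F z))%:E)%E) @`
    [set z | r < cabs z]))).
  by apply: ereal_inf_lbound; exists [set z | r < cabs z] => //; exists r.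
apply: ge_ereal_sup => _ [z rz <-].
have z0 : 0 < cabs z by apply: le_lt_trans rz.
have [->|Fz] := eqVneq (F z) 0.
  rewrite cabs0 le0_lneNy// mulrNy gtr0_sg ?invr_gt0// mul1e.
  exact: leNye.
have F0 : 0 < cabs (F z) by rewrite cabs_gt0.
rewrite lne_EFin// -EFinM -EFinD lee_fin mulrC ler_pdivrMr//.
have : ln (cabs (F z)) <= ln K + t * cabs z.
  by rewrite -ler_expR expRD !lnK ?posrE.
have : ln K <= e / 2 * cabs z.
  apply: (le_trans (ler_norm _)); rewrite mulrC -ler_pdivrMr ?divr_gt0//; exact: ltW.
rewrite /t; lra.
Qed.

End ExponentialType.

(** * Monotone majorants of the signum *)

Section SgnGap.
Variable R : realType.
Local Notation C := R[i].
Local Notation mu := (@lebesgue_measure R).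
Implicit Types (F : C -> C) (f : R -> R).

Lemma integral_itv_intR f (a b : R) : continuous f -> a <= b ->
  (\int[mu]_(x in `[a, b]) (f x)%:E)%E = (intR f a b)%:E.
Proof.
move=> cf ab; rewrite /intR ab /Rintegral fineK//.
by apply: integrable_fin_num => //; exact: continuous_itv_integrable.
Qed.

Lemma measurable_continuous f (D : set R) : continuous f -> measurable_fun D f.
Proof. by move=> cf; apply: measurable_funTS; exact: continuous_measurable_fun. Qed.

Lemma integral_Ny_cvg f (L : R) : continuous f -> (forall x, x <= 0 -> 0 <= f x) ->
  (forall e, 0 < e -> exists N, forall n, (N <= n)%N -> `|intR f (- n%:R) 0 - L| <= e) ->
  (\int[mu]_(x in `]-oo, 0%R]) (f x)%:E)%E = L%:E.
Proof.
move=> cf f0 fL.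
pose V (n : nat) : set R := `[- n%:R, 0]%classic.
have UV : \bigcup_i V i = `]-oo, 0%R]%classic.
  apply/seteqP; split=> [x [n _]|x]; rewrite /V /= !in_itv/=; first by case/andP.
  move=> x0; exists (Num.trunc `|x|).+1 => //=; rewrite in_itv/= x0 andbT.
  by rewrite lerNl -normrN (le_trans (ler_norm _))// normrN ltW// truncnS_gt.
have nd : nondecreasing_seq V.
  move=> m n mn; rewrite subsetEset => x; rewrite /V /= !in_itv/= => /andP[h ->].
  by rewrite andbT (le_trans _ h)// lerN2 ler_nat.
have H : (\int[mu]_(x in V n) (f x)%:E @[n --> \oo] --> \int[mu]_(x in \bigcup_i V i) (f x)%:E)%E.
  apply: ge0_nondecreasing_set_cvg_integral => //.
  - by move=> n; exact: measurable_itv.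
  - by move=> n; apply/measurable_EFinP; exact: measurable_continuous.
  - by move=> n x; rewrite /V /= in_itv/= lee_fin => /andP[_ /f0].
rewrite UV in H; apply/esym; apply: cvg_unique H => //.
rewrite (_ : (fun n => _) = (fun n => (intR f (- n%:R) 0)%:E)); last first.
  by apply/funext => n; rewrite integral_itv_intR// oppr_le0.
apply: cvg_EFin; first by near=> n.
apply/cvgrPdist_le => e e0; have [N HN] := fL e e0.
by near=> n; rewrite distrC; apply: HN; near: n; exact: nbhs_infty_ge.
Unshelve. all: by end_near. Qed.

(** The gap over [-X, X], with the signum replaced by a constant on each side so that both
    integrands are continuous. *)
Definition gap_trunc f (X : R) : R :=
  intR (fun x => f x + 1) (- X) 0 + intR (fun x => f x - 1) 0 X.

Lemma measurable_sgn_gap f (D : set R) : continuous f -> measurable D ->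
  measurable_fun D (fun x => f x - Num.sg x).
Proof.
move=> cf mD; apply: measurable_funB; first exact: measurable_continuous.
apply: nondecreasing_measurable => // x y xy.
have sgE (t : R) : Num.sg t = if t < 0 then -1 else if 0 < t then 1 else 0.
  by case: (ltgtP t 0) => [/ltr0_sg|/gtr0_sg|->]; rewrite ?sgr0.
rewrite !sgE; case: (ltP x 0) => x0; case: (ltP y 0) => y0 //; case: (ltP 0 x) => x1 //;
  case: (ltP 0 y) => y1 //; lra.
Qed.

Lemma integral_gap_trunc f (X : R) : continuous f -> (forall x, Num.sg x <= f x) -> 0 < X ->
  (\int[mu]_(x in `[(- X)%R, X]) (f x - Num.sg x)%:E)%E = (gap_trunc f X)%:E.
Proof.
move=> cf f0 X0; have X1 : - X <= 0 by lra.
have X2 : - X <= X by lra.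
have c1 : continuous (fun x => f x + 1) := cntD cf (@cnst R 1).
have c2 : continuous (fun x => f x - 1) := cntB cf (@cnst R 1).
have US : `[(- X), X]%classic = `[(- X), 0%R[%classic `|` `[0%R, X]%classic :> set R.
  apply/seteqP; split=> x /=; rewrite !in_itv/=; last by case=> /andP[]; lra.
  by have [x0|x0] := ltP x 0 => /andP[-> ->]; [left|right].
rewrite US ge0_integral_setU//=.
- rewrite /gap_trunc EFinD; congr (_ + _)%E.
    rewrite -integral_itv_intR// -integral_itv_bndo_bndc//; last by apply/measurable_EFinP; exact: measurable_continuous.
    apply: eq_integral => x; rewrite inE/= in_itv/= => /andP[_ x0].
    by rewrite ltr0_sg// opprK.
  rewrite -integral_itv_intR ?(ltW X0)// -!integral_itv_obnd_cbnd//.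
  + apply: eq_integral => x; rewrite inE/= in_itv/= => /andP[x0 _].
    by rewrite gtr0_sg.
  + by apply/measurable_EFinP; exact: measurable_sgn_gap.
  + by apply/measurable_EFinP; exact: measurable_continuous.
- by apply/measurable_EFinP; apply: measurable_sgn_gap => //; exact: measurableU.
- by move=> x _; rewrite lee_fin subr_ge0.
- apply/disj_setPS => x []; rewrite /= !in_itv/=; lra.
Qed.

Lemma sgn_gap_ge F (X : R) : continuous (on_reals F) ->
  (forall x, Num.sg x <= on_reals F x) -> 0 < X ->
  ((gap_trunc (on_reals F) X)%:E <= sgn_gap F)%E.
Proof.
move=> cf f0 X0; rewrite -integral_gap_trunc//.
apply: ge0_subset_integral => //; first by apply/measurable_EFinP; exact: measurable_sgn_gap.
by move=> x _; rewrite lee_fin subr_ge0.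
Qed.

Lemma sgn_gap_le F (L : R) : continuous (on_reals F) ->
  (forall x, Num.sg x <= on_reals F x) ->
  (forall n, gap_trunc (on_reals F) n.+1%:R <= L) -> (sgn_gap F <= L%:E)%E.
Proof.
move=> cf f0 fL; set f := on_reals F in cf f0 fL *.
pose V (n : nat) : set R := `[- n.+1%:R, n.+1%:R]%classic.
have UV : \bigcup_i V i = setT.
  apply/seteqP; split=> // x _; exists (Num.trunc `|x|) => //.
  by rewrite /V /= in_itv/= -ler_norml ltW// truncnS_gt.
have nd : nondecreasing_seq V.
  move=> m n mn; rewrite subsetEset => x; rewrite /V /= !in_itv/= -!ler_norml => h.
  by rewrite (le_trans h)// ler_nat.
have H : (\int[mu]_(x in V n) (f x - Num.sg x)%:E @[n --> \oo] -->
    \int[mu]_(x in \bigcup_i V i) (f x - Num.sg x)%:E)%E.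
  apply: ge0_nondecreasing_set_cvg_integral => //.
  - by move=> n; exact: measurable_itv.
  - move=> n; apply/measurable_EFinP; apply: measurable_sgn_gap => //; exact: measurable_itv.
  - by move=> n x _; rewrite lee_fin subr_ge0.
rewrite UV in H; rewrite /sgn_gap -/f -(cvg_lim _ H)//.
apply: lime_le; first by apply/cvg_ex; eexists; exact: H.
by near=> n; rewrite integral_gap_trunc// lee_fin.
Unshelve. all: by end_near. Qed.

End SgnGap.

(** * Sign of the derivative and growth of monotone majorants *)

Section MonotoneMajorant.
Variable R : realType.
Local Notation C := R[i].
Implicit Types (F : C -> C) (x y : R).

Definition dreal F x : R := complex.Re (cderiv F x%:C).

Lemma on_reals_rder F x : entire F -> rder (on_reals F) x (dreal F x).
Proof. by move=> eF; have [] := cder_real (cderivP x%:C eF). Qed.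

Lemma on_reals_continuous F : entire F -> continuous (on_reals F).
Proof. by move=> eF x; exact: rder_continuous (on_reals_rder x eF). Qed.

Lemma dreal_continuous F : entire F -> continuous (dreal F).
Proof. by move=> /entire_cderiv/entire_ccont_real[]. Qed.

Lemma real_entire_E F x : real_entire F -> F x%:C = (on_reals F x)%:C.
Proof. by move=> [_ H]; apply: complex_ext; rewrite //= H. Qed.

Lemma real_entire_cderiv F : real_entire F -> real_entire (cderiv F).
Proof.
move=> [eF FR]; split=> [|x]; first exact: entire_cderiv.
have [_ H] := cder_real (cderivP x%:C eF).
rewrite (_ : _ \o _ = fun=> 0) in H; last by apply/funext => y; rewrite /= FR.
exact: rder_unique H (rder_cst _ _).
Qed.

Lemma cderiv_realE F x : real_entire F -> cderiv F x%:C = (dreal F x)%:C.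
Proof. by move=> rF; rewrite (real_entire_E _ (real_entire_cderiv rF)). Qed.

(** One-sided increments suffice to determine the sign of the derivative. *)
Lemma rder_ge0_right (f : R -> R) x d (r : R) : 0 < r -> rder f x d ->
  (forall h, 0 < h < r -> f x <= f (x + h)) -> 0 <= d.
Proof.
move=> r0 fd H; rewrite leNgt; apply/negP => d0.
have e0 : 0 < - d / 2 by rewrite divr_gt0 ?oppr_gt0.
have [del del0 K] := rderP fd e0.
pose h := Num.min (del / 2) (r / 2).
have h0 : 0 < h by rewrite lt_min !divr_gt0.
have hd : h < del by rewrite gt_min; apply/orP; left; lra.
have hr : h < r by rewrite gt_min; apply/orP; right; lra.
have := H h; rewrite h0 hr => /(_ isT).
have := K h; rewrite gtr0_norm// => /(_ hd); rewrite ler_norml => /andP[_].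
have : d * h < 0 by rewrite nmulr_rlt0.
have -> : - d / 2 * h = - (d * h) / 2 by field.
move: (d * h) => u; lra.
Qed.

Lemma majorant_dreal_ge0 F x : monotone_majorant F -> x < 0 -> 0 <= dreal F x.
Proof.
move=> [[eF _] _ _ nd _] x0.
apply: (@rder_ge0_right _ x _ (- x)) (on_reals_rder x eF) _; first lra.
by move=> h h0; apply: nd; rewrite ?in_itv/=; lra.
Qed.

Lemma majorant_dreal_le0 F x : monotone_majorant F -> 0 < x -> dreal F x <= 0.
Proof.
move=> [[eF _] _ _ _ ni] x0; rewrite -oppr_ge0.
apply: (@rder_ge0_right _ x _ 1) (rderN (on_reals_rder x eF)) _ => // h h0.
by rewrite lerN2; apply: ni; rewrite ?in_itv/= ?andbT; lra.
Qed.

(** F' is nonnegative on the left of 0, nonpositive on the right, and continuous. *)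
Lemma majorant_dreal0 F : monotone_majorant F -> dreal F 0 = 0.
Proof.
move=> mF; have [[eF _] _ _ _ _] := mF.
have c0 := (continuousP_eps _ _).1 (@dreal_continuous F eF 0).
apply/eqP; rewrite eq_le; apply/andP; split; rewrite leNgt; apply/negP => d0.
  have [del del0 K] := c0 _ d0; have := K (del / 2).
  rewrite subr0 gtr0_norm ?divr_gt0// => /(_ (ltac:(clear -del0; lra))).
  have := @majorant_dreal_le0 F (del / 2) mF; rewrite divr_gt0// => /(_ isT).
  rewrite ltr_norml; move: d0; move: (dreal F (del / 2)) (dreal F 0) => u v; clear; lra.
have nd0 : 0 < - dreal F 0 by rewrite oppr_gt0.
have [del del0 K] := c0 _ nd0; have := K (- (del / 2)).
rewrite subr0 normrN gtr0_norm ?divr_gt0// => /(_ (ltac:(clear -del0; lra))).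
have := @majorant_dreal_ge0 F (- (del / 2)) mF; rewrite oppr_lt0 divr_gt0// => /(_ isT).
rewrite ltr_norml; move: d0; move: (dreal F (- (del / 2))) (dreal F 0) => u v; clear; lra.
Qed.

(** Outside [-1, 1] monotonicity bounds [F] above by its values at 1 and -1, and the signum bounds
    it below by -1. *)
Lemma majorant_bounded F : monotone_majorant F ->
  exists2 A, 0 < A & forall x, cabs (F x%:C) <= A.
Proof.
move=> [rF _ Fsg nd ni]; have [eF _] := rF.
have [B B0 HB] := entire_bounded 1 eF.
have HR x : `|x| <= 1 -> `|on_reals F x| <= B.
  move=> x1; rewrite -cabs_real -real_entire_E//; apply: HB.
  by rewrite cabs_real.
have b1 := HR 1; have bN1 := HR (-1).
have {}b1 : `|on_reals F 1| <= B by apply: b1; rewrite normr1.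
have {}bN1 : `|on_reals F (-1)| <= B by apply: bN1; rewrite normrN1.
exists (B + 1) => [|x]; first lra.
rewrite real_entire_E// cabs_real.
have [x1|] := leP `|x| 1; first by have := HR x x1; lra.
have := Fsg x => sx.
have sg1 : -1 <= Num.sg x.
  by case: (ltgtP x 0) => [/ltr0_sg|/gtr0_sg|->] => [->|->|]; rewrite ?sgr0; lra.
rewrite lter_normr => /orP[x1|x1].
  have : on_reals F x <= on_reals F 1 by apply: ni; rewrite ?in_itv/= ?andbT; lra.
  by move: b1; rewrite !ler_norml; lra.
have : on_reals F x <= on_reals F (-1) by apply: nd; rewrite ?in_itv/=; lra.
by move: bN1; rewrite !ler_norml; lra.
Qed.

Lemma majorant_growth F : monotone_majorant F -> exists2 A, 0 < A &
  forall z, cabs (F z) <= A * expR (2 * pi * `|complex.Im z|).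
Proof.
move=> mF; have [A A0 HA] := majorant_bounded mF; exists A => //.
have [[eF _] tF _ _ _] := mF.
have p0 : 0 <= 2 * pi :> R by rewrite mulr_ge0// pi_ge0.
exact: growth eF A0 p0 (exp_type_exp_bounded eF p0 tF) HA.
Qed.

(** Cauchy's estimate on unit discs, where the imaginary part varies by at most 1, costs a factor
    exp(2 pi). *)
Lemma majorant_cderiv_growth F : monotone_majorant F -> exists2 A, 0 < A &
  forall z, cabs (cderiv F z) <= A * expR (2 * pi * `|complex.Im z|).
Proof.
move=> mF; have [A A0 HA] := majorant_growth mF; have [[eF _] _ _ _ _] := mF.
have p0 : 0 <= 2 * pi :> R by rewrite mulr_ge0// pi_ge0.
exists (A * expR (2 * pi)) => [|z]; first by rewrite mulr_gt0// expR_gt0.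
apply: cderiv_bound => // w wz; apply: (le_trans (HA w)).
rewrite -[A * expR (2 * pi) * _]mulrA -expRD ler_wpM2l ?(ltW A0)// ler_expR.
rewrite -[X in X + _]mulr1 -mulrDr ler_wpM2l//.
have := le_trans (Im_le_cabs (w - z)) wz; rewrite ImD ImN => h.
have -> : complex.Im w = (complex.Im w - complex.Im z) + complex.Im z by ring.
by apply: (le_trans (ler_normD _ _)); rewrite lerD2r.
Qed.

End MonotoneMajorant.

(** * Quadrature and the inequality *)

Section Sinc.
Variable R : realType.
Local Notation C := R[i].
Implicit Types (x y : R) (z w : C).

Lemma i_neq0 : 'i%C != 0 :> C.
Proof. by rewrite -cabs_gt0 cabs_i. Qed.

Lemma entire_csin : entire (@csin R).
Proof.
have e1 := entireM (@entire_cst R 'i%C) (@entire_id R).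
exact (entireM (entireB (entire_comp (@entire_cexp R) e1)
  (entire_comp (@entire_cexp R) (entireN e1))) (@entire_cst R (2 * 'i%C)^-1)).
Qed.

Definition ccos z : C := (cexp ('i%C * z) + cexp (- ('i%C * z))) / 2.

Lemma cder_csin z : cder (@csin R) z (ccos z).
Proof.
have d1 : cder (fun w => 'i%C * w) z 'i%C.
  by apply: cder_eq (cderM (cder_cst 'i%C z) (cder_id z)) _; rewrite mulr0 addr0 mulr1.
have d2 := cder_comp d1 (cder_cexp _).
have d3 := cder_comp (cderN d1) (cder_cexp _).
apply: cder_eq (cderM (cderB d2 d3) (cder_cst (2 * 'i%C)^-1 z)) _.
rewrite /ccos mulr0 add0r; field; exact: i_neq0.
Qed.

Lemma csin_real x : csin x%:C = (sin x)%:C :> C.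
Proof.
rewrite /csin (_ : 'i%C * x%:C = 0 +i* x); last by simpc.
rewrite (_ : - (0 +i* x) = 0 +i* (- x)); last by simpc.
have n2 : 2 * 'i%C != 0 :> C by rewrite mulf_neq0 ?pnatr_eq0 ?i_neq0.
rewrite !cexp_imag cosN sinN; apply: (mulIf n2); rewrite divfK//.
by rewrite -(realC_nat R 2); simpc; apply: complex_ext => /=; ring.
Qed.

Lemma csin0 : csin 0 = 0 :> C.
Proof. by rewrite (csin_real 0) sin0. Qed.

Lemma ccos0 : ccos 0 = 1 :> C.
Proof. by rewrite /ccos mulr0 oppr0 cexp0 -mulr2n divff// pnatr_eq0. Qed.

Lemma cabs_csin_le z : cabs (csin z) <= expR `|complex.Im z|.
Proof.
rewrite /csin cabsM cabsV cabsM cabs_i cabs_nat mulr1 ler_pdivrMr//.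
apply: (le_trans (cabsB _ _)); rewrite !cabs_cexp mulrDr mulr1.
have -> : complex.Re ('i%C * z) = - complex.Im z by case: z => a b /=; ring.
have -> : complex.Re (- ('i%C * z)) = complex.Im z by case: z => a b /=; ring.
by apply: lerD; rewrite ler_expR ?ler_norm// -normrN ler_norm.
Qed.

Definition csinpi z : C := csin (pi%:C * z).

Lemma entire_csinpi : entire csinpi.
Proof. exact (entire_comp entire_csin (entireM (@entire_cst R pi%:C) (@entire_id R))). Qed.

Lemma cder_csinpi z : cder csinpi z (pi%:C * ccos (pi%:C * z)).
Proof.
have d1 : cder (fun w => pi%:C * w) z pi%:C.
  by apply: cder_eq (cderM (cder_cst pi%:C z) (cder_id z)) _; rewrite mulr0 addr0 mulr1.
by apply: cder_eq (cder_comp d1 (cder_csin _)) _; rewrite mulrC.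
Qed.

Lemma piC_neq0 : pi%:C != 0 :> C.
Proof. by rewrite realC_eq0 lt0r_neq0// pi_gt0. Qed.

(** (sin(pi z) / (pi z))^2, with its removable singularity filled in by the divided difference. *)
Definition sinc2 z : C := (divdiff csinpi 0 z / pi%:C) ^+ 2.

Lemma entire_sinc2 : entire sinc2.
Proof.
exact (@entireX R _ 2 (entireM (@entire_divdiff R csinpi 0 entire_csinpi) (@entire_cst R pi%:C^-1))).
Qed.

Lemma sinc2E z : csinpi z ^+ 2 = pi%:C ^+ 2 * z ^+ 2 * sinc2 z.
Proof.
rewrite (divdiffE csinpi 0 z) {1}/csinpi mulr0 csin0 add0r subr0 /sinc2.
by move: piC_neq0; move: (pi%:C : C) => p p0; field.
Qed.

Lemma sinc2_0 : sinc2 0 = 1.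
Proof.
rewrite /sinc2 /divdiff eqxx (cderivE (cder_csinpi 0)) mulr0 ccos0 mulr1.
by rewrite divff ?expr1n// piC_neq0.
Qed.

Lemma sinc2_neq0E z : z != 0 -> sinc2 z = csinpi z ^+ 2 / (pi%:C ^+ 2 * z ^+ 2).
Proof.
by move=> z0; rewrite sinc2E mulrC mulKf// mulf_neq0 ?expf_neq0// piC_neq0.
Qed.

Lemma sinc2_real x : x != 0 -> sinc2 x%:C = (sin (pi * x) ^+ 2 / (pi ^+ 2 * x ^+ 2))%:C.
Proof.
move=> x0; rewrite sinc2_neq0E ?realC_eq0// /csinpi -realCM csin_real.
by rewrite -!realCX -realCM -realCV -realCM.
Qed.

Lemma Im_sinc2 x : complex.Im (sinc2 x%:C) = 0.
Proof. by have [->|x0] := eqVneq x 0; [rewrite sinc2_0|rewrite sinc2_real]. Qed.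

Lemma sin_le_abs x : `|sin x| <= `|x|.
Proof.
wlog x0 : x / 0 < x => [W|].
  have [x0|x0|->] := ltgtP x 0; last by rewrite sin0.
    by have := W (- x); rewrite sinN !normrN oppr_gt0 => /(_ x0).
  exact: W.
have [c _] := @MVT R sin cos 0 x x0 (fun y _ => is_derive_sin y)
  (continuous_subspaceT (@continuous_sin R)).
by rewrite sin0 !subr0 => ->; rewrite normrM ler_piMl// cos_max.
Qed.

Lemma Re_sinc2_itv x : 0 <= complex.Re (sinc2 x%:C) <= 1.
Proof.
have [->|x0] := eqVneq x 0; first by rewrite sinc2_0 /= ler01 lexx.
have px : 0 < pi ^+ 2 * x ^+ 2 by rewrite mulr_gt0 ?(exprn_gt0 _ (pi_gt0 R))// exprn_even_gt0.
rewrite sinc2_real//= divr_ge0 ?sqr_ge0 ?(ltW px)//= ler_pdivrMr// mul1r -exprMn.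
rewrite -(real_normK (num_real (sin _))) -(real_normK (num_real (pi * x))).
by rewrite ler_pXn2r ?nnegrE// sin_le_abs.
Qed.

(** Of the quadratic decay, one power will pay for the linear weight and the other for the decay
    required by the Fourier estimate. *)
Lemma sinc2_bound : exists2 K, 0 < K &
  forall z, cabs (sinc2 z) * (1 + cabs z ^+ 2) <= K * expR (2 * pi * `|complex.Im z|).
Proof.
have [B B0 HB] := entire_bounded 1 entire_sinc2.
exists (2 * B + 2) => [|z]; first by rewrite ltr_wpDl// mulr_ge0.
have p2 := pi_ge2 R.
have E1 : 1 <= expR (2 * pi * `|complex.Im z|).
  by rewrite -expR0 ler_expR !mulr_ge0// pi_ge0.
have [z1|z1] := leP (cabs z) 1.
  have : cabs z ^+ 2 <= 1 by rewrite exprn_ile1 ?cabs_ge0.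
  have := HB z z1; have := cabs_ge0 (sinc2 z); have := sqr_ge0 (cabs z).
  move: (cabs z ^+ 2) (cabs (sinc2 z)) (expR _) E1 => q s E E1 q0 s0 sB q1.
  have : s * (1 + q) <= B * 2 by apply: ler_pM => //; lra.
  nra.
have z0 : z != 0 by rewrite -cabs_gt0; lra.
have c1 : 1 <= cabs z ^+ 2 by rewrite exprn_ege1// ltW.
have S : cabs (csinpi z) ^+ 2 <= expR (2 * pi * `|complex.Im z|).
  have -> : 2 * pi * `|complex.Im z| = 2%:R * (pi * `|complex.Im z|) by ring.
  rewrite expRM_natl ler_pXn2r ?nnegrE ?cabs_ge0 ?expR_ge0//.
  have := cabs_csin_le (pi%:C * z); rewrite ImMr normrM (ger0_norm (pi_ge0 R)).
  by [].
rewrite sinc2_neq0E// cabsM cabsV cabsM !cabsX cabs_real (ger0_norm (pi_ge0 R)).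
have pp : 1 <= pi ^+ 2 :> R by rewrite exprn_ege1//; lra.
have D0 : 0 < pi ^+ 2 * cabs z ^+ 2 by rewrite mulr_gt0//; lra.
rewrite mulrAC ler_pdivrMr//.
move: D0 S E1 pp c1 (sqr_ge0 (cabs (csinpi z))).
move: (cabs (csinpi z) ^+ 2) (cabs z ^+ 2) (expR _) (pi ^+ 2 : R) => s q E P D0 S E1 pp c1 s0.
have : s * (1 + q) <= E * (2 * q) by apply: ler_pM => //; lra.
have : E * (2 * q) <= (2 * B + 2) * E * q.
  by rewrite (_ : (2 * B + 2) * E * q = E * (2 * q) + 2 * B * (E * q)); [rewrite lerDl !mulr_ge0//; lra|ring].
have : (2 * B + 2) * E * q * 1 <= (2 * B + 2) * E * q * P.
  by rewrite ler_wpM2l// !mulr_ge0//; lra.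
lra.
Qed.

End Sinc.

(** * Poisson summation in Fejer means *)

Section Poisson.
Variable R : realType.
Local Notation C := R[i].
Implicit Types (x y t : R) (z w : C) (N : nat).

Lemma fejer_period N t x : expi t = 1 -> fejer N (x + t) = fejer N x.
Proof.
move=> t1; rewrite /fejer; congr (_ * cabs _ ^+ 2); apply: eq_bigr => j _.
by rewrite !expiMn expiD t1 mulr1.
Qed.

(** The kernel has period 1, so it concentrates at every integer [t] as it does at 0. *)
Lemma fejer_window (g : R -> R) t (e : R) : continuous g -> expi t = 1 -> 0 < e ->
  exists N0, forall N, (N0 <= N)%N -> (0 < N)%N ->
    `|intR (fun x => g x * fejer N x) (t - 1 / 2) (t + 1 / 2) - g t| <= e.
Proof.
move=> cg t1 e0; have cgt := cnt_comp (@cnt_affine R 1 t) cg.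
have [N0 HN] := fejer_cvg (ccont_real cgt) e0; exists N0 => N h1 h2.
have {HN} := HN N h1 h2; have cK := cntM cg (@fejer_continuous R N).
have E := @intR_affine R (fun x => g x * fejer N x) 1 t (- (1 / 2)) (1 / 2) cK.
have e1 : 1 * - (1 / 2) + t = t - 1 / 2 by lra.
have e2 : 1 * (1 / 2) + t = t + 1 / 2 by lra.
rewrite (mul1r (intR _ _ _)) e1 e2 in E; rewrite -{}E.
have -> : (fun x => g (1 * x + t) * fejer N (1 * x + t)) =
    (fun x => g (1 * x + t) * fejer N x).
  by apply/funext => x; rewrite [X in fejer N X](_ : _ = x + t) ?mul1r// fejer_period.
have -> : cint (fun x => (g (1 * x + t))%:C * (fejer N x)%:C) (- (1 / 2)) (1 / 2) =
    (intR (fun x => g (1 * x + t) * fejer N x) (- (1 / 2)) (1 / 2))%:C.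
  by rewrite -cint_real; congr cint; apply/funext => x; rewrite realCM.
by rewrite -realCB cabs_real mulr0 add0r.
Qed.

Variables (f : C -> C) (K s : R).
Hypotheses (ef : entire f) (K0 : 0 <= K) (s2 : s < 2 * pi)
  (fK : forall z, cabs (f z) * (1 + cabs z) <= K * expR (s * `|complex.Im z|)).

(* The integral is pushed up to height [T], where [f(z) exp(2 pi i k z)] is small. *)
Lemma fourier_decay_pos (g : C -> C) (k X : R) : entire g ->
  (forall z, cabs (g z) * (1 + cabs z) <= K * expR (s * `|complex.Im z|)) ->
  1 <= k -> 0 < X ->
  cabs (cint (fun x => g x%:C * expi (k * x)) (- X) X) <= 2 * (K / (2 * pi - s)) / (1 + X).
Proof.
move=> eg gK k1 X0; set c := 2 * pi - s.
have c0 : 0 < c by rewrite subr_gt0.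
have X10 : 0 < 1 + X by lra.
pose h z := g z * cexp (k%:C * (0 +i* (2 * pi)) * z).
have eh : entire h.
  exact (entireM eg (entire_comp (@entire_cexp R)
    (entireM (@entire_cst R (k%:C * (0 +i* (2 * pi)))) (@entire_id R)))).
have hE x : h (x +i* 0) = g x%:C * expi (k * x).
  rewrite /h /expi; congr (_ * cexp _); rewrite realCM -[x +i* 0]/(x%:C); ring.
have hb x y : 0 <= y -> cabs (h (x +i* y)) * (1 + cabs (x +i* y : C)) <= K * expR (- (c * y)).
  move=> y0; rewrite /h cabsM cabs_cexp mulrAC.
  have -> : complex.Re (k%:C * (0 +i* (2 * pi)) * (x +i* y)) = - (2 * pi * k * y).
    by rewrite /=; ring.
  have := gK (x +i* y); rewrite /= (ger0_norm y0) => H.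
  apply: (le_trans (ler_wpM2r (expR_ge0 _) H)).
  rewrite -[leLHS]mulrA -expRD ler_wpM2l// ler_expR /c.
  have : 2 * pi * y <= 2 * pi * k * y.
    have := pi_gt0 R => p0.
    by rewrite ler_wpM2r// ler_peMr// mulr_ge0// ltW.
  lra.
(* On the vertical sides |z| is at least X, which yields the factor 1 / (1 + X). *)
have side x y : `|x| = X -> 0 <= y -> cabs (h (x +i* y)) <= K / (1 + X) * expR (- c * y).
  move=> xX y0; rewrite mulrAC ler_pdivlMr// mulNr; apply: le_trans (hb x y y0).
  by rewrite ler_wpM2l ?cabs_ge0// lerD2l -xX; exact: Re_le_cabs (x +i* y).
have cE : continuous (fun y => K / (1 + X) * expR (- c * y)).
  apply: cntM; first exact: cnst.
  move=> y; apply: (@rder_continuous _ _ _ (expR (- c * y) * (- c))).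
  have := rder_comp (rder_affine (- c) 0 y) (is_derive_expR _ : rder _ _ _).
  by under eq_fun do rewrite addr0; rewrite addr0.
have IE T : 0 <= T -> intR (fun y => K / (1 + X) * expR (- c * y)) 0 T <= K / c / (1 + X).
  move=> T0; rewrite (@intR_FTC _ _ (fun y => - (K / (1 + X) / c) * expR (- c * y + 0)))//.
    rewrite mulr0 !addr0 expR0 mulr1 -subr_ge0.
    have -> : K / c / (1 + X) - (- (K / (1 + X) / c) * expR (- c * T) - - (K / (1 + X) / c)) =
        K / (1 + X) / c * expR (- c * T) by field; rewrite !lt0r_neq0.
    by rewrite mulr_ge0 ?expR_ge0// !mulr_ge0 ?invr_ge0// ltW.
  move=> y; apply: rder_eq (rderZ _ (rder_comp (rder_affine (- c) 0 y)
    (is_derive_expR _ : rder _ _ _))) _.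
  by rewrite addr0; field; rewrite !lt0r_neq0.
apply/ler_addgt0Pl => e e0.
(* The top side contributes at most 2 X K exp(-c T), which is at most 2 X K / (1 + c T), hence at
   most [e]. *)
pose T := 2 * X * K / (c * e).
have T0 : 0 <= T by rewrite divr_ge0 ?mulr_ge0// ltW.
have XX : - X <= X by lra.
have := goursat eh XX T0; rewrite /rectint.
set b := cint _ _ _; set r := 'i%C * _; set tp := cint _ _ _; set l := 'i%C * _ => E.
have -> : cint (fun x => g x%:C * expi (k * x)) (- X) X = b.
  by congr cint; apply/funext => x; rewrite hE.
have -> : b = tp + (l - r).
  by apply/eqP; rewrite -subr_eq0; apply/eqP; rewrite -E; ring.
apply: (le_trans (cabsD _ _)); apply: lerD.
  apply: (@le_trans _ _ (K * expR (- (c * T)) * (X - - X))).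
    apply: cint_bound_cst => //; first exact: ccont_h.
    move=> x _; apply: le_trans (hb x T T0); rewrite ler_peMr ?cabs_ge0// lerDl cabs_ge0//.
  rewrite expRN; have cT : 0 < 1 + c * T by rewrite ltr_wpDr// mulr_ge0// ltW.
  have iE1 : (expR (c * T))^-1 <= (1 + c * T)^-1.
    by rewrite lef_pV2 ?posrE ?expR_gt0// expR_ge1Dx.
  apply: (@le_trans _ _ (K * (1 + c * T)^-1 * (X - - X))).
    by rewrite ler_wpM2r ?ler_wpM2l//; lra.
  rewrite mulrAC ler_pdivrMr//.
  have -> : c * T = 2 * X * K / e by rewrite /T; field; rewrite !lt0r_neq0.
  have : e * (2 * X * K / e) = 2 * X * K by rewrite mulrC divfK// lt0r_neq0.
  lra.
apply: (le_trans (cabsB _ _)).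
rewrite (_ : 2 * (K / c) / (1 + X) = K / c / (1 + X) + K / c / (1 + X)); last by ring.
apply: lerD; apply: le_trans (IE T T0); rewrite cabsM cabs_i mul1r;
  apply: cint_bound => //; try exact: ccont_v.
- by move=> y /andP[y0 _]; apply: side => //; rewrite normrN gtr0_norm.
- by move=> y /andP[y0 _]; apply: side => //; rewrite gtr0_norm.
Qed.

Lemma fourier_decay (k X : R) : 1 <= `|k| -> 0 < X ->
  cabs (cint (fun x => f x%:C * expi (k * x)) (- X) X) <= 2 * (K / (2 * pi - s)) / (1 + X).
Proof.
move=> k1 X0; have [k0|k0] := leP 0 k.
  by apply: fourier_decay_pos => //; rewrite -(ger0_norm k0).
pose g z := f (- z).
have eg : entire g by exact (entire_comp ef (entireN (@entire_id R))).
have gK z : cabs (g z) * (1 + cabs z) <= K * expR (s * `|complex.Im z|).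
  by have := fK (- z); rewrite cabsN ImN normrN.
have k1' : 1 <= - k by rewrite -(ltr0_norm k0).
have := fourier_decay_pos eg gK k1' X0.
have cf : ccont (fun x => f x%:C * expi (k * x)).
  exact: ccontM (entire_ccont_real ef) (ccont_expi k).
have := cint_affine (- 1) 0 (- X) X cf.
rewrite !addr0 !mulN1r opprK (cint_swap _ _ cf).
rewrite (_ : (fun x => _ * expi (k * (-1 * x + 0))) = fun x => g x%:C * expi (- k * x)).
  by rewrite realCN mulN1r => /oppr_inj ->.
by apply/funext => x; rewrite addr0 mulN1r mulrN mulNr /g realCN.
Qed.

Let fr x := complex.Re (f x%:C).

Lemma fr_continuous : continuous fr.
Proof. exact: (entire_ccont_real ef).1. Qed.

(** The diagonal of the double sum reproduces the integral of [f]. The fewer than N^2 other terms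
    have frequency at least 1 in modulus, so each is O(1/X), and they are divided by N. *)
Lemma intR_fejer_close N (X : R) : (0 < N)%N -> 0 < X ->
  `|intR (fun x => fr x * fejer N x) (- X) X - intR fr (- X) X| <=
  N%:R * (2 * (K / (2 * pi - s)) / (1 + X)).
Proof.
move=> N0 X0; set D := 2 * (K / (2 * pi - s)) / (1 + X).
have cf := entire_ccont_real ef.
have cK := ccont_real (@fejer_continuous R N).
have Npos : 0 < N%:R :> R by rewrite ltr0n.
have NC : N%:R != 0 :> C by rewrite pnatr_eq0 -lt0n.
have D0 : 0 <= D.
  have := fourier_decay (k := 1); rewrite normr1 => /(_ X (lexx _) X0).
  by apply: le_trans; exact: cabs_ge0.
have -> : intR (fun x => fr x * fejer N x) (- X) X - intR fr (- X) X =
    complex.Re (cint (fun x => f x%:C * (fejer N x)%:C) (- X) X - cint (fun x => f x%:C) (- X) X).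
  rewrite ReD ReN !Re_cint; congr (_ - _); congr intR; apply/funext => x.
  by rewrite ReM /= mulr0 subr0.
apply: (le_trans (Re_le_cabs _)).
rewrite (cint_fejer N (- X) X cf).
set I := cint (fun x => f x%:C) (- X) X.
have -> : N%:R^-1 * (\sum_(l < N) \sum_(j < N)
    cint (fun x => f x%:C * expi ((j%:R - l%:R) * x)) (- X) X) - I =
  N%:R^-1 * (\sum_(l < N) \sum_(j < N | j != l)
    cint (fun x => f x%:C * expi ((j%:R - l%:R) * x)) (- X) X).
  have E (l : 'I_N) : \sum_(j < N) cint (fun x => f x%:C * expi ((j%:R - l%:R) * x)) (- X) X =
     I + \sum_(j < N | j != l) cint (fun x => f x%:C * expi ((j%:R - l%:R) * x)) (- X) X.
    rewrite (bigD1 l)//=; congr (_ + _); congr cint; apply/funext => x.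
    by rewrite subrr mul0r expi0 mulr1.
  rewrite (eq_bigr _ (fun l _ => E l)) big_split/= sumr_const card_ord mulrDr -[I *+ N]mulr_natl.
  by rewrite mulKf// addrAC subrr add0r.
rewrite cabsM cabsV cabs_nat mulrC ler_pdivrMr//.
have H (l : nat) : (l < N)%N -> cabs (\sum_(j < N | (j : nat) != l)
    cint (fun x => f x%:C * expi ((j%:R - l%:R) * x)) (- X) X) <= N%:R * D.
  move=> lN; rewrite big_mkcond/=.
  pose G (j : nat) := if j != l then cint (fun x => f x%:C * expi ((j%:R - l%:R) * x)) (- X) X else 0.
  apply: (le_trans (@cabs_sum R N G)).
  apply: (@le_trans _ _ (\sum_(j < N) D)); last by rewrite sumr_const card_ord mulr_natl.
  apply: ler_sum => j _; rewrite /G; case: ifP => [jl|_]; last by rewrite cabs0.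
  apply: fourier_decay => //.
  by have [h|h] := leqP l j; [rewrite -natrB// normr_nat ler1n subn_gt0 ltn_neqAle eq_sym jl
    |rewrite distrC -natrB ?(ltnW h)// normr_nat ler1n subn_gt0].
apply: (le_trans (@cabs_sum R N (fun l => \sum_(j < N | (j : nat) != l)
    cint (fun x => f x%:C * expi ((j%:R - l%:R) * x)) (- X) X))).
apply: (@le_trans _ _ (\sum_(l < N) N%:R * D)).
  by apply: ler_sum => l _; exact: H.
by rewrite sumr_const card_ord -[(N%:R * D) *+ N]mulr_natr.
Qed.

Hypothesis fpos : forall x, x <= -1 \/ 0 <= x -> 0 <= fr x.

(* [expi t = 1] encodes that t is an integer. *)
Theorem poisson_le t (e : R) : expi t = 1 -> t <= -2 \/ 1 <= t -> 0 < e ->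
  exists2 X0, 0 < X0 & forall X, X0 <= X -> fr t + fr (-1) + fr 0 <= intR fr (- X) X + e.
Proof.
move=> t1 tt e0; have cfr := fr_continuous.
have e40 : 0 < e / 4 by rewrite divr_gt0.
have [N1 H1] := fejer_window cfr t1 e40.
have eN1 : expi (-1 : R) = 1 by rewrite expiN expi1 invr1.
have [N2 H2] := fejer_window cfr eN1 e40.
have [N3 H3] := fejer_window cfr (expi0 R) e40.
pose N := (N1 + N2 + N3).+1.
have N0 : (0 < N)%N by [].
have {}H1 := H1 N (ltac:(rewrite /N -addnA; exact: leq_trans (leq_addr _ _) (leqnSn _))) N0.
have {}H2 := H2 N (ltac:(rewrite /N -addnA addnCA; exact: leq_trans (leq_addr _ _) (leqnSn _))) N0.
have {}H3 := H3 N (ltac:(exact: leq_trans (leq_addl _ _) (leqnSn _))) N0.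
pose D := 2 * (K / (2 * pi - s)).
have D0 : 0 <= D.
  by rewrite mulr_ge0// divr_ge0// subr_ge0 ltW.
(* [N] is fixed first; beyond this length the off-diagonal frequencies contribute at most
   [e / 4]. *)
pose Y := N%:R * D / (e / 4).
have Y0 : 0 <= Y by apply: divr_ge0 (ltW e40); exact: mulr_ge0.
exists (Y + `|t| + 2) => [|X XX]; first by have := normr_ge0 t; move: (Y) Y0 => y; lra.
have X0 : 0 < X.
  by apply: lt_le_trans XX; have := normr_ge0 t; move: (Y) Y0 => y; lra.
have CL : `|intR (fun x => fr x * fejer N x) (- X) X - intR fr (- X) X| <= e / 4.
  apply: (le_trans (intR_fejer_close N0 X0)); rewrite -/D mulrA ler_pdivrMr; last lra.
  have YE : Y * (e / 4) = N%:R * D by rewrite divfK// lt0r_neq0.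
  rewrite -YE mulrC ler_wpM2l ?(ltW e40)//; have := normr_ge0 t; lra.
pose g x := fr x * fejer N x.
have cg : continuous g := cntM cfr (@fejer_continuous R N).
have gpos a b : a <= b -> b <= -1 \/ 0 <= a -> 0 <= intR g a b.
  move=> ab h; apply: intR_ge0 => // x /andP[ax xb]; rewrite mulr_ge0 ?fejer_ge0//.
  by apply: fpos; case: h => ?; [left|right]; lra.
move: H1 H2 H3 CL; rewrite -/g.
have -> : -1 - 1 / 2 = - (3 / 2) :> R by lra.
have -> : -1 + 1 / 2 = - (1 / 2) :> R by lra.
rewrite !add0r => H1 H2 H3 CL.
have tX : `|t| + 2 <= X by lra.
(* The windows of -1 and 0 together cover (-1, 0), where the sign is not known; all that lies
   outside the three windows has a nonnegative integrand and is dropped. *)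
have main : intR g (t - 1 / 2) (t + 1 / 2) + intR g (- (3 / 2)) (- (1 / 2))
    + intR g (- (1 / 2)) (1 / 2) <= intR g (- X) X.
  have ch := fun b a c => esym (intR_chasles b a c cg).
  case: tt => tt.
    have tX' : - t + 2 <= X by have := ler_norm (- t); rewrite normrN; lra.
    rewrite (ch (t - 1 / 2) (- X) X) (ch (t + 1 / 2) (t - 1 / 2) X)
      (ch (- (3 / 2)) (t + 1 / 2) X) (ch (- (1 / 2)) (- (3 / 2)) X) (ch (1 / 2) (- (1 / 2)) X).
    have p1 : 0 <= intR g (- X) (t - 1 / 2) by apply: gpos; [lra|left; lra].
    have p2 : 0 <= intR g (t + 1 / 2) (- (3 / 2)) by apply: gpos; [lra|left; lra].
    have p3 : 0 <= intR g (1 / 2) X by apply: gpos; [lra|right; lra].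
    move: p1 p2 p3; lra.
  have tX' : t + 2 <= X by have := ler_norm t; lra.
  rewrite (ch (- (3 / 2)) (- X) X) (ch (- (1 / 2)) (- (3 / 2)) X) (ch (1 / 2) (- (1 / 2)) X)
    (ch (t - 1 / 2) (1 / 2) X) (ch (t + 1 / 2) (t - 1 / 2) X).
  have p1 : 0 <= intR g (- X) (- (3 / 2)) by apply: gpos; [lra|left; lra].
  have p2 : 0 <= intR g (1 / 2) (t - 1 / 2) by apply: gpos; [lra|right; lra].
  have p3 : 0 <= intR g (t + 1 / 2) X by apply: gpos; [lra|right; lra].
  move: p1 p2 p3; lra.
move: H1 H2 H3 CL; rewrite !ler_norml; move: main; lra.
Qed.

End Poisson.

(** * The quadrature inequality and its equality case *)

Section Inequality.
Variable R : realType.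
Local Notation C := R[i].
Implicit Types (F : C -> C) (x y t l : R).

Lemma gap_truncE f (Y : R) : continuous f -> gap_trunc f Y = intR f (- Y) Y :> R.
Proof.
move=> cf; rewrite /gap_trunc (intRD _ _ cf (@cnst R 1)) (intRB _ _ cf (@cnst R 1)) !intR_cst.
by rewrite -(intR_chasles 0 (- Y) Y cf); ring.
Qed.

Lemma intR_scale f l x : continuous f ->
  l * intR (fun t => f (l * t)) (- x) x = intR f (- (l * x)) (l * x) :> R.
Proof.
move=> cf; have := intR_affine l 0 (- x) x cf; rewrite !addr0 -(mulrN l x) => <-.
by congr (_ * intR _ _ _); apply/funext => t; rewrite addr0.
Qed.

(** The boundary terms are - (Y + l) F(Y) - (Y - l) F(-Y), at most - (Y + l) + (Y - l) = - 2 l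
    because F(Y) >= 1, F(-Y) >= -1 and Y >= l. *)
Lemma majorant_parts F l (Y : R) : monotone_majorant F -> 0 < l -> l <= Y ->
  intR (fun y => - (y + l) * dreal F y) (- Y) Y <= gap_trunc (on_reals F) Y - 2 * l.
Proof.
move=> [[eF _] _ Fsg _ _] l0 lY.
have cd := @dreal_continuous R F eF; have cf := @on_reals_continuous R F eF.
have dA x : rder (fun y => - 1 * y + - l) x (-1) := rder_affine _ _ _.
have := intR_parts (- Y) Y (@cnst R (-1)) cd dA (fun x => on_reals_rder x eF).
rewrite (intRZ _ _ _ cf).
rewrite (_ : (fun y => _ * dreal F y) = (fun y => - (y + l) * dreal F y)); last first.
  by apply/funext => y; rewrite mulN1r opprD.
rewrite (gap_truncE _ cf).
have := Fsg Y; have := Fsg (- Y); rewrite ltr0_sg ?gtr0_sg; [|lra|lra].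
move: (intR (on_reals F) _ _) (on_reals F Y) (on_reals F (- Y)) => G a b hb ha E.
have : (Y + l) * 1 <= (Y + l) * a by rewrite ler_wpM2l//; lra.
have : (Y - l) * -1 <= (Y - l) * b by rewrite ler_wpM2l//; lra.
lra.
Qed.

(** Weight and derivative change sign at -1 and at 0 respectively, so the product can be negative
    only between the two. *)
Lemma quadrature_node_ge0 F l t : monotone_majorant F -> 0 < l ->
  t <= -1 \/ 0 <= t -> 0 <= - (l * t + l) * dreal F (l * t).
Proof.
move=> mF l0 [tt|tt].
  rewrite mulr_ge0//; first by nra.
  by apply: majorant_dreal_ge0 => //; nra.
rewrite mulNr oppr_ge0 mulr_ge0_le0//; first by rewrite addr_ge0 ?mulr_ge0// ltW.
have [->|t0] := eqVneq t 0; first by rewrite mulr0 majorant_dreal0.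
by apply: majorant_dreal_le0 => //; rewrite mulr_gt0// lt_def t0.
Qed.

(** The factor [1 - e] is the loss of damping at the node [t]; of the two errors [e], one comes from
    the Poisson summation and one from removing the damping on (-1, 0). *)
Lemma majorant_quadrature_eps F (I0 l t e : R) : monotone_majorant F ->
  (forall X, 0 < X -> gap_trunc (on_reals F) X <= I0) ->
  0 < l < 1 -> expi t = 1 -> t <= -2 \/ 1 <= t -> 0 < e ->
  l * (- (l * t + l) * dreal F (l * t)) * (1 - e) <= I0 - 2 * l + l * (e + e).
Proof.
move=> mF HI /andP[l0 l1] t1 tt e0; have [rF _ Fsg _ _] := mF; have [eF _] := rF.
have [A A0 HA] := majorant_cderiv_growth mF; have [K K0 HK] := sinc2_bound R.
have p0 := pi_gt0 R.
pose gr x := - (l * x + l) * dreal F (l * x).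
have [Cg Cg0 HCg] : exists2 Cg, 0 <= Cg & forall x, -1 <= x <= 0 -> `|gr x| <= Cg.
  exists (l * A) => [|x x01]; first by rewrite mulr_ge0// ltW.
  have := HA (l * x)%:C; rewrite /= normr0 mulr0 expR0 mulr1 (cderiv_realE _ rF) cabs_real => H.
  rewrite /gr normrM normrN; apply: ler_pM => //.
  by rewrite ger0_norm; nra.
have eS := @entire_sinc2 R.
(* The permitted distance of the damping factor from 1: [e] at the node, and [e / (Cg + 1)] on
   [-1, 0], where [gr] may be as large as [Cg]. *)
pose e3 := Num.min e (e / (Cg + 1)).
have C10 : 0 < Cg + 1 by rewrite ltr_wpDl.
have e30 : 0 < e3 by rewrite lt_min e0 divr_gt0.
have e3e : e3 <= e by rewrite ge_min lexx.
have e3C : Cg * e3 <= e.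
  apply: (@le_trans _ _ (Cg * (e / (Cg + 1)))); first by rewrite ler_wpM2l// ge_min lexx orbT.
  by rewrite mulrA ler_pdivrMr// mulrC ler_wpM2l ?(ltW e0)// lerDl.
have [rho rho0 Hrho] := cder_cont (cderivP 0 eS) e30.
(* The first bound keeps l + ep < 1, so that the type stays below 2 pi; the second makes the damping
   factor nearly 1 for |x| <= |t| + 1, hence at [t] and on [-1, 0]. *)
pose ep := Num.min ((1 - l) / 2) (rho / (`|t| + 2)).
have t20 : 0 < `|t| + 2 by rewrite ltr_wpDl.
have ep0 : 0 < ep by rewrite lt_min !divr_gt0// subr_gt0.
have epl : ep <= (1 - l) / 2 by rewrite ge_min lexx.
have ept : ep * (`|t| + 2) <= rho by rewrite -ler_pdivlMr// ge_min lexx orbT.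
pose S x := complex.Re (sinc2 (ep%:C * x%:C)).
have SE x : sinc2 (ep%:C * x%:C) = (S x)%:C.
  by apply: complex_ext => //=; rewrite -realCM Im_sinc2.
have S01 x : 0 <= S x <= 1 by rewrite /S -realCM Re_sinc2_itv.
have S1 x : `|x| <= `|t| + 1 -> 1 - S x <= e3.
  move=> xt; have hx : cabs (ep%:C * x%:C) < rho.
    rewrite -realCM cabs_real normrM (gtr0_norm ep0); apply: lt_le_trans ept.
    by rewrite ltr_pM2l//; lra.
  have := Hrho _ hx; rewrite add0r sinc2_0 SE -(@rmorph1 _ _ (real_complex R)) -realCB cabs_real.
  by rewrite ltr_norml => /andP[h _]; move: h; move: (S x) => a; clear; lra.
pose G z := - (l%:C * z + l%:C) * cderiv F (l%:C * z).
have eG : entire G.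
  have el := entireM (@entire_cst R l%:C) (@entire_id R).
  exact (entireM (entireN (entireD el (@entire_cst R l%:C))) (entire_comp (entire_cderiv eF) el)).
have eSe : entire (fun z => sinc2 (ep%:C * z)).
  exact (entire_comp eS (entireM (@entire_cst R ep%:C) (@entire_id R))).
pose f z := G z * sinc2 (ep%:C * z).
have ef : entire f by exact (entireM eG eSe).
have fE x : f x%:C = (gr x * S x)%:C.
  rewrite /f SE realCM; congr (_ * _).
  by rewrite /G /gr -!realCM (cderiv_realE _ rF) !realCM realCN realCD !realCM.
pose K1 := l * A * (2 / ep ^+ 2) * K.
have K10 : 0 <= K1.
  by rewrite !mulr_ge0 ?(ltW l0) ?(ltW A0) ?(ltW K0) ?invr_ge0 ?sqr_ge0.
pose s := 2 * pi * (l + ep).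
have s2 : s < 2 * pi.
  rewrite /s -[ltRHS]mulr1 ltr_pM2l ?mulr_gt0//; lra.
have fK z : cabs (f z) * (1 + cabs z) <= K1 * expR (s * `|complex.Im z|).
  have := HK (ep%:C * z); rewrite ImMr normrM (gtr0_norm ep0) cabsM cabs_real (gtr0_norm ep0).
  have := HA (l%:C * z); rewrite ImMr normrM (gtr0_norm l0).
  have -> : cabs (f z) = cabs (l%:C * z + l%:C) * cabs (cderiv F (l%:C * z)) *
      cabs (sinc2 (ep%:C * z)) by rewrite /f cabsM /G cabsM cabsN.
  have : cabs (l%:C * z + l%:C) <= l * (1 + cabs z).
    rewrite (le_trans (cabsD _ _))// cabsM cabs_real (gtr0_norm l0) mulrDr mulr1 addrC.
    by rewrite lerD2l.
  have -> : expR (s * `|complex.Im z|) = expR (2 * pi * (l * `|complex.Im z|)) *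
      expR (2 * pi * (ep * `|complex.Im z|)).
    by rewrite -expRD; congr expR; rewrite /s; ring.
  rewrite /K1; have := cabs_ge0 (l%:C * z + l%:C); have := cabs_ge0 (cderiv F (l%:C * z)).
  have := cabs_ge0 (sinc2 (ep%:C * z)); have := cabs_ge0 z.
  have := @expR_ge0 R (2 * pi * (l * `|complex.Im z|)).
  have := @expR_ge0 R (2 * pi * (ep * `|complex.Im z|)).
  move: (expR _) (expR _) (cabs (sinc2 _)) (cabs (cderiv F _)) (cabs (_ + _)) (cabs z).
  move=> E1 E2 sc d L u E10 E20 u0 sc0 d0 L0 HL Hd Hsc.
  have ep1 : ep ^+ 2 <= 1 by rewrite exprn_ile1 ?(ltW ep0)//; lra.
  have epp : 0 < ep ^+ 2 by rewrite exprn_gt0.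
  (* (1 + u)^2 <= 2 (1 + u^2), and ep <= 1; this compares the weight with the decay of the dilated
     sinc^2. *)
  have U : (1 + u) ^+ 2 <= 2 / ep ^+ 2 * (1 + (ep * u) ^+ 2).
    rewrite mulrAC ler_pdivlMr// exprMn.
    have : 0 <= (1 - u) ^+ 2 by exact: sqr_ge0.
    move: ep1 epp; move: (ep ^+ 2) => q q1 q0 h.
    have : (1 + u) ^+ 2 * q <= (2 * (1 + u ^+ 2)) * q by rewrite ler_wpM2r ?(ltW q0)//; lra.
    lra.
  have -> : L * d * sc * (1 + u) = L * d * (1 + u) * sc by ring.
  apply: (@le_trans _ _ (l * (1 + u) * (A * E1) * (1 + u) * sc)).
    rewrite ler_wpM2r// ler_wpM2r//; first by lra.
    exact: ler_pM.
  have -> : l * (1 + u) * (A * E1) * (1 + u) * sc = l * A * E1 * ((1 + u) ^+ 2 * sc) by ring.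
  have H3 : (1 + u) ^+ 2 * sc <= 2 / ep ^+ 2 * (K * E2).
    apply: (@le_trans _ _ (2 / ep ^+ 2 * (1 + (ep * u) ^+ 2) * sc)); first by rewrite ler_wpM2r.
    by rewrite -mulrA ler_wpM2l ?divr_ge0 ?(ltW epp)// mulrC.
  have -> : l * A * (2 / ep ^+ 2) * K * (E1 * E2) = l * A * E1 * (2 / ep ^+ 2 * (K * E2)) by ring.
  by rewrite ler_wpM2l// !mulr_ge0// ltW.
have grpos x : x <= -1 \/ 0 <= x -> 0 <= gr x by exact: quadrature_node_ge0.
have frE x : complex.Re (f x%:C) = gr x * S x by rewrite fE.
have fpos x : x <= -1 \/ 0 <= x -> 0 <= complex.Re (f x%:C).
  by move=> /grpos g0; rewrite frE mulr_ge0//; case/andP: (S01 x).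
have [X0 X00 HX] := poisson_le ef K10 s2 fK fpos t1 tt e0.
pose X := X0 + `|t| + 2.
have X2 : 2 <= X by rewrite lerDr addr_ge0// ltW.
have X1 : 0 < X by apply: lt_le_trans X2.
have X0X : X0 <= X by rewrite /X -addrA lerDl addr_ge0.
have := HX X X0X.
clearbody X.
rewrite !frE.
have -> : gr (-1) = 0 by rewrite /gr mulrN1 addNr oppr0 mul0r.
have -> : gr 0 = 0 by rewrite /gr mulr0 majorant_dreal0// mulr0.
rewrite !mul0r !addr0 => P.
have cgr : continuous gr.
  have c1 := @cnt_affine R l l; have c2 := @cnt_affine R l 0.
  have := cntM (cntN c1) (cnt_comp c2 (@dreal_continuous R F eF)).
  by under eq_fun do rewrite addr0.
have cfr : continuous (fun x => complex.Re (f x%:C)) := (entire_ccont_real ef).1.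
have ch g b a c : continuous g -> intR g a c = intR g a b + intR g b c :> R.
  by move=> cg; rewrite intR_chasles.
(* Where [gr] is nonnegative the damping only decreases it; on [-1, 0] the damping may increase a
   negative value, by at most [e]. *)
have J : intR (fun x => complex.Re (f x%:C)) (- X) X <= intR gr (- X) X + e.
  rewrite (ch _ (-1) _ _ cfr) (ch _ 0 (-1) _ cfr) (ch _ (-1) _ _ cgr) (ch _ 0 (-1) _ cgr).
  have j x : x <= -1 \/ 0 <= x -> complex.Re (f x%:C) <= gr x.
    by move=> /grpos g0; rewrite frE ler_piMr//; case/andP: (S01 x).
  have j1 : intR (fun x => complex.Re (f x%:C)) (- X) (-1) <= intR gr (- X) (-1).
    by apply: intR_le => // [|x /andP[_ x1]]; [lra|apply: j; left].
  have j2 : intR (fun x => complex.Re (f x%:C)) 0 X <= intR gr 0 X.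
    by apply: intR_le => // [|x /andP[x1 _]]; [lra|apply: j; right].
  have j3 : intR (fun x => complex.Re (f x%:C)) (-1) 0 <= intR (fun x => gr x + e) (-1) 0.
    apply: intR_le => //; first exact: cntD cgr (@cnst R e).
    move=> x x01; rewrite frE; have /S1 s1 : `|x| <= `|t| + 1.
      by have := normr_ge0 t; rewrite ler_norml; lra.
    have g1 := HCg x x01.
    have : - gr x * (1 - S x) <= Cg * e3.
      apply: (@le_trans _ _ (`|gr x| * (1 - S x))).
        by rewrite ler_wpM2r// ?subr_ge0; [case/andP: (S01 x)|rewrite -normrN ler_norm].
      by apply: ler_pM => //; rewrite subr_ge0; case/andP: (S01 x).
    move: e3C; move: (Cg * e3) (gr x) (S x) => a b c; clear; lra.
  move: j1 j2 j3; rewrite (intRD _ _ cgr (@cnst R e)) intR_cst.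
  move: (intR _ _ _) (intR _ _ _) (intR _ _ _) (intR _ _ _) (intR _ _ _) (intR _ _ _) => a1 a2 a3 a4 a5 a6.
  clear; lra.
(* The substitution y = l x restores F' undilated, with the weight y + l. *)
have lJ : l * intR gr (- X) X <= I0 - 2 * l.
  have ch2 : continuous (fun y => - (y + l) * dreal F y).
    have := cntM (cntN (@cnt_affine R 1 l)) (@dreal_continuous R F eF).
    by under eq_fun do rewrite mul1r.
  have -> : l * intR gr (- X) X = _ := intR_scale l X ch2.
  have lX0 : 0 < l * X by rewrite mulr_gt0.
  have X11 : 1 <= X by apply: le_trans X2; rewrite ler1n.
  have lX : l <= l * X by rewrite ler_peMr// ltW.
  by apply: le_trans (majorant_parts mF l0 lX) _; rewrite lerD2r; exact: HI.
have gt0 : 0 <= gr t by apply: grpos; case: tt; [left|right]; lra.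
have St : 1 - e <= S t by have := S1 t; rewrite lerDl ler01 => /(_ isT); lra.
have P2 : gr t * (1 - e) <= intR gr (- X) X + (e + e).
  have : gr t * (1 - e) <= gr t * S t by rewrite ler_wpM2l.
  move: P J; move: (intR gr _ _) => a1; move: (intR _ _ _) => a2.
  move: (gr t * S t) (gr t * (1 - e)) => a3 a4; clear; lra.
have : l * (gr t * (1 - e)) <= l * (intR gr (- X) X + (e + e)) by rewrite ler_wpM2l// ltW.
rewrite -/(gr t) (mulrA l (gr t)) (mulrDr l (intR gr (- X) X)).
by move=> H; apply: (le_trans H); rewrite lerD2r.
Qed.

(** The limit of the preceding estimate, with an error small enough to absorb both [v * e1] and
    [2 * l * e1]. *)
Lemma majorant_quadrature F (I0 l t : R) : monotone_majorant F ->
  (forall X, 0 < X -> gap_trunc (on_reals F) X <= I0) ->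
  0 < l < 1 -> expi t = 1 -> t <= -2 \/ 1 <= t ->
  l * (- (l * t + l) * dreal F (l * t)) <= I0 - 2 * l.
Proof.
move=> mF HI l01 t1 tt; set v := l * _; apply/ler_addgt0Pl => e e0.
have D0 : 0 < `|v| + 2 * l + 1.
  by have := normr_ge0 v; case/andP: l01; lra.
pose e1 := e / (`|v| + 2 * l + 1).
have e10 : 0 < e1 by rewrite divr_gt0.
have := majorant_quadrature_eps mF HI l01 t1 tt e10; rewrite -/v.
have eE : e1 * (`|v| + 2 * l + 1) = e by rewrite divfK// lt0r_neq0.
have : v * e1 <= `|v| * e1 by rewrite ler_wpM2r ?ler_norm// ltW.
move: eE; move: (`|v|) => nv; case/andP: l01; lra.
Qed.

Lemma le_limit1 (q : R -> R) (b : R) : continuous q ->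
  (forall l, 0 < l < 1 -> q l <= b) -> q 1 <= b.
Proof.
move=> cq H; rewrite leNgt; apply/negP => qb.
have d0 : 0 < q 1 - b by rewrite subr_gt0.
have [del del0 K] := (continuousP_eps _ _).1 (cq 1) _ d0.
pose h := Num.min (del / 2) (1 / 2).
have h0 : 0 < h by rewrite lt_min !divr_gt0.
have h1 : h <= 1 / 2 by rewrite ge_min lexx orbT.
have hd : h < del by rewrite gt_min; apply/orP; left; lra.
have := H (1 - h); rewrite subr_gt0 ltrBlDr ltrDl h0 andbT => /(_ (ltac:(lra))).
have := K (1 - h); rewrite addrAC subrr add0r normrN gtr0_norm// => /(_ hd).
rewrite ltr_norml; lra.
Qed.

(** Only the nonnegativity of the term at the node 1 is used: it gives 2 l <= gap, and l tends to
    1. *)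
Theorem majorant_gap_ge2 F : monotone_majorant F -> (2%:E <= sgn_gap F)%E.
Proof.
move=> mF; have [[eF _] _ Fsg _ _] := mF.
have cf := @on_reals_continuous R F eF.
have HT X : 0 < X -> ((gap_trunc (on_reals F) X)%:E <= sgn_gap F)%E by exact: sgn_gap_ge.
case E : (sgn_gap F) HT => [r| |] HT; last 2 first.
- by rewrite leey.
- by have := HT 1 ltr01; rewrite leeNy_eq.
rewrite lee_fin; have {}HT X : 0 < X -> gap_trunc (on_reals F) X <= r by move=> /HT; rewrite lee_fin.
have := @le_limit1 (fun l => 2 * l + 0) r (@cnt_affine R 2 0); rewrite mulr1 addr0; apply.
move=> l l01; rewrite addr0.
have := majorant_quadrature mF HT l01 (expi1 R) (or_intror (lexx 1)).
have l0 : 0 < l by case/andP: l01.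
have := quadrature_node_ge0 mF l0 (or_intror ler01 : 1 <= -1 \/ 0 <= 1).
move=> /(mulr_ge0 (ltW l0)); lra.
Qed.

(** When the gap is 2 the limit l = 1 bounds the nonnegative term - (t + 1) F'(t) by 0, and t + 1 is
    not 0. *)
Theorem extremal_node F t : monotone_majorant F -> sgn_gap F = 2%:E ->
  expi t = 1 -> t <= -2 \/ 1 <= t -> dreal F t = 0.
Proof.
move=> mF IF t1 tt; have [[eF _] _ Fsg _ _] := mF.
have cf := @on_reals_continuous R F eF.
have HT X : 0 < X -> gap_trunc (on_reals F) X <= 2.
  by move=> X0; rewrite -lee_fin -IF; exact: sgn_gap_ge.
pose q l := l * (- (l * t + l) * dreal F (l * t)) + 2 * l.
have cid : continuous (fun l : R => l) by move=> x; exact: cvg_id.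
have clt : continuous (fun l : R => l * t) := cntM cid (@cnst R t).
have cd := cnt_comp clt (@dreal_continuous R F eF).
have cq : continuous q := cntD (cntM cid (cntM (cntN (cntD clt cid)) cd)) (cntM (@cnst R 2) cid).
have H : q 1 <= 2.
  apply: le_limit1 cq _ => l l01; rewrite -lerBrDr.
  exact: majorant_quadrature mF HT l01 t1 tt.
have {H} : - (t + 1) * dreal F t <= 0.
  by move: H; rewrite /q; move: (dreal F) => d; rewrite !mul1r mulr1 gerDr.
move=> H.
have tt' : t <= -1 \/ 0 <= t by case: tt => ?; [left|right]; lra.
have := quadrature_node_ge0 mF ltr01 tt'; move: (dreal F) H => d H; rewrite !mul1r => H2.
have /eqP : - (t + 1) * d t = 0 by apply/eqP; rewrite eq_le H2 andbT.
rewrite mulf_eq0 oppr_eq0 => /orP[|/eqP//].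
by rewrite addr_eq0 => /eqP tN; case: tt; rewrite tN; lra.
Qed.

End Inequality.

(** * Rigidity of the extremal majorant *)

Section SineZeros.
Variable R : realType.
Local Notation C := R[i].
Implicit Types (F G E : C -> C) (x y : R) (z w : C).

Lemma cder_neq0_near F z : entire F -> F z != 0 -> exists2 r : R, 0 < r &
  forall w, cabs (w - z) < r -> F w != 0.
Proof.
move=> eF Fz; have F0 : 0 < cabs (F z) by rewrite cabs_gt0.
have [del del0 H] := cder_cont (cderivP z eF) F0; exists del => // w wz.
have := H (w - z) wz; rewrite subrKC => K; apply/negP => /eqP w0.
by move: K; rewrite w0 sub0r cabsN ltxx.
Qed.

(** Around a simple zero of [G] the quotient coincides with that of the two divided differences,
    whose denominator does not vanish. *)
Lemma entire_div F G : entire F -> entire G ->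
  (forall z, G z = 0 -> F z = 0 /\ cderiv G z != 0) ->
  exists2 Q, entire Q & forall z, F z = G z * Q z.
Proof.
move=> eF eG FG; pose Q z := if G z == 0 then cderiv F z / cderiv G z else F z / G z.
exists Q => [|z]; last first.
  rewrite /Q; case: eqVneq => [z0|z0]; first by rewrite z0 mul0r (FG z z0).1.
  by rewrite mulrC divfK.
apply/entireP => p; have [p0|p0] := eqVneq (G p) 0; last first.
  have [r r0 Hr] := cder_neq0_near eG p0.
  have := cderM (cderivP p eF) (cderV p0 (cderivP p eG)) => D; eexists.
  by apply: cder_near r0 _ D => w wp; rewrite /Q (negPf (Hr w wp)).
have [Fp Gp] := FG p p0.
have eDF := @entire_divdiff R F p eF; have eDG := @entire_divdiff R G p eG.
have Gp' : divdiff G p p != 0 by rewrite /divdiff eqxx.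
have [r r0 Hr] := cder_neq0_near eDG Gp'.
have := cderM (cderivP p eDF) (cderV Gp' (cderivP p eDG)) => D; eexists.
apply: cder_near r0 _ D => w wp; have [->|wp0] := eqVneq w p.
  by rewrite /Q p0 eqxx /divdiff eqxx.
have := Hr w wp; rewrite /Q (divdiffE G p w) (divdiffE F p w) p0 Fp !add0r => Dw.
have wp1 : w - p != 0 by rewrite subr_eq0.
by rewrite mulf_eq0 (negPf wp1) (negPf Dw) -mulf_div divff// mul1r.
Qed.

(** In the upper half plane the first factor carries the growth and the bracket remains bounded, so
    lower bounds reduce to the bracket. *)
Lemma csinpiE z : csinpi z = cexp (- ('i%C * (pi%:C * z))) *
  ((expR (- (2 * pi * complex.Im z)))%:C * expi (complex.Re z) - 1) / (2 * 'i%C).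
Proof.
rewrite /csinpi /csin; congr (_ / _).
have -> : (expR (- (2 * pi * complex.Im z)))%:C * expi (complex.Re z) =
    cexp ('i%C * (pi%:C * z) + 'i%C * (pi%:C * z)).
  case: z => a b /=; rewrite (_ : 'i%C * _ = (- (pi * b)) +i* (pi * a)); last by simpc.
  rewrite /cexp /= expiE; congr (_%:C * (cos _ +i* sin _)); last by ring.
    by congr expR; ring.
  by ring.
by rewrite mulrBr mulr1 -cexpD addrA addNr add0r.
Qed.

Lemma cabs_csinpi z : cabs (csinpi z) = expR (pi * complex.Im z) *
  cabs ((expR (- (2 * pi * complex.Im z)))%:C * expi (complex.Re z) - 1) / 2.
Proof.
rewrite csinpiE cabsM (cabsM (cexp _)) cabsV (cabsM 2) cabs_i mulr1 cabs_nat cabs_cexp.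
congr (expR _ * _ / _); case: z => a b /=; ring.
Qed.

Lemma csinpiN z : csinpi (- z) = - csinpi z.
Proof. by rewrite /csinpi /csin !mulrN opprK -[RHS]mulNr opprB. Qed.

(** Taking moduli, exp(-2 pi Im z) = 1, so the zero is real; the remaining equation makes it an
    integer. *)
Lemma csinpi_eq0 z : csinpi z = 0 -> z = (complex.Re z)%:C /\ expi (complex.Re z) = 1.
Proof.
move=> z0; have /eqP := cabs_csinpi z; rewrite z0 cabs0 eq_sym.
rewrite mulf_eq0 invr_eq0 pnatr_eq0 orbF mulf_eq0 (gt_eqF (expR_gt0 _))/=.
rewrite cabs_eq0 subr_eq0 => /eqP E.
have := congr1 (@cabs R) E; rewrite cabsM cabs_expi mulr1 cabs1 cabs_real.
rewrite ger0_norm ?expR_ge0// => E1; have : expR (- (2 * pi * complex.Im z)) = expR 0 by rewrite E1 expR0.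
move=> /expR_inj /eqP; rewrite oppr_eq0 mulf_eq0 mulf_eq0 pnatr_eq0 (gt_eqF (pi_gt0 R))/= => /eqP y0.
split; last by move: E; rewrite E1 mul1r.
by apply: complex_ext.
Qed.

(** A common zero of sine and cosine would be a zero of the exponential. *)
Lemma cderiv_csinpi_neq0 z : csinpi z = 0 -> cderiv (@csinpi R) z != 0.
Proof.
move=> z0; rewrite (cderivE (cder_csinpi z)) mulf_neq0 ?piC_neq0//.
apply/eqP => c0; move: z0 c0; rewrite /csinpi /csin /ccos; set w := _ * _.
move=> /eqP; rewrite mulf_eq0 invr_eq0 mulf_eq0 (negPf (i_neq0 R)) pnatr_eq0/= orbF subr_eq0 => /eqP E.
move=> /eqP; rewrite mulf_eq0 invr_eq0 pnatr_eq0 orbF E -mulr2n -mulr_natl mulf_eq0 pnatr_eq0/=.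
by rewrite (negPf (cexp_neq0 _)).
Qed.

(** There is no solution in (0, 1), since cos(2 pi t) = 1 forces sin(pi t) = 0; translation excludes
    (-2, -1) and (-1, 0) as well. *)
Lemma expi_eq1_node x : expi x = 1 -> [\/ x <= -2, x = -1, x = 0 | 1 <= x].
Proof.
have K (t : R) : expi t = 1 -> 0 < t < 1 -> False.
  move=> t1 /andP[t0 tl]; have := congr1 (@complex.Re R) t1; rewrite expiE /= => c1.
  have : 0 < sin (pi * t).
    have p0 := pi_gt0 R; apply: sin_gt0_pi; rewrite mulr_gt0//= -[ltRHS]mulr1 ltr_pM2l//.
  have := cos2Dsin2 (pi * t); move: c1; rewrite (_ : 2 * pi * t = (pi * t) *+ 2); last by rewrite mulr2n; ring.
  rewrite cos_mulr2n; move: (cos _) (sin _) => c s; rewrite mulr2n => h1 h2 s0.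
  have := exprn_gt0 2 s0; lra.
have e1 := expi1 R.
move=> x1; have [h|h] := leP x (-2); first exact: Or41.
have [h1|h1] := leP 1 x; first exact: Or44.
have [h2|h2|->] := ltgtP x (-1); last exact: Or42.
  by case: (K (x + 2)); [rewrite (_ : x + 2 = x + 1 + 1) ?expiD ?e1 ?x1 ?mulr1//; ring|lra].
have [h3|h3|->] := ltgtP x 0; last exact: Or43.
  by case: (K (x + 1)); [rewrite expiD e1 x1 mulr1|lra].
by case: (K x); [exact: x1|lra].
Qed.

Lemma Re_expi_circle n x : n%:R + 1 / 4 <= `|x| <= n%:R + 1 / 2 -> complex.Re (expi x) <= 0.
Proof.
move=> xn; have -> : complex.Re (expi x) = complex.Re (expi `|x|).
  by rewrite !expiE/=; case: ger0P => // _; rewrite mulrN cosN.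
have -> : `|x| = (`|x| - n%:R) + n%:R by rewrite subrK.
rewrite expiD expi_nat mulr1 expiE /=; move: xn; move: (`|x| - n%:R) (subrK n%:R `|x|) => t <- xn.
have p0 := pi_gt0 R; rewrite -oppr_ge0 -cosDpi.
have -> : 2 * pi * t + pi = 2 * pi * (t - 1 / 2) + pi *+ 2 :> R by rewrite mulrBr -mulr_natl; field.
rewrite cosD2pi; apply: cos_ge0_pihalf.
have t1 : 0 <= t - 1 / 4 by lra.
have t2 : 0 <= 1 / 2 - t by lra.
by apply/andP; split; [have := mulr_ge0 (ltW p0) t1|have := mulr_ge0 (ltW p0) t2]; lra.
Qed.

End SineZeros.

(** * Lower bounds for the sine on circles, and entire functions of polynomial growth *)

Section EntireGrowth.
Variable R : realType.
Local Notation C := R[i].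
Implicit Types (F G E : C -> C) (x y : R) (z w : C).

(** If Im z >= 1/4 the exponential is at most 1/2, as 2 pi Im z >= 1. Otherwise |Re z| lies within
    1/4 of the half-integer radius, and the real part of the exponential is nonpositive. *)
Lemma cabs_expi_sub1_ge n z : cabs z = n.+1%:R + 1 / 2 -> 0 <= complex.Im z ->
  1 / 2 <= cabs ((expR (- (2 * pi * complex.Im z)))%:C * expi (complex.Re z) - 1) :> R.
Proof.
case: z => x y /= zn y0; set e := expR _; have e0 : 0 <= e := expR_ge0 _.
have [y1|y1] := leP (1 / 4) y.
  apply: le_trans (_ : 1 - e <= _).
    have E1 := expRxMexpNx_1 (2 * pi * y); rewrite -/e in E1; clearbody e.
    have u0 : 1 <= 2 * pi * y.
      by have := mulr_ge0 (ltW (pi_gt0 R)) (_ : 0 <= y - 1 / 4); have := pi_ge2 R; lra.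
    move: E1 u0 (@expR_ge1Dx R (2 * pi * y)); move: (2 * pi * y) => u.
    move: (expR u) => E E1 u0 Eu; have := ler_wpM2r e0 (_ : 2 <= E); lra.
  rewrite -(cabsN (_ - 1)) opprB; apply: le_trans (cabs_sub_le _ _).
  by rewrite cabs1 cabsM cabs_expi mulr1 cabs_real ger0_norm.
have xn : n.+1%:R + 1 / 4 <= `|x| <= n.+1%:R + 1 / 2.
  have n1 : 1 <= n.+1%:R :> R by rewrite ler1n.
  have := congr1 (fun t => t ^+ 2) zn; rewrite cabs_sqr /=.
  have -> : x ^+ 2 = `|x| ^+ 2 by rewrite real_normK ?num_real.
  have y2 : y ^+ 2 <= (1 / 4) ^+ 2 by rewrite lerXn2r ?nnegrE// ltW.
  move: n1 (normr_ge0 x) (sqr_ge0 y) y2; move: (n.+1%:R) `|x| (y ^+ 2) => a b q; clear.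
  move=> a1 b0 q0 q1 H.
  by apply/andP; split; rewrite -(@ler_pXn2r _ 2)// ?nnegrE; lra.
have c0 := Re_expi_circle xn.
apply: le_trans (Re_le_cabs _); rewrite ler_normr; apply/orP; right.
rewrite ReD ReN ReMr; have := mulr_ge0_le0 e0 c0; rewrite [complex.Re 1]/=; lra.
Qed.

Lemma cabs_csinpi_ge n z : cabs z = n.+1%:R + 1 / 2 ->
  expR (pi * `|complex.Im z|) / 4 <= cabs (csinpi z) :> R.
Proof.
wlog y0 : z / 0 <= complex.Im z => [W|] zn.
  have [y0|y0] := leP 0 (complex.Im z); first exact: W.
  rewrite -cabsN -csinpiN -normrN -ImN; apply: W; last by rewrite cabsN.
  by rewrite ImN oppr_ge0 ltW.
rewrite cabs_csinpi ger0_norm//; have := cabs_expi_sub1_ge zn y0.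
have := @expR_gt0 R (pi * complex.Im z); move: (expR (pi * _)) (cabs _) => a b a0 b0.
have := ler_wpM2l (ltW a0) b0; lra.
Qed.

(** Induction on the degree, dividing out one factor z at a time. Of the conclusion that [E] is a
    polynomial only this dichotomy is needed: constant, or of at least linear growth along the
    positive axis. *)
Lemma liouville_growth E k (K : R) (rad : nat -> R) : entire E ->
  (forall n, n.+1%:R < rad n) ->
  (forall n z, cabs z = rad n -> cabs (E z) <= K * rad n ^+ k) ->
  (exists c, forall z, E z = c) \/
  exists2 c : R, 0 < c & exists Y0, forall y, Y0 <= y -> c * y <= cabs (E y%:C).
Proof.
move=> eE radn; have rad0 n : 0 < rad n := lt_trans (ltr0Sn _ n) (radn n).
have rad1 n : 1 <= rad n by apply: le_trans (ltW (radn n)); rewrite ler1n.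
have radn' n : n%:R < rad n by apply: lt_trans (radn n); rewrite ltr_nat.
elim: k E eE K => [|k IH] E eE K HE; have eD := @entire_divdiff R E 0 eE;
  have ED z : E z = E 0 + z * divdiff E 0 z by rewrite {1}(divdiffE E 0 z) subr0.
- left; exists (E 0) => z.
  rewrite ED (@liouville_zero R _ (K + cabs (E 0)) rad eD radn') ?mulr0 ?addr0// => n w wn.
  rewrite ler_pdivlMr// -wn -cabsM mulrC.
  have -> : w * divdiff E 0 w = E w - E 0 by rewrite ED addrAC subrr add0r.
  by rewrite (le_trans (cabsB _ _))// lerD2r -[K]mulr1 -(expr0 (rad n)) HE.
have [n w wn|[c Dc]|[c c0 [Y0 HY]]] := IH _ eD (K + cabs (E 0)).
- have H := HE n w wn; rewrite -(ler_pM2l (rad0 n)) -{1}wn -cabsM.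
  have -> : w * divdiff E 0 w = E w - E 0 by rewrite ED addrAC subrr add0r.
  rewrite (le_trans (cabsB _ _))//.
  rewrite (mulrCA (rad n)) -exprS mulrDl lerD// ler_peMr ?cabs_ge0//.
  exact: exprn_ege1.
- have [c0|c0] := eqVneq c 0.
    by left; exists (E 0) => z; rewrite ED Dc c0 mulr0 addr0.
  have cc0 : 0 < cabs c by rewrite cabs_gt0.
  right; exists (cabs c / 2); first by rewrite divr_gt0.
  exists (2 * cabs (E 0) / cabs c) => y; rewrite ler_pdivrMr// => H.
  rewrite ED Dc addrC; apply: le_trans (_ : cabs (y%:C * c) - cabs (E 0) <= _); last first.
    by rewrite -(cabsN (E 0)); apply: le_trans (cabs_sub_le _ _) _; rewrite opprK.
  have y0 : 0 <= y by rewrite -(pmulr_lge0 _ cc0); apply: le_trans H; rewrite mulr_ge0 ?cabs_ge0.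
  by rewrite cabsM cabs_real ger0_norm//; lra.
(* From y >= 2 one has c y^2 >= 2 c y, and one of the two c y pays for |E 0|. *)
right; exists c => //; exists (Num.max Y0 (Num.max 2 (cabs (E 0) / c))) => y.
rewrite !ge_max => /and3P[y1 y2]; rewrite ler_pdivrMr// => y3.
have y0 : 0 <= y by apply: le_trans y2.
rewrite ED addrC; apply: le_trans (_ : cabs (y%:C * divdiff E 0 y%:C) - cabs (E 0) <= _); last first.
  by rewrite -(cabsN (E 0)); apply: le_trans (cabs_sub_le _ _) _; rewrite opprK.
rewrite cabsM cabs_real ger0_norm//; have := ler_wpM2l y0 (HY _ y1).
have : 0 <= c * (y * (y - 2)) by rewrite mulr_ge0 ?(ltW c0)// mulr_ge0// subr_ge0.
move: (y * cabs _) (cabs _) y3 => u v; clear; lra.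
Qed.

End EntireGrowth.

(** * Double zeros of the derivative of an extremal majorant *)

Section Extremal.
Variable R : realType.
Local Notation C := R[i].
Implicit Types (F G E : C -> C) (x y : R) (z w : C).

Lemma rder_local_min (f : R -> R) x d (r : R) : 0 < r -> rder f x d ->
  (forall h, `|h| < r -> f x <= f (x + h)) -> d = 0.
Proof.
move=> r0 fd H; apply/eqP; rewrite eq_le -oppr_ge0; apply/andP; split.
  have : rder (fun u => f (-1 * u)) (- x) (- d).
    have := rder_comp (rderZ (-1) (rder_id (- x))) (_ : rder f _ d).
    rewrite mulrNN mul1r mulr1 => /(_ fd); rewrite mulrN1; exact.
  move=> /(rder_ge0_right r0); apply=> h /andP[h0 hr].
  rewrite mulrNN mul1r mulrDr mulrNN mul1r mulN1r; apply: H.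
  by rewrite normrN gtr0_norm.
apply: rder_ge0_right r0 fd _ => h /andP[h0 hr]; apply: H.
by rewrite gtr0_norm.
Qed.

(** F' keeps its sign near x, so its zero there is a local extremum of F'. *)
Lemma majorant_node_double F x : monotone_majorant F -> dreal F x = 0 -> x != 0 ->
  dreal (cderiv F) x = 0.
Proof.
move=> mF Fx x0; have [[eF _] _ _ _ _] := mF.
have D : rder (dreal F) x (dreal (cderiv F) x) := on_reals_rder x (entire_cderiv eF).
have r0 : 0 < `|x| by rewrite normr_gt0.
have K1 : x < 0 -> forall h, `|h| < `|x| -> 0 <= dreal F (x + h).
  move=> xn h; rewrite (ltr0_norm xn) ltr_norml => hx.
  by apply: majorant_dreal_ge0 => //; lra.
have K2 : 0 < x -> forall h, `|h| < `|x| -> dreal F (x + h) <= 0.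
  move=> xp h; rewrite (gtr0_norm xp) ltr_norml => hx.
  by apply: majorant_dreal_le0 => //; lra.
move: (dreal (cderiv F) x) (dreal F) D Fx K1 K2 => d g D gx K1 K2.
have /orP[xn|xp] : (x < 0) || (0 < x) by rewrite -neq_lt.
  by apply: rder_local_min r0 D _ => h hx; rewrite gx; exact: K1.
apply/eqP; rewrite -oppr_eq0; apply/eqP.
by apply: rder_local_min r0 (rderN D) _ => h hx; rewrite gx lerN2; exact: K2.
Qed.

Lemma entire_pole_factor : entire (fun z : C => z * (z + 1) ^+ 2).
Proof.
have e1 : entire (fun z : C => z + 1) := entireD (@entire_id R) (@entire_cst R 1).
exact (entireM (@entire_id R) (@entireX R _ 2 e1)).
Qed.

(** The left side has a double zero at every integer: from F' away from -1 and 0, from the factor (z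
    + 1)^2 at -1, and from F'(0) = 0 together with the factor z at 0. It is divided twice by the
    sine, whose zeros are simple. *)
Lemma extremal_factor F : monotone_majorant F -> sgn_gap F = 2%:E ->
  exists2 E, entire E & forall z, cderiv F z * (z * (z + 1) ^+ 2) = csinpi z ^+ 2 * E z.
Proof.
move=> mF IF; have [rF _ _ _ _] := mF; have [eF _] := rF.
have eF1 := entire_cderiv eF; have eP := entire_pole_factor.
have es := @entire_csinpi R.
pose f z := cderiv F z * (z * (z + 1) ^+ 2); have ef : entire f := entireM eF1 eP.
have dP p : cder (fun z : C => z * (z + 1) ^+ 2) p (p * (2 * (p + 1)) + (p + 1) ^+ 2 * 1).
  apply: cderM (cder_id p) _.
  have d1 := cderD (cder_id p) (cder_cst 1 p).
  by apply: cder_eq (cderM d1 d1) _; ring.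
have df p : cderiv f p = cderiv F p * (p * (2 * (p + 1)) + (p + 1) ^+ 2 * 1) +
    p * (p + 1) ^+ 2 * cderiv (cderiv F) p.
  exact: cderivE (cderM (cderivP p eF1) (dP p)).
have Z p : csinpi p = 0 -> f p = 0 /\ cderiv f p = 0.
  move=> /csinpi_eq0[]; move: (complex.Re p) => x -> x1.
  rewrite df /f !(cderiv_realE _ (real_entire_cderiv rF)) !(cderiv_realE _ rF).
  have K : x != 0 -> dreal F x = 0 -> (dreal F x)%:C = 0 :> C /\ (dreal (cderiv F) x)%:C = 0 :> C.
    by move=> x0 Fx; rewrite Fx majorant_node_double.
  have Q (a b u v : C) : a = 0 /\ b = 0 -> a * u = 0 /\ a * v + u * b = 0.
    by case=> -> ->; split; ring.
  have Q1 (a b : C) : a * (-1 * (-1 + 1) ^+ 2) = 0 /\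
      a * (-1 * (2 * (-1 + 1)) + (-1 + 1) ^+ 2 * 1) + -1 * (-1 + 1) ^+ 2 * b = 0.
    by split; ring.
  have Q0 (b u v w : C) : 0 * u = 0 /\ 0 * v + 0 * w * b = 0 by split; ring.
  have [xl|xl|xl|xl] := expi_eq1_node x1.
  - apply: Q; apply: K; first by rewrite lt_eqF// (le_lt_trans xl)// ltrNl oppr0.
    exact: extremal_node mF IF x1 (or_introl xl).
  - have -> : x%:C = -1 :> C by rewrite xl realCN.
    exact: Q1.
  - by rewrite xl majorant_dreal0//; exact: Q0.
  apply: Q; apply: K; first by rewrite gt_eqF// (lt_le_trans ltr01).
  exact: extremal_node mF IF x1 (or_intror xl).
have [E1 eE1 HE1] := entire_div ef es (fun p p0 => conj (Z p p0).1 (cderiv_csinpi_neq0 p0)).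
have Z1 p : csinpi p = 0 -> E1 p = 0 /\ cderiv (@csinpi R) p != 0.
  move=> p0; have n0 := cderiv_csinpi_neq0 p0; split=> //.
  have := cderivE (cderM (cderivP p es) (cderivP p eE1)).
  rewrite -(_ : f = fun z => csinpi z * E1 z); last by apply/funext.
  rewrite (Z p p0).2 p0 mul0r add0r => /esym /eqP; rewrite mulf_eq0 (negPf n0) orbF.
  by move/eqP.
have [E2 eE2 HE2] := entire_div eE1 es Z1.
by exists E2 => // z; rewrite -[LHS]/(f z) HE1 HE2 expr2 mulrA.
Qed.

Lemma sin_pinat n : sin (pi * n%:R) = 0 :> R.
Proof.
elim: n => [|n IH]; first by rewrite mulr0 sin0.
by rewrite -addn1 natrD mulrDr mulr1 sinDpi IH oppr0.
Qed.

Lemma intR_sin2 (m n : nat) :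
  intR (fun y : R => sin (pi * y) ^+ 2) m%:R n%:R = (n%:R - m%:R) / 2.
Proof.
have p0 := pi_gt0 R.
have d y : rder (fun y : R => pi * y) y pi by have := rderZ pi (rder_id y); rewrite mulr1.
have ds y : rder (fun y : R => sin (pi * y)) y (cos (pi * y) * pi) :=
  rder_comp (d y) (is_derive_sin _ : rder _ _ _).
have dc y : rder (fun y : R => cos (pi * y)) y (- sin (pi * y) * pi) :=
  rder_comp (d y) (is_derive_cos _ : rder _ _ _).
have cs : continuous (fun y : R => sin (pi * y)) := fun y => rder_continuous (ds y).
pose H (y : R) := 2^-1 * y - (2 * pi)^-1 * (sin (pi * y) * cos (pi * y)).
rewrite (@intR_FTC _ _ H _ _ (cntM cs cs)).
  by rewrite /H !sin_pinat !mul0r !mulr0 !subr0 -mulrBr mulrC.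
move=> y; apply: rder_eq (rderB (rderZ _ (rder_id y)) (rderZ _ (rderM (ds y) (dc y)))) _.
have := cos2Dsin2 (pi * y); move: (sin _) (cos _) => s c h.
have Q (p : R) : p != 0 ->
    2^-1 * 1 - (2 * p)^-1 * (s * (- s * p) + c * (c * p)) = (1 - (c ^+ 2 - s ^+ 2)) / 2.
  by move=> pn; field.
by rewrite (Q _ (lt0r_neq0 p0)); lra.
Qed.

End Extremal.

(** * The entire quotient is constant *)

Section Rigidity.
Variable R : realType.
Local Notation C := R[i].
Implicit Types (F G E : C -> C) (x y : R) (z w : C).

(** The exponential growth of F' cancels that of the squared sine. In 64, 16 comes from the lower
    bound of the squared sine and 4 from |z + 1|^2 <= 4 |z|^2. *)
Lemma factor_circle_bound F E : monotone_majorant F ->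
  (forall z, cderiv F z * (z * (z + 1) ^+ 2) = csinpi z ^+ 2 * E z) ->
  exists K, forall n z, cabs z = n.+1%:R + 1 / 2 ->
    cabs (E z) <= K * (n.+1%:R + 1 / 2) ^+ 3 :> R.
Proof.
move=> mF HE; have [A A0 HA] := majorant_cderiv_growth mF; exists (64 * A) => n z zn.
have := HA z; have := cabs_csinpi_ge zn; have := congr1 (@cabs R) (HE z).
rewrite (cabsM (cderiv F z)) (cabsM z) (cabsM (csinpi z ^+ 2)) !cabsX.
have : cabs (z + 1) <= 2 * cabs z.
  by rewrite (le_trans (cabsD _ _))// cabs1 zn; have : 1 <= n.+1%:R :> R by [rewrite ler1n]; lra.
have -> : expR (2 * pi * `|complex.Im z|) = expR (pi * `|complex.Im z|) ^+ 2.
  by rewrite expr2 -expRD; congr expR; ring.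
have r0 := cabs_ge0 z; rewrite -zn; move: (cabs_ge0 (z + 1)) (cabs_ge0 (E z)) (cabs_ge0 (cderiv F z)).
move: (expR_gt0 (pi * `|complex.Im z|)) r0; move: (cabs z) (cabs (z + 1)) (cabs (E z)) (cabs (cderiv F z)).
move: (expR _) (cabs (csinpi z)) => e s r r1 Ez d e0 r0 r10 E0 d0 h1 eq h2 h3.
have e2 : 0 < e ^+ 2 by rewrite exprn_gt0.
rewrite -(ler_pM2l e2).
have S : e ^+ 2 <= 16 * s ^+ 2.
  have : (e / 4) ^+ 2 <= s ^+ 2 by rewrite lerXn2r ?nnegrE ?divr_ge0 ?(ltW e0)// (le_trans _ h2)// divr_ge0 ?(ltW e0).
  lra.
have r2 : r1 ^+ 2 <= (2 * r) ^+ 2 by rewrite lerXn2r ?nnegrE ?mulr_ge0.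
have H1 := ler_wpM2r E0 S.
have H2 : d * (r * r1 ^+ 2) <= (A * e ^+ 2) * (r * (2 * r) ^+ 2).
  by apply: ler_pM => //; rewrite ?mulr_ge0 ?sqr_ge0// ler_wpM2l.
move: H1 H2; rewrite eq => H1 H2; apply: (le_trans H1).
rewrite -mulrA; have := ler_wpM2l (ler0n _ 16) H2 => /le_trans; apply.
by rewrite (_ : 16 * _ = e ^+ 2 * (64 * A * r ^+ 3))//; ring.
Qed.

(** Integration by parts with l = 1 makes the integral over [-X, X] at most 2 - 2 = 0. The part left
    of -1 is nonnegative, so the part over [0, X] is at most minus the fixed integral over
    [-1, 0]. *)
Lemma majorant_weight_bounded F : monotone_majorant F -> (sgn_gap F <= 2%:E)%E ->
  exists B, forall X, 1 <= X -> intR (fun y => (y + 1) * - dreal F y) 0 X <= B.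
Proof.
move=> mF IF; have [[eF _] _ Fsg _ _] := mF.
have cf := @on_reals_continuous R F eF; have cd := @dreal_continuous R F eF.
pose w y := - (y + 1) * dreal F y.
have cw : continuous w.
  have := cntM (cntN (@cnt_affine R 1 1)) cd.
  by rewrite (_ : (fun x => - (1 * x + 1) * dreal F x) = w)//; apply/funext => x; rewrite (mul1r x).
rewrite (_ : (fun y => (y + 1) * - dreal F y) = w); last first.
  by apply/funext => y; rewrite /w mulrN mulNr.
exists (- intR w (-1) 0) => X X1.
have X0 : 0 < X := lt_le_trans ltr01 X1.
have G2 : gap_trunc (on_reals F) X <= 2.
  by rewrite -lee_fin; apply: le_trans IF; exact: sgn_gap_ge.
have : intR w (- X) X <= gap_trunc (on_reals F) X - 2 * 1 := majorant_parts mF ltr01 X1.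
have : 0 <= intR w (- X) (-1).
  apply: intR_ge0 => //; first by rewrite lerN2.
  move=> y /andP[_ y1]; rewrite /w mulr_ge0//; first lra.
  by apply: majorant_dreal_ge0 => //; lra.
rewrite -(intR_chasles (-1) (- X) X cw) -(intR_chasles 0 (-1) X cw).
move: (intR _ _ _) (intR _ _ _) (intR _ _ _) (gap_trunc _ _) G2 => a b c d; clear; lra.
Qed.

Lemma dyadic_unbounded (W : R -> R) (c : R) (N : nat) (B : R) : 0 < c -> (0 < N)%N ->
  (forall n, (N <= n)%N -> W n%:R + c <= W (2 * n)%:R) ->
  (forall n, (0 < n)%N -> W n%:R <= B) -> False.
Proof.
move=> c0 N0 H HB.
have K j : (N <= N * 2 ^ j)%N /\ W N%:R + c * j%:R <= W (N * 2 ^ j)%:R.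
  elim: j => [|j [IH1 IH2]]; first by rewrite expn0 muln1 mulr0 addr0.
  split; first by rewrite leq_pmulr// expn_gt0.
  have := H _ IH1; rewrite expnS mulnCA -natr1; lra.
have [j Hj] : exists j : nat, B < W N%:R + c * j%:R.
  exists (Num.bound `|(B - W N%:R) / c|); rewrite -ltrBlDl mulrC -ltr_pdivrMr//.
  exact: le_lt_trans (ler_norm _) (archi_boundP (normr_ge0 _)).
have := le_lt_trans (HB _ (leq_trans N0 (K j).1)) Hj; rewrite ltNge (K j).2//.
Qed.

(* If the entire quotient E were not constant, the weight (y + 1) |F'(y)| would
   dominate c sin^2(pi y) / (y + 1), whose integrals over [n, 2n] stay away
   from 0. *)
Theorem extremal_cderiv F : monotone_majorant F -> sgn_gap F = 2%:E ->
  exists c, forall z, cderiv F z * (z * (z + 1) ^+ 2) = c * csinpi z ^+ 2.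
Proof.
move=> mF IF; have [E eE HE] := extremal_factor mF IF.
have [K HK] := factor_circle_bound mF HE.
have radn n : n.+1%:R < n.+1%:R + 1 / 2 :> R by rewrite ltrDl divr_gt0.
have [[c Ec]|[c c0 [Y0 HY]]] := liouville_growth eE radn HK.
  by exists c => z; rewrite HE Ec mulrC.
have [rF _ _ _ _] := mF; have [eF _] := rF.
have cd := @dreal_continuous R F eF.
have IF2 : (sgn_gap F <= 2%:E)%E by rewrite IF.
have [B HB] := majorant_weight_bounded mF IF2.
pose w y := (y + 1) * - dreal F y.
have cw : continuous w.
  have := cntM (@cnt_affine R 1 1) (cntN cd).
  by rewrite (_ : (fun x => (1 * x + 1) * - dreal F x) = w)//; apply/funext => x; rewrite (mul1r x).
(* The modulus of the factorization at [y], with |E y| >= c y, divided by y. *)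
have wge y : 0 < y -> Y0 <= y -> c * sin (pi * y) ^+ 2 <= w y * (y + 1).
  move=> y0 yY; have := congr1 (@cabs R) (HE y%:C); have := HY y yY.
  rewrite (cabsM (cderiv F _)) (cabsM y%:C) (cabsM (csinpi _ ^+ 2)) !cabsX.
  rewrite (cderiv_realE _ rF) /csinpi -realCM csin_real !cabs_real.
  rewrite (_ : y%:C + 1 = (y + 1)%:C :> C); last by rewrite realCD.
  have y1 : 0 < y + 1 by rewrite addr_gt0.
  rewrite cabs_real (gtr0_norm y0) (gtr0_norm y1) real_normK ?num_real//.
  rewrite (ler0_norm (majorant_dreal_le0 mF y0)) /w.
  move: (dreal F y) (sin (pi * y) ^+ 2) (sqr_ge0 (sin (pi * y))) (cabs (E y%:C)).
  move=> d s s0 u uc H; rewrite -(ler_pM2l y0).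
  have := ler_wpM2l s0 uc; rewrite -H (_ : s * (c * y) = y * (c * s)); last by ring.
  by rewrite (_ : - d * (y * (y + 1) ^+ 2) = y * ((y + 1) * - d * (y + 1)))//; ring.
exfalso; pose N := (Num.bound `|Y0|).+1.
have NY n : (N <= n)%N -> Y0 <= n%:R /\ 1 <= n%:R :> R.
  move=> Nn; split; last by rewrite ler1n (leq_trans _ Nn).
  apply: le_trans (ler_norm _) _; apply: le_trans (ltW (archi_boundP (normr_ge0 _))) _.
  by rewrite ler_nat (leq_trans _ Nn).
(* On [n, 2n] the squared sine has integral n / 2 and the denominator is at most 2 n + 1 <= 3 n,
   whence 1/6. *)
apply: (@dyadic_unbounded (fun X => intR w 0 X) (c / 6) N B).
- by rewrite divr_gt0.
- by [].
- move=> n Nn; have [nY n1] := NY n Nn; rewrite -(intR_chasles n%:R 0 (2 * n)%:R cw) lerD2l.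
  have cs : continuous (fun y : R => sin (pi * y)).
    by move=> y; exact: rder_continuous (rder_comp (rderZ pi (rder_id y)) (is_derive_sin _ : rder _ _ _)).
  have n2 : 0 < (2 * n)%:R + 1 :> R by rewrite ltr_wpDl.
  apply: (@le_trans _ _ (intR (fun y => c / ((2 * n)%:R + 1) * sin (pi * y) ^+ 2) n%:R (2 * n)%:R)).
    rewrite (intRZ _ _ _ (cntM cs cs)) intR_sin2 natrM.
    by rewrite mulrAC ler_pdivlMr -?natrM// natrM; have := ler_wpM2l (ltW c0) n1; lra.
  apply: intR_le => //.
  + exact: cntM (@cnst R _) (cntM cs cs).
  + by rewrite ler_nat leq_pmull.
  move=> y /andP[y1 y2]; have y0 : 0 < y by apply: lt_le_trans y1; apply: lt_le_trans n1.
  have w0 : 0 <= w y.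
    by rewrite mulr_ge0 ?oppr_ge0 ?majorant_dreal_le0// addr_ge0// ltW.
  rewrite mulrAC ler_pdivrMr//; apply: (le_trans (wge y y0 (le_trans nY y1))).
  by rewrite ler_wpM2l// lerD2r.
- move=> n n0; apply: HB; by rewrite ler1n.
Qed.

End Rigidity.

(** * Uniqueness of the extremal majorant *)

Section Uniqueness.
Variable R : realType.
Local Notation C := R[i].
Implicit Types (F G H : C -> C) (x y : R) (z w : C).

(** Integrating F' includes the endpoint 0, which the monotonicity hypothesis leaves out. *)
Lemma majorant_nonincreasing F x y : monotone_majorant F -> 0 <= x -> x <= y ->
  on_reals F y <= on_reals F x.
Proof.
move=> mF x0 xy; have [[eF _] _ _ _ _] := mF.
have cd := @dreal_continuous R F eF.
rewrite -subr_ge0 -opprB -(intR_FTC x y cd (fun u => on_reals_rder u eF)) -mulN1r -(intRZ _ _ _ cd).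
apply: intR_ge0 => //; first exact: cntM (@cnst R (-1)) cd.
move=> u /andP[xu _]; rewrite mulN1r oppr_ge0; have [->|u0] := eqVneq u 0.
  by rewrite majorant_dreal0.
by apply: majorant_dreal_le0 => //; rewrite lt_def u0 (le_trans x0).
Qed.

Lemma majorant_nondecreasing F x y : monotone_majorant F -> y <= 0 -> x <= y ->
  on_reals F x <= on_reals F y.
Proof.
move=> mF y0 xy; have [[eF _] _ _ _ _] := mF.
have cd := @dreal_continuous R F eF.
rewrite -subr_ge0 -(intR_FTC x y cd (fun u => on_reals_rder u eF)).
apply: intR_ge0 => // u /andP[_ uy]; have [->|u0] := eqVneq u 0.
  by rewrite majorant_dreal0.
by apply: majorant_dreal_ge0 => //; rewrite lt_neqAle u0 (le_trans uy).
Qed.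

(** By monotonicity X (F(X) - 1) and X (F(-X) + 1) are bounded by the two halves of the gap, so both
    distances are at most 2 / X. *)
Lemma majorant_limit F (e : R) : monotone_majorant F -> (sgn_gap F <= 2%:E)%E -> 0 < e ->
  exists X0 : R, forall X, X0 <= X ->
    `|on_reals F X - 1| <= e /\ `|on_reals F (- X) - -1| <= e.
Proof.
move=> mF IF e0; have [[eF _] _ Fsg _ _] := mF; exists (2 / e + 1) => X XX.
have X0 : 0 < X by apply: lt_le_trans XX; rewrite ltr_wpDl// divr_ge0// ltW.
have eX : 2 < e * X.
  apply: lt_le_trans (_ : e * (2 / e + 1) <= _); last by rewrite ler_wpM2l// ltW.
  by rewrite mulrDr mulr1 mulrC divfK ?lt0r_neq0// ltrDl.
have cf := @on_reals_continuous R F eF.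
have : gap_trunc (on_reals F) X <= 2.
  by rewrite -lee_fin; apply: le_trans IF; exact: sgn_gap_ge.
have F1 : 1 <= on_reals F X by have := Fsg X; rewrite gtr0_sg.
have F2 : -1 <= on_reals F (- X) by have := Fsg (- X); rewrite ltr0_sg// oppr_lt0.
have : (on_reals F X - 1) * (X - 0) <= intR (fun x => on_reals F x - 1) 0 X.
  rewrite -intR_cst; apply: intR_le => //; [exact: (@cnst R _)|exact: cntB cf (@cnst R 1)|exact: ltW|].
  by move=> x /andP[x0 xX]; rewrite lerD2r; exact: majorant_nonincreasing.
have : (on_reals F (- X) + 1) * (0 - - X) <= intR (fun x => on_reals F x + 1) (- X) 0.
  rewrite -intR_cst; apply: intR_le => //; [exact: (@cnst R _)|exact: cntD cf (@cnst R 1)|by rewrite oppr_le0 ltW|].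
  by move=> x /andP[x0 xX]; rewrite lerD2r; exact: majorant_nondecreasing.
rewrite /gap_trunc; move: (intR _ _ _) (intR _ _ _) => i1 i2 h1 h2 h3.
have K u v : 0 <= u -> 0 <= v -> u * X + v * X <= 2 -> u <= e.
  move=> u0 v0 uv; rewrite leNgt; apply/negP => eu.
  have := ltr_pM2r X0 e u; rewrite eu => eu'; have := mulr_ge0 v0 (ltW X0); lra.
rewrite opprK !ger0_norm; [|lra|lra]; split.
  by apply: (K _ (on_reals F (- X) + 1)); lra.
by apply: (K _ (on_reals F X - 1)); lra.
Qed.

Lemma cderiv0_const H : entire H -> (forall z, cderiv H z = 0) -> forall z, H z = H 0.
Proof.
move=> eH H0 z; have D t : rcder (fun t => H (0 + t%:C * z)) t 0.
  by have := cder_line (cderivP (0 + t%:C * z) eH); rewrite H0 mul0r.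
have := cint_FTC 0 1 (ccont_cst 0) D; rewrite cint_cst mul0r mul1r !add0r mul0r => /esym/eqP.
by rewrite subr_eq0 => /eqP.
Qed.

(** A nonzero value of the derivative at z would persist at z + d and z + d / 2, and both points
    would have to be 0 or -1, although they are at most 1/4 apart. *)
Lemma cderiv_pole_const H : entire H -> (forall z, cderiv H z * (z * (z + 1) ^+ 2) = 0) ->
  forall z, H z = H 0.
Proof.
move=> eH HP; apply: cderiv0_const => // z; apply/eqP/negPn/negP => z0.
have [r r0 Hr] := cder_neq0_near (entire_cderiv eH) z0.
pose d := Num.min (r / 2) (1 / 2); have d0 : 0 < d by rewrite lt_min !divr_gt0.
have dr : d < r by rewrite gt_min; apply/orP; left; lra.
have d1 : d <= 1 / 2 by rewrite ge_min lexx orbT.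
have K s : s = d \/ s = d / 2 -> (z + s%:C == 0) || (z + s%:C == -1).
  move=> sd; have := HP (z + s%:C) => /eqP; rewrite mulf_eq0.
  rewrite (negPf (Hr _ _)) /=; last first.
    by rewrite addrAC subrr add0r cabs_real gtr0_norm; case: sd => ->; lra.
  by rewrite mulf_eq0 sqrf_eq0 (addr_eq0 (z + s%:C)).
have zE s : (z + s%:C == 0) || (z + s%:C == -1) -> complex.Re z + s = 0 \/ complex.Re z + s = -1.
  by case/orP => /eqP /(congr1 (@complex.Re R)); rewrite ReD => ->; [left|right; rewrite ReN].
have := zE _ (K _ (or_introl erefl)); have := zE _ (K _ (or_intror erefl)).
by case=> h1; case=> h2; lra.
Qed.

Lemma cabs_le_eps_eq0 (u : C) (K : R) : 0 <= K -> (forall e, 0 < e -> cabs u <= K * e) -> u = 0.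
Proof.
move=> K0 Hu; apply/eqP; rewrite -cabs_eq0 eq_le cabs_ge0 andbT.
apply/ler_addgt0Pl => e e0; have K1 : 0 < K + 1 by rewrite ltr_wpDl.
apply: le_trans (Hu (e / (K + 1)) _) _; first by rewrite divr_gt0.
by rewrite addr0 mulrA ler_pdivrMr// mulrC ler_wpM2l ?(ltW e0)// lerDl.
Qed.

(** The two derivatives are multiples c and d of one function, so d F - c G is a constant b. The
    limits at both ends give b = d - c and b = - (d - c), hence c = d; then F - G is constant with
    limit 0. *)
Theorem extremal_unique F G : monotone_majorant F -> sgn_gap F = 2%:E ->
  monotone_majorant G -> sgn_gap G = 2%:E -> forall z, F z = G z.
Proof.
move=> mF IF mG IG; have [rF _ Fsg _ _] := mF; have [rG _ Gsg _ _] := mG.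
have [eF _] := rF; have [eG _] := rG.
have lim d c b : (forall z, d * F z - c * G z = b) -> b = 0 /\ d = c.
  move=> Hb; suff [b1 b2] : b = d - c /\ b = - (d - c).
    have bb : b + b = 0 by rewrite {1}b1 b2 subrr.
    have b0 : b = 0 by move/eqP: bb; rewrite -mulr2n -mulr_natl mulf_eq0 pnatr_eq0 => /eqP.
    by split=> //; move/eqP: b1; rewrite b0 eq_sym subr_eq0 => /eqP.
  have K0 : 0 <= cabs d + cabs c by rewrite addr_ge0 ?cabs_ge0.
  have est (e x s : R) : `|on_reals F x - s| <= e -> `|on_reals G x - s| <= e ->
      cabs (b - (d - c) * s%:C) <= (cabs d + cabs c) * e.
    move=> h1 h2; rewrite -(Hb x%:C) (real_entire_E _ rF) (real_entire_E _ rG).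
    have -> : d * (on_reals F x)%:C - c * (on_reals G x)%:C - (d - c) * s%:C =
        d * (on_reals F x - s)%:C - c * (on_reals G x - s)%:C by rewrite !realCB; ring.
    rewrite (le_trans (cabsB _ _))// mulrDl !(cabsM, cabs_real).
    by rewrite lerD// ler_wpM2l ?cabs_ge0.
  have IF2 : (sgn_gap F <= 2%:E)%E by rewrite IF.
  have IG2 : (sgn_gap G <= 2%:E)%E by rewrite IG.
  have est2 (e : R) : 0 < e -> cabs (b - (d - c)) <= (cabs d + cabs c) * e /\
      cabs (b - - (d - c)) <= (cabs d + cabs c) * e.
    move=> e0; have [X1 H1] := majorant_limit mF IF2 e0; have [X2 H2] := majorant_limit mG IG2 e0.
    have [] := H1 (Num.max X1 X2); first by rewrite le_max lexx.
    have [] := H2 (Num.max X1 X2); first by rewrite le_max lexx orbT.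
    move=> g1 g2 f1 f2; have := est _ _ _ f1 g1; have := est _ _ _ f2 g2.
    by rewrite realCN mulrN mulr1 => h2 h1; split.
  by split; apply/eqP; rewrite -subr_eq0; apply/eqP; apply: (cabs_le_eps_eq0 K0) => e /est2[].
have [c Hc] := extremal_cderiv mF IF; have [d Hd] := extremal_cderiv mG IG.
have lincomb (a b : C) : (forall z, (a * cderiv F z - b * cderiv G z) * (z * (z + 1) ^+ 2) = 0) ->
    a = b.
  move=> H0; have eL : entire (fun z => a * F z - b * G z).
    exact (entireB (entireM (@entire_cst R a) eF) (entireM (@entire_cst R b) eG)).
  have LD z : cderiv (fun z => a * F z - b * G z) z = a * cderiv F z - b * cderiv G z.
    rewrite (cderivE (cderB (cderM (cder_cst a z) (cderivP z eF))
      (cderM (cder_cst b z) (cderivP z eG)))).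
    by move: (cderiv F z) (cderiv G z) => p q; rewrite !mulr0 !addr0.
  have [] := lim a b (a * F 0 - b * G 0); last by [].
  by apply: (cderiv_pole_const eL) => z; rewrite LD.
have L (a b f g p s : C) : f * p = c * s -> g * p = d * s -> (a * f - b * g) * p = (a * c - b * d) * s.
  by move=> fE gE; rewrite mulrBl -!mulrA fE gE; ring.
have dc : d = c.
  by apply: lincomb => z; rewrite (L _ _ _ _ _ _ (Hc z) (Hd z)) mulrC [c * d]mulrC subrr mulr0.
have L1 (f g p s : C) : f * p = c * s -> g * p = d * s -> (f - g) * p = 0.
  by move=> fE gE; rewrite mulrBl fE gE dc subrr.
have H0 : forall z, cderiv (fun z => F z - G z) z * (z * (z + 1) ^+ 2) = 0.
  move=> z; rewrite (cderivE (cderB (cderivP z eF) (cderivP z eG))).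
  exact: L1 (Hc z) (Hd z).
have eB := entireB eF eG.
have Hb := cderiv_pole_const eB H0.
have [b0 _] := lim 1 1 (F 0 - G 0) (fun z => etrans (congr2 _ (mul1r _) (congr1 _ (mul1r _))) (Hb z)).
by move=> z; apply/eqP; rewrite -subr_eq0 Hb b0.
Qed.

End Uniqueness.

(** * The extremal majorant *)

Section SincIntegral.
Variable R : realType.
Local Notation C := R[i].
Implicit Types (x y u v : R) (z w : C).

Definition sincr x : R := complex.Re (sinc2 x%:C).

Lemma sincr_continuous : continuous sincr.
Proof. exact (entire_ccont_real (@entire_sinc2 R)).1. Qed.

Lemma sincr_ge0 x : 0 <= sincr x.
Proof. by case/andP: (Re_sinc2_itv x). Qed.

Lemma sincrE x : x != 0 -> sincr x = sin (pi * x) ^+ 2 / (pi ^+ 2 * x ^+ 2).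
Proof. by move=> x0; rewrite /sincr sinc2_real. Qed.

Lemma sinc2_sincr x : sinc2 x%:C = (sincr x)%:C.
Proof. by apply: complex_ext => //=; rewrite Im_sinc2. Qed.

(** The numerator of sinc^2 cancels the denominator of the geometric sum in the kernel. *)
Lemma sincr_fejer N x : (0 < N)%N -> sincr x * fejer N x = N%:R * sincr (N%:R * x).
Proof.
move=> N0; have N1 : N%:R != 0 :> R by rewrite pnatr_eq0 -lt0n.
have [->|x0] := eqVneq x 0.
  rewrite mulr0 /sincr sinc2_0 mul1r mulr1 /fejer.
  under eq_bigr do rewrite mulr0 expi0.
  by rewrite sumr_const card_ord cabs_nat expr2 mulKf.
rewrite !sincrE ?mulf_neq0// /fejer.
have s2 t : 2 - 2 * cos (2 * pi * t) = 4 * sin (pi * t) ^+ 2 :> R.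
  rewrite (_ : 2 * pi * t = (pi * t) *+ 2); last by rewrite -[RHS]mulr_natl mulrA.
  by rewrite cos_mulr2n; have := cos2Dsin2 (pi * t); move: (cos _) (sin _) => c s; lra.
have : (4 * sin (pi * x) ^+ 2) * cabs (\sum_(j < N) expi (j%:R * x)) ^+ 2 =
    4 * sin (pi * (N%:R * x)) ^+ 2.
  rewrite -!s2 -!cabs_expi_sub1 -exprMn -cabsM expiMn subrX1; congr (cabs (_ * _) ^+ 2).
  by apply: eq_bigr => j _; rewrite expiMn.
move: (cabs _ ^+ 2) (sin _ ^+ 2) (sin _ ^+ 2) => q t s H.
have {}H : t = s * q by lra.
have p0 : pi ^+ 2 != 0 :> R by rewrite expf_neq0// lt0r_neq0// pi_gt0.
by move: p0; move: (pi ^+ 2) => p p0; rewrite H; field; rewrite ?p0 ?x0 ?N1.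
Qed.

(** Rescaling turns the Fejer mean of sinc^2 at 0 into its integral over [-N/2, N/2], so the limit
    is the value of sinc^2 at 0. *)
Lemma intR_sincr_cvg (e : R) : 0 < e -> exists N0, forall N, (N0 <= N)%N -> (0 < N)%N ->
  `|intR sincr (- (N%:R / 2)) (N%:R / 2) - 1| <= e.
Proof.
move=> e0; have [N0 H] := fejer_cvg (ccont_real sincr_continuous) e0.
exists N0 => N NN Npos; have := H N NN Npos.
rewrite (_ : (fun x => _) = (fun x => (N%:R * sincr (N%:R * x))%:C)); last first.
  by apply/funext => x; rewrite -realCM sincr_fejer.
have cN : continuous (fun x => sincr (N%:R * x)).
  by have := cnt_comp (@cnt_affine R N%:R 0) sincr_continuous; under eq_fun do rewrite addr0.
rewrite cint_real (intRZ _ _ _ cN) (intR_scale _ _ sincr_continuous).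
by rewrite /sincr sinc2_0 -(@rmorph1 _ _ (real_complex R)) -realCB cabs_real !mulrA mulr1.
Qed.

Lemma intR_widen (f : R -> R) x y u v : continuous f -> (forall t, 0 <= f t) ->
  u <= x -> x <= y -> y <= v -> intR f x y <= intR f u v.
Proof.
move=> cf f0 ux xy yv; rewrite -(intR_chasles x u v cf) -(intR_chasles y x v cf).
have := intR_ge0 cf ux (fun t _ => f0 t); have := intR_ge0 cf yv (fun t _ => f0 t).
move: (intR _ _ _) (intR _ _ _) (intR _ _ _) => a b c; clear; lra.
Qed.

Lemma bound_nat (r : R) : exists n : nat, (0 < n)%N /\ forall m, (n <= m)%N -> r <= m%:R.
Proof.
exists (Num.bound `|r|).+1; split=> // m nm.
apply: le_trans (ler_norm _) _; apply: le_trans (ltW (archi_boundP (normr_ge0 _))) _.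
by rewrite ler_nat (leq_trans _ nm).
Qed.

Lemma intR_sincr_le1 x y : x <= y -> intR sincr x y <= 1.
Proof.
move=> xy; apply/ler_addgt0Pl => e e0; have [N0 H] := intR_sincr_cvg e0.
have [n [n0 Hn]] := bound_nat (2 * (`|x| + `|y|)).
pose N := maxn N0 n; have Nn := Hn N (leq_maxr _ _).
have N1 : (0 < N)%N by rewrite (leq_trans n0) ?leq_maxr.
have := H N (leq_maxl _ _) N1; rewrite ler_norml => /andP[_].
have hx := ler_norm (- x); rewrite normrN in hx; have hy := ler_norm y.
have := normr_ge0 x; have := normr_ge0 y => y0 x0.
have : intR sincr x y <= intR sincr (- (N%:R / 2)) (N%:R / 2).
  by apply: intR_widen => //; [exact: sincr_continuous|exact: sincr_ge0|lra|lra].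
move: (intR _ _ _) (intR _ _ _) => a b; clear; lra.
Qed.

Lemma intR_sincr_ge (e : R) : 0 < e -> exists X0, forall x y, x <= - X0 -> X0 <= y ->
  1 - e <= intR sincr x y.
Proof.
move=> e0; have [N0 H] := intR_sincr_cvg e0.
exists (N0.+1%:R / 2) => x y hx hy.
have := H N0.+1 (leqnSn _) isT; rewrite ler_norml => /andP[+ _].
have n0 : 0 <= N0.+1%:R / 2 :> R by rewrite divr_ge0.
have : intR sincr (- (N0.+1%:R / 2)) (N0.+1%:R / 2) <= intR sincr x y.
  by apply: intR_widen => //; [exact: sincr_continuous|exact: sincr_ge0|lra].
move: (intR _ _ _) (intR _ _ _) => a b; clear; lra.
Qed.

End SincIntegral.

(** * Entire representation of the kernel *)

Section Kernel.
Variable R : realType.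
Local Notation C := R[i].
Implicit Types (x y u v : R) (z w s : C).

Lemma csinpiD1 z : csinpi (z + 1) = - csinpi z.
Proof.
have cp : cexp ('i%C * pi%:C) = -1 :> C.
  rewrite (_ : 'i%C * pi%:C = 0 +i* pi); last by simpc.
  by rewrite cexp_imag cospi sinpi; apply: complex_ext => //=; rewrite oppr0.
have cp' : cexp (- ('i%C * pi%:C)) = -1 :> C by rewrite cexpN cp invrN invr1.
rewrite /csinpi /csin mulrDr mulr1 mulrDr opprD !cexpD cp cp' !mulrN1 -opprD.
by rewrite mulNr.
Qed.

(** The squared sine has period 1. This yields the sign of the kernel on each half line, its tails,
    and the integration by parts for M. *)
Lemma kernel_fun_mul s : s * kernel_fun s = sinc2 (s + 1).
Proof.
have S1 : csinpi (s + 1) ^+ 2 = csinpi s ^+ 2 by rewrite csinpiD1 sqrrN.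
have [->|s0] := eqVneq s 0.
  rewrite mul0r add0r sinc2_neq0E ?oner_eq0// -{1}(add0r 1) csinpiD1 /csinpi mulr0 csin0.
  by rewrite oppr0 expr0n/= mul0r.
rewrite /kernel_fun (negPf s0); have [->|s1] := eqVneq s (-1).
  by rewrite mulrNN mulr1 addNr sinc2_0.
have s1' : s + 1 != 0 by rewrite addr_eq0.
rewrite sinc2_neq0E// S1 /csinpi; have := piC_neq0 R.
by move: (csin (pi%:C * s)) => c; move: (pi%:C : C) => p p0; field; rewrite p0 s0 s1'.
Qed.

(** Partial fractions: 1 / (s (s + 1)^2) = 1 / s - (s + 2) / (s + 1)^2. The right side is visibly
    entire and matches the values chosen at 0 and -1. *)
Lemma kernel_funE s : kernel_fun s = s * sinc2 s - (s + 2) * sinc2 (s + 1).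
Proof.
have S1 : csinpi (s + 1) ^+ 2 = csinpi s ^+ 2 by rewrite csinpiD1 sqrrN.
have [->|s0] := eqVneq s 0.
  have := kernel_fun_mul 0; rewrite mul0r => <-.
  by rewrite /kernel_fun eqxx mul0r mulr0 subrr.
have [->|s1] := eqVneq s (-1).
  rewrite addNr sinc2_0 (_ : sinc2 (-1) = 0).
    by rewrite /kernel_fun eqxx oppr_eq0 oner_eq0; ring.
  rewrite sinc2_neq0E ?oppr_eq0 ?oner_eq0// csinpiN -{1}(add0r 1) csinpiD1 /csinpi mulr0 csin0.
  by rewrite !oppr0 expr0n/= mul0r.
have s1' : s + 1 != 0 by rewrite addr_eq0.
rewrite /kernel_fun (negPf s0) (negPf s1) !sinc2_neq0E// S1 /csinpi; have := piC_neq0 R.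
by move: (csin (pi%:C * s)) => c; move: (pi%:C : C) => p p0; field; rewrite p0 s0 s1'.
Qed.

Lemma entire_kernel_fun : entire (@kernel_fun R).
Proof.
rewrite (_ : @kernel_fun R = fun s => s * sinc2 s - (s + 2) * sinc2 (s + 1)); last first.
  by apply/funext => s; exact: kernel_funE.
have e1 : entire (fun s : C => s + 1) := entireD (@entire_id R) (@entire_cst R 1).
have e2 : entire (fun s : C => s + 2) := entireD (@entire_id R) (@entire_cst R 2).
have es := @entire_sinc2 R.
exact (entireB (entireM (@entire_id R) es) (entireM e2 (entire_comp es e1))).
Qed.

End Kernel.

(** * Primitives of entire functions along segments *)

Section Primitive.
Variable R : realType.
Local Notation C := R[i].
Implicit Types (F : C -> C) (x y u v : R) (z w s : C).

Definition primitive0 F z : C := cint (fun t => F (t%:C * z) * z) 0 1.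

(** The derivative of F(t z) z with respect to z is also the derivative of t F(t z) with respect to
    t, so its integral over [0, 1] is F(z). *)
Lemma cder_primitive0 F z : entire F -> cder (primitive0 F) z (F z).
Proof.
move=> eF; have eF' := entire_cderiv eF.
have c0 (G : C -> C) w : entire G -> ccont (fun t => G (t%:C * w)).
  move=> /(@entire_ccont R G 0 w); rewrite (_ : (fun t => _) = (fun t => G (t%:C * w)))//.
  by apply/funext => t; rewrite add0r.
pose g t := F (t%:C * z) + t%:C * (cderiv F (t%:C * z) * z).
have cg : ccont g.
  apply: ccontD (c0 _ z eF) _; apply: ccontM; first by have := c0 _ 1 (@entire_id R); under eq_fun do rewrite mulr1.
  exact: ccontM (c0 _ z eF') (ccont_cst z).
have D t : rcder (fun t => F (t%:C * z) * t%:C) t (g t).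
  have dw : cder (fun w : C => w * z) t%:C z.
    by have := cderM (cder_id t%:C) (cder_cst z t%:C); rewrite mulr0 add0r mulr1.
  have d := cderM (cder_comp dw (cderivP _ eF)) (cder_id t%:C).
  by have := cder_real d; rewrite mulr1.
have <- : cint g 0 1 = F z by rewrite (cint_FTC 0 1 cg D) mulr0 subr0 mul1r mulr1.
pose rho := cabs z + 1; have rho0 : 0 <= rho by rewrite addr_ge0 ?cabs_ge0.
have [K HK] := entire_quad rho eF; have [B B0 HB] := entire_bounded rho eF'.
apply: (@cder_cint _ (fun t z => F (t%:C * z) * z) g z 1 (B + `|K| * rho)) => //.
  by move=> h _; exact: ccontM (c0 _ _ eF) (ccont_cst _).
move=> t h /andP[t0 t1] h1.
have tz w : cabs (t%:C * w) <= cabs w.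
  by rewrite cabsM cabs_real ger0_norm// ler_piMl// cabs_ge0.
have zr : cabs z <= rho by rewrite lerDl.
have zhr : cabs (z + h) <= rho by rewrite (le_trans (cabsD _ _))// lerD2l ltW.
have := HK (t%:C * z) (t%:C * h); rewrite -mulrDr.
move=> /(_ (le_trans (tz _) zr) (le_trans (tz _) zhr)).
set r := _ - _ => Hr.
have -> : F (t%:C * (z + h)) * (z + h) - F (t%:C * z) * z - g t * h =
    cderiv F (t%:C * z) * (t%:C * h) * h + r * (z + h) by rewrite /r /g; ring.
clearbody r; rewrite (le_trans (cabsD _ _))// (mulrDl B) lerD//.
  rewrite cabsM cabsM expr2 mulrA ler_wpM2r ?cabs_ge0//.
  by apply: ler_pM => //; rewrite ?cabs_ge0// HB// (le_trans (tz _)).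
rewrite cabsM; apply: le_trans (_ : (`|K| * cabs h ^+ 2) * rho <= _); last by rewrite mulrAC.
apply: ler_pM => //; rewrite ?cabs_ge0//; apply: (le_trans Hr).
apply: (@le_trans _ _ (`|K| * cabs (t%:C * h) ^+ 2)); first by rewrite ler_wpM2r ?sqr_ge0// ler_norm.
by rewrite ler_wpM2l// lerXn2r ?nnegrE ?cabs_ge0.
Qed.

Lemma primitive0_bound F z (M : R) : entire F -> (forall w, cabs w <= cabs z -> cabs (F w) <= M) ->
  cabs (primitive0 F z) <= M * cabs z.
Proof.
move=> eF FM; rewrite (_ : M * cabs z = M * cabs z * (1 - 0)); last by rewrite subr0 mulr1.
apply: cint_bound_cst => //.
  apply: ccontM (ccont_cst z); have := @entire_ccont R F 0 z eF.
  by under eq_fun do rewrite add0r.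
move=> t /andP[t0 t1]; rewrite cabsM ler_wpM2r ?cabs_ge0//; apply: FM.
by rewrite cabsM cabs_real ger0_norm// ler_piMl// cabs_ge0.
Qed.

End Primitive.

(** * The integral of the kernel over the real line *)

Section KernelIntegral.
Variable R : realType.
Local Notation C := R[i].
Implicit Types (x y u v : R) (z w s : C).

Definition kernelr x : R := complex.Re (kernel_fun x%:C).

Lemma kernel_kernelr x : kernel_fun x%:C = (kernelr x)%:C.
Proof.
apply: complex_ext => //=; rewrite kernel_funE.
rewrite (_ : x%:C + 1 = (x + 1)%:C :> C); last by rewrite realCD.
rewrite (_ : x%:C + 2 = (x + 2)%:C :> C); last by rewrite realCD (realC_nat R 2).
by rewrite !sinc2_sincr -!realCM -realCB.
Qed.

Lemma kernelr_continuous : continuous kernelr.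
Proof. exact (entire_ccont_real (@entire_kernel_fun R)).1. Qed.

Lemma kernelr_mul x : x * kernelr x = sincr (x + 1).
Proof.
apply: (@complexI R); rewrite realCM -kernel_kernelr kernel_fun_mul.
by rewrite -sinc2_sincr realCD.
Qed.

Lemma kernelr0 : kernelr 0 = 0.
Proof. by rewrite /kernelr /kernel_fun eqxx. Qed.

Lemma kernelr_ge0 x : 0 <= x -> 0 <= kernelr x.
Proof.
rewrite le_eqVlt => /predU1P[<-|x0]; first by rewrite kernelr0.
by rewrite -(pmulr_rge0 _ x0) kernelr_mul sincr_ge0.
Qed.

Lemma kernelr_le0 x : x <= 0 -> kernelr x <= 0.
Proof.
rewrite le_eqVlt => /predU1P[->|x0]; first by rewrite kernelr0.
by rewrite -(nmulr_rge0 _ x0) kernelr_mul sincr_ge0.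
Qed.

Let sx x := x * sincr x.
Let csx : continuous sx.
Proof. by apply: cntM (@sincr_continuous R) => x; exact: cvg_id. Qed.

Lemma kernelrE x : kernelr x = sx x - sx (1 * x + 1) - sincr (1 * x + 1).
Proof.
rewrite mul1r /sx; apply: (@complexI R); rewrite -kernel_kernelr kernel_funE.
by rewrite !realCB !realCM -!sinc2_sincr !realCD; ring.
Qed.

Lemma sx_bound x : `|x| * `|sx x| <= 1.
Proof.
have [->|x0] := eqVneq x 0; first by rewrite normr0 mul0r.
have x2 : 0 < x ^+ 2 by rewrite exprn_even_gt0.
have p1 : 1 <= pi ^+ 2 :> R by rewrite exprn_ege1// (le_trans _ (pi_ge2 R))// ler1n.
rewrite -normrM /sx mulrA -expr2 ger0_norm; last by rewrite mulr_ge0 ?sqr_ge0 ?sincr_ge0.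
have p2 : 0 < pi ^+ 2 * x ^+ 2 by rewrite mulr_gt0// (lt_le_trans ltr01).
rewrite sincrE// mulrA ler_pdivrMr//.
have s1 : sin (pi * x) ^+ 2 <= 1 :> R.
  by have := cos2Dsin2 (pi * x); have := sqr_ge0 (cos (pi * x)); move: (_ ^+ 2) (_ ^+ 2) => a b; clear; lra.
rewrite mul1r mulrC; apply: ler_pM => //; first exact: sqr_ge0.
  exact: sqr_ge0.
by apply: le_trans p1.
Qed.

(** The difference of x sinc^2(x) and its translate by 1 telescopes to integrals over unit intervals
    at the two ends, where it is O(1/|x|); what remains is minus the integral of a translate of
    sinc^2, which tends to -1. *)
Lemma intR_kernelr_cvg (e : R) : 0 < e -> exists n0, forall n, (n0 <= n)%N ->
  `|intR kernelr (- n%:R) n%:R + 1| <= e.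
Proof.
move=> e0; have e4 : 0 < e / 4 by rewrite divr_gt0.
have [X0 HX] := intR_sincr_ge e4.
have [n0 [n00 Hn]] := bound_nat (`|X0| + 2 + 4 / e).
exists n0 => n nn; have := Hn n nn => {}Hn.
have hX := ler_norm X0; have hX0 := normr_ge0 X0.
have he : 0 <= 4 / e by rewrite divr_ge0// ltW.
have n1 : 2 <= n%:R :> R by lra.
have nX : X0 + 2 <= n%:R by lra.
have ne : 4 / e <= n%:R - 1 by lra.
pose N : R := n%:R; rewrite -/N in n1 nX ne *.
have csx1 : continuous (fun x => sx (1 * x + 1)) := cnt_comp (@cnt_affine R 1 1) csx.
have csi := @sincr_continuous R.
have csi1 : continuous (fun x => sincr (1 * x + 1)) := cnt_comp (@cnt_affine R 1 1) csi.
have sh f : continuous f -> intR (fun x => f (1 * x + 1)) (- N) N = intR f (- N + 1) (N + 1).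
  by move=> cf; have := intR_affine 1 1 (- N) N cf; rewrite !mul1r.
rewrite (_ : kernelr = fun x => sx x - sx (1 * x + 1) - sincr (1 * x + 1)); last first.
  by apply/funext => x; exact: kernelrE.
rewrite (intRB _ _ (cntB csx csx1) csi1) (intRB _ _ csx csx1) !sh//.
have -> : intR sx (- N) N - intR sx (- N + 1) (N + 1) =
    intR sx (- N) (- N + 1) - intR sx N (N + 1).
  rewrite -(intR_chasles (- N + 1) (- N) N csx) -(intR_chasles N (- N + 1) (N + 1) csx).
  by move: (intR _ _ _) (intR _ _ _) (intR _ _ _) => a b c; clear; lra.
have bd a : N - 1 <= `|a| /\ N - 1 <= `|a + 1| -> 0 <= a \/ a + 1 <= 0 -> `|intR sx a (a + 1)| <= e / 4.
  move=> [a1 a2] a3; have aE : e / 4 = e / 4 * (a + 1 - a) by rewrite addrAC subrr add0r mulr1.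
  have K x : a <= x <= a + 1 -> `|sx x| <= e / 4.
    move=> xa; have xN : N - 1 <= `|x|.
      by case: a3 => a3; move: a1 a2; [rewrite !ger0_norm//|rewrite !ler0_norm//]; lra.
    have x4 : 4 / e <= `|x| by apply: le_trans xN.
    have := sx_bound x; move: x4; rewrite ler_pdivrMr//; move: (`|x|) (`|sx x|) (normr_ge0 (sx x)).
    move=> q s s0 h1 h2; have := ler_wpM2r s0 h1; have := ler_wpM2l (ltW e0) h2; lra.
  rewrite ler_norml aE -mulNr -!intR_cst; apply/andP; split; apply: intR_le => //; try exact: (@cnst R _).
  - by rewrite lerDl.
  - by move=> x /K; rewrite ler_norml => /andP[].
  - by rewrite lerDl.
  - by move=> x /K; rewrite ler_norml => /andP[].
have b1 := bd (- N); have b2 := bd N.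
have s1 : 1 - e / 4 <= intR (@sincr R) (- N + 1) (N + 1) by apply: HX; lra.
have s2 : intR (@sincr R) (- N + 1) (N + 1) <= 1 by apply: intR_sincr_le1; lra.
move: b1 b2 s1 s2; move: (intR sx _ _) (intR sx _ _) (intR (@sincr R) _ _) => i2 i1 i3 b1 b2 s1 s2.
have {}b1 : `|i1| <= e / 4.
  by apply: b1; [split; rewrite ler0_norm; lra|right; lra].
have {}b2 : `|i2| <= e / 4.
  by apply: b2; [split; rewrite ger0_norm; lra|left; lra].
move: b1 b2; rewrite !ler_norml; lra.
Qed.

End KernelIntegral.

(** * The extremal function as a shifted primitive of the kernel *)

Section ExtremalMajorant.
Variable R : realType.
Local Notation C := R[i].
Local Notation mu := (@lebesgue_measure R).
Implicit Types (x y u v l : R) (z w s : C).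

Let nk x : R := - kernelr x.
Let s1 x : R := sincr (1 * x + 1).

Let ck : continuous (@kernelr R) := @kernelr_continuous R.
Let cnk : continuous nk := cntN ck.
Let cs1 : continuous s1 := cnt_comp (@cnt_affine R 1 1) (@sincr_continuous R).

Lemma shifted_sincr_le1 x y : x <= y -> intR s1 x y <= 1.
Proof.
move=> xy; have := intR_affine 1 1 x y (@sincr_continuous R); rewrite !mul1r => ->.
by apply: intR_sincr_le1; rewrite lerD2r.
Qed.

(** X times a tail of the kernel is thereby at most a tail of sinc^2, which bounds the boundary
    terms X (M(X) - 1) and X (M(-X) + 1). *)
Lemma kernelr_scale_le X x : 0 <= X <= `|x| -> X * `|kernelr x| <= s1 x.
Proof.
move=> /andP[X0 Xx]; rewrite /s1 mul1r -kernelr_mul.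
apply: (@le_trans _ _ (`|x| * `|kernelr x|)); first by rewrite ler_wpM2r.
have [x0|x0] := leP 0 x; first by rewrite (ger0_norm x0) ger0_norm// kernelr_ge0.
by rewrite (ltr0_norm x0) ler0_norm ?kernelr_le0 ?(ltW x0)// mulrNN.
Qed.

Lemma intR_nk_tail X x y : 0 <= X -> x <= y -> y <= - X -> X * intR nk x y <= intR s1 x y.
Proof.
move=> X0 xy yX; rewrite -(intRZ _ _ _ cnk); apply: intR_le => //.
  exact: cntM (@cnst R X) cnk.
move=> t /andP[_ ty]; have t0 : t <= 0 by lra.
have := @kernelr_scale_le X t; rewrite (ler0_norm (kernelr_le0 t0)) (ler0_norm t0) X0 /=.
by apply; lra.
Qed.

Lemma intR_kernelr_tail X x y : 0 <= X -> x <= y -> X <= x -> X * intR (@kernelr R) x y <= intR s1 x y.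
Proof.
move=> X0 xy Xx; rewrite -(intRZ _ _ _ ck); apply: intR_le => //.
  exact: cntM (@cnst R X) ck.
move=> t /andP[xt _]; have t0 : 0 <= t by lra.
have := @kernelr_scale_le X t; rewrite (ger0_norm (kernelr_ge0 t0)) (ger0_norm t0) X0 /=.
by apply; lra.
Qed.

Lemma nk_mono x y : x <= y -> y <= 0 -> intR nk y 0 <= intR nk x 0.
Proof.
move=> xy y0; rewrite -(intR_chasles y x 0 cnk) lerDr.
by apply: intR_ge0 => // t /andP[_ ty]; rewrite oppr_ge0 kernelr_le0// (le_trans ty).
Qed.

(** The integral of minus the kernel over the negative half line, as the supremum of an increasing
    sequence bounded through the comparison with sinc^2. Its value need not be computed. *)
Lemma kernel_neg_integral : exists l : R, (forall x, x <= 0 -> intR nk x 0 <= l) /\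
  (forall e, 0 < e -> exists N, forall n, (N <= n)%N -> l - e <= intR nk (- n%:R) 0).
Proof.
pose S := [set intR nk (- n%:R) 0 | n in [set: nat]].
have S_ub : ubound S (intR nk (-1) 0 + 1).
  move=> _ [n _ <-]; apply: (@le_trans _ _ (intR nk (- n.+1%:R) 0)).
    by apply: nk_mono; rewrite ?lerN2 ?ler_nat ?oppr_le0.
  have n1 : - n.+1%:R <= -1 :> R by rewrite lerN2 ler1n.
  rewrite -(intR_chasles (-1) (- n.+1%:R) 0 cnk) addrC lerD2l.
  have := intR_nk_tail ler01 n1 (lexx (-1)); rewrite mul1r => /le_trans; apply.
  exact: shifted_sincr_le1.
have Ssup : has_sup S by split; [exists (intR nk (- 0%:R) 0), 0%N|exists (intR nk (-1) 0 + 1)].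
have H0 n : intR nk (- n%:R) 0 <= sup S by apply: sup_upper_bound Ssup _ _; exists n.
exists (sup S); split=> [x x0|e e0].
  have [n [_ Hn]] := bound_nat (- x); have xn := Hn n (leqnn n).
  by apply: le_trans (H0 n); apply: nk_mono => //; rewrite lerNl.
have [_ [N _ <-] HN] := sup_adherent e0 Ssup; exists N => n Nn.
apply: (le_trans (ltW HN)); apply: nk_mono; first by rewrite lerN2 ler_nat.
by rewrite oppr_le0.
Qed.

Definition shifted_primitive l z : C := - 2 * ((- l)%:C + primitive0 (@kernel_fun R) z) - 1.

Lemma extremal_majorantE l : (forall x, x <= 0 -> intR nk x 0 <= l) ->
  (forall e, 0 < e -> exists N, forall n, (N <= n)%N -> l - e <= intR nk (- n%:R) 0) ->
  forall z, extremal_majorant z = shifted_primitive l z.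
Proof.
move=> Hl He z; rewrite /extremal_majorant /shifted_primitive /path_integral_from_ninfty.
congr (_ * (_ + _) - _).
  rewrite /cintegral; apply: complex_ext => /=; rewrite /Rintegral.
    (* The kernel is nonpositive on this half line, so monotone convergence is applied to its
       opposite. *)
    rewrite (_ : (fun t => _) = (fun t => (- (nk t)%:E)%E)); last first.
      by apply/funext => t; rewrite /nk EFinN oppeK.
    rewrite integral_ge0N => [|t]; last first.
      by rewrite /= in_itv/= => t0; rewrite lee_fin oppr_ge0 kernelr_le0.
    rewrite (integral_Ny_cvg (L := l) cnk) => [//|t t0|e e0]; first by rewrite oppr_ge0 kernelr_le0.
    have [N HN] := He e e0; exists N => n Nn; rewrite ler_norml.
    have := HN n Nn; have := Hl (- n%:R); rewrite oppr_le0 => /(_ (ler0n _ _)).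
    move: (intR _ _ _) => a h1 h2; apply/andP; split; lra.
  rewrite (_ : (fun t => _) = cst 0%E).
    by rewrite integral0.
  by apply/funext => t; rewrite kernel_kernelr.
rewrite /segment_integral /primitive0 /cint /intR ler01 /cintegral.
by congr (_ +i* _); congr Rintegral; apply/funext => t /=; rewrite !add0r !subr0.
Qed.

Lemma cder_shifted_primitive l z : cder (shifted_primitive l) z (-2 * kernel_fun z).
Proof.
have d := cderD (cder_cst (- l)%:C z) (cder_primitive0 z (@entire_kernel_fun R)).
by apply: cder_eq (cderB (cderM (cder_cst (-2) z) d) (cder_cst 1 z)) _; rewrite mulr0 addr0 add0r subr0.
Qed.

Lemma entire_shifted_primitive l : entire (shifted_primitive l).
Proof. by apply/entireP => z; eexists; exact: cder_shifted_primitive. Qed.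

Lemma shifted_primitive_real l x :
  shifted_primitive l x%:C = (2 * l - 1 - 2 * intR (fun t => kernelr (t * x) * x) 0 1)%:C.
Proof.
rewrite /shifted_primitive /primitive0.
rewrite (_ : (fun t => _) = (fun t => (kernelr (t * x) * x)%:C)); last first.
  by apply/funext => t; rewrite -realCM kernel_kernelr -realCM.
rewrite cint_real; move: (intR _ _ _) => a.
by apply: complex_ext => //=; ring.
Qed.

Lemma exp_bounded_kernel : exists2 K, 0 < K & forall z,
  cabs (kernel_fun z) <= K * expR (2 * pi * cabs z) :> R.
Proof.
have [K K0 HK] := sinc2_bound R; exists (3 * K); first by rewrite mulr_gt0.
move=> z; apply: (@le_trans _ _ (3 * K * expR (2 * pi * `|complex.Im z|))); last first.
  by rewrite ler_pM2l ?mulr_gt0// ler_expR ler_pM2l ?mulr_gt0 ?pi_gt0// Im_le_cabs.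
have h1 := HK z; have := HK (z + 1); rewrite ImD [complex.Im 1]/= addr0 => h2.
have tri : cabs (z + 2) <= cabs (z + 1) + 1.
  by rewrite (_ : z + 2 = z + 1 + 1) ?(le_trans (cabsD _ _)) ?cabs1//; ring.
rewrite kernel_funE (le_trans (cabsB _ _))// (cabsM z) (cabsM (z + 2)).
have := cabs_ge0 (sinc2 z); have := cabs_ge0 (sinc2 (z + 1)).
move: (expR _) (cabs (sinc2 z)) (cabs (sinc2 (z + 1))) h1 h2 tri.
move: (cabs (z + 2)) (cabs (z + 1)) (cabs z) => c b a e p q h1 h2 tri q0 p0.
(* The linear factors are absorbed by the quadratic decay, with constants 1 and 2: this is the 3 in
   [3 * K]. *)
have a1 : a <= 1 + a ^+ 2 by have := sqr_ge0 (a - 1); have := sqr_ge0 a; lra.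
have b1 : c <= 2 * (1 + b ^+ 2) by have := sqr_ge0 (b - 1); have := sqr_ge0 b; lra.
have := ler_wpM2r p0 a1; have := ler_wpM2r q0 b1; lra.
Qed.

(** Integration along [0, z] costs a factor |z|, at most exp(d |z|) / d with d = t - 2 pi. *)
Lemma exp_bounded_shifted_primitive l : exp_bounded (2 * pi) (shifted_primitive l).
Proof.
move=> t st; have [K K0 HK] := exp_bounded_kernel.
pose d := t - 2 * pi; have d0 : 0 < d by rewrite subr_gt0.
exists (2 * `|l| + 1 + 2 * (K / d)).
  by rewrite ltr_pwDl ?addr_ge0 ?mulr_ge0 ?invr_ge0 ?(ltW K0) ?(ltW d0)// ltr_wpDl// mulr_ge0.
move=> z; have z0 := cabs_ge0 z; have p0 := pi_gt0 R.
have B : cabs (primitive0 (@kernel_fun R) z) <= K * expR (2 * pi * cabs z) * cabs z.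
  apply: primitive0_bound (@entire_kernel_fun R) _ => w wz; apply: (le_trans (HK w)).
  by rewrite ler_pM2l// ler_expR ler_pM2l ?mulr_gt0.
have E1 : 1 <= expR (t * cabs z).
  by rewrite -(expR0 R) ler_expR mulr_ge0// (le_trans _ (ltW st))// mulr_ge0// ltW.
have B2 : expR (2 * pi * cabs z) * cabs z <= expR (t * cabs z) / d.
  have -> : expR (t * cabs z) = expR (2 * pi * cabs z) * expR (d * cabs z).
    by rewrite -expRD -mulrDl /d subrKC.
  rewrite ler_pdivlMr// -(mulrA (expR _)) ler_wpM2l ?expR_ge0// mulrC.
  by have := expR_ge1Dx (d * cabs z); lra.
rewrite /shifted_primitive (le_trans (cabsB _ _))// cabs1 cabsM cabsN cabs_nat.
have := cabsD (- l)%:C (primitive0 (@kernel_fun R) z); rewrite cabs_real normrN.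
move: (cabs (_ + _)) (cabs (primitive0 _ z)) B => u v B D.
have B3 : v <= K / d * expR (t * cabs z).
  have := ler_wpM2l (ltW K0) B2; rewrite (mulrA K (expR (2 * pi * cabs z))) => h.
  by apply: (le_trans B); apply: (le_trans h); rewrite mulrA mulrAC.
have := ler_wpM2l (normr_ge0 l) E1; move: (expR (t * _)) E1 B3 => e E1 B3 hl.
move: (K / d) B3 => k B3; rewrite !mulrDl mul1r; lra.
Qed.

End ExtremalMajorant.

(** * The extremal function is a majorant with gap 2 *)

Section ExtremalGap.
Variable R : realType.
Local Notation C := R[i].
Implicit Types (x y u v : R) (z w s : C).

Let nk x : R := - kernelr x.
Let s1 x : R := sincr (1 * x + 1).
Let ck : continuous (@kernelr R) := @kernelr_continuous R.
Let cnk : continuous nk := cntN ck.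
Let cs1 : continuous s1 := cnt_comp (@cnt_affine R 1 1) (@sincr_continuous R).

Variable l : R.
Hypothesis l_ub : forall x, x <= 0 -> intR nk x 0 <= l.
Hypothesis l_lub : forall e, 0 < e ->
  exists N, forall n, (N <= n)%N -> l - e <= intR nk (- n%:R) 0.

Let m := on_reals (shifted_primitive l).
Let em : entire (shifted_primitive l) := @entire_shifted_primitive R l.

Lemma shifted_primitive_rder x : rder m x (-2 * kernelr x).
Proof.
have := on_reals_rder x em; rewrite /dreal (cderivE (cder_shifted_primitive l x%:C)).
by rewrite kernel_kernelr -(realC_nat R 2) -realCN -realCM.
Qed.

Let cm : continuous m := @on_reals_continuous R _ em.
Let ckm : continuous (fun x => -2 * kernelr x) := cntM (@cnst R (-2)) ck.

Lemma shifted_primitive_diff x y : m y - m x = -2 * intR (@kernelr R) x y.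
Proof. by rewrite -(intR_FTC x y ckm shifted_primitive_rder) (intRZ _ _ _ ck). Qed.

Lemma shifted_primitive_at x : m x = 2 * l - 1 - 2 * intR (@kernelr R) 0 x.
Proof.
have m0 : m 0 = 2 * l - 1.
  rewrite /m /on_reals shifted_primitive_real /=.
  rewrite (_ : (fun t => _) = fun=> 0) ?intR_cst ?mul0r ?mulr0 ?subr0//.
  by apply/funext => t; rewrite mulr0.
by rewrite -m0 -[LHS](subrK (m 0)) shifted_primitive_diff addrC mulNr.
Qed.

Lemma intR_nk x y : intR nk x y = - intR (@kernelr R) x y.
Proof.
have := intRZ (-1) x y ck; rewrite mulN1r => <-; congr (intR _ _ _).
by apply/funext => t; rewrite mulN1r.
Qed.

Lemma mass_left x : x <= 0 -> m x + 1 = 2 * (l - intR nk x 0).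
Proof.
move=> x0; rewrite shifted_primitive_at intR_nk (intR_swap x 0 ck); ring.
Qed.

(** The total integral of the kernel is -1 and its left half is -l, so its right half is l - 1. *)
Lemma mass_right_le (e : R) : 0 < e -> exists N, forall n, (N <= n)%N ->
  l - intR nk (- n%:R) 0 <= e /\ `|l - 1 - intR (@kernelr R) 0 n%:R| <= 2 * e.
Proof.
move=> e0; have [N1 H1] := l_lub e0; have [N2 H2] := intR_kernelr_cvg e0.
exists (maxn N1 N2) => n; rewrite geq_max => /andP[n1 n2].
have h1 := H1 n n1; have h2 := H2 n n2.
have n0 : - n%:R <= 0 :> R by rewrite oppr_le0.
have h3 := l_ub n0; move: h1 h2 h3.
rewrite -(intR_chasles 0 (- n%:R) n%:R ck) intR_nk.
move: (intR _ _ _) (intR _ _ _) => a b; rewrite !ler_norml => h1 /andP[h2 h3] h4.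
by split; [lra|apply/andP; split; lra].
Qed.

Lemma mass_right x : 0 <= x -> intR (@kernelr R) 0 x <= l - 1.
Proof.
move=> x0; apply/ler_addgt0Pl => e e0; have e2 : 0 < e / 2 by rewrite divr_gt0.
have [N HN] := mass_right_le e2; have [n [_ Hn]] := bound_nat x.
have [_] := HN (maxn N n) (leq_maxl _ _); have xn := Hn (maxn N n) (leq_maxr _ _).
rewrite -(intR_chasles x 0 _ ck).
have : 0 <= intR (@kernelr R) x (maxn N n)%:R.
  by apply: intR_ge0 => // t /andP[xt _]; rewrite kernelr_ge0// (le_trans x0).
rewrite ler_norml; move: (intR _ _ _) (intR _ _ _) => a b h1 /andP[h2 h3]; lra.
Qed.

Lemma shifted_primitive_majorant : monotone_majorant (shifted_primitive l).
Proof.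
split.
- by split=> // x; rewrite shifted_primitive_real.
- exact: exp_bounded_exp_type (exp_bounded_shifted_primitive l).
- move=> x; rewrite -/m; have [x0|x0] := ltP x 0.
    rewrite ltr0_sg//; have := mass_left (ltW x0); have := l_ub (ltW x0).
    move: (intR _ _ _) (m x) => a b h1 h2; lra.
  apply: (@le_trans _ _ 1); first by rewrite sgr_def; case: (_ != 0); case: (_ < 0); rewrite ?expr0 ?expr1 ?mulr0n ?mulr1n; lra.
  have := mass_right x0; have := shifted_primitive_at x.
  move: (intR _ _ _) (m x) => a b h1 h2; lra.
- move=> x y; rewrite !in_itv/= => x0 y0 xy.
  rewrite -subr_ge0 -/m shifted_primitive_diff mulNr -mulrN -intR_nk mulr_ge0//.
  apply: intR_ge0 => // t /andP[_ ty]; rewrite oppr_ge0 kernelr_le0//.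
  by rewrite (le_trans ty)// ltW.
move=> x y; rewrite !in_itv/= !andbT => x0 y0 xy.
rewrite -subr_ge0 -opprB -/m shifted_primitive_diff mulNr opprK mulr_ge0//.
apply: intR_ge0 => // t /andP[yt _]; rewrite kernelr_ge0//.
by rewrite (le_trans _ yt)// ltW.
Qed.

(** By parts the gap is X (m(X) - 1) + X (m(-X) + 1) plus twice the integral of sinc^2(x + 1) over
    [-X, X]. Up to [e], the boundary terms are at most twice its integral over the outer parts of
    [-n, n], so the sum is at most twice its integral over [-n, n]. *)
Lemma shifted_primitive_gap_trunc X : 0 < X -> gap_trunc m X <= 2.
Proof.
move=> X0; apply/ler_addgt0Pl => e e0.
(* The tails are known up to d on the left and 2 d on the right, and both enter with the factor 2
   X. *)
have d0 : 0 < e / (6 * X) by rewrite divr_gt0// mulr_gt0.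
have [N HN] := mass_right_le d0; have [n0 [_ Hn0]] := bound_nat X.
pose n := maxn N n0; have [h1 h2] := HN n (leq_maxl _ _).
have Xn : X <= n%:R := Hn0 n (leq_maxr _ _).
have dE : 6 * X * (e / (6 * X)) = e by rewrite mulrC divfK// mulf_neq0// lt0r_neq0.
rewrite (gap_truncE _ cm).
have cid : continuous (fun=> 1 : R) := @cnst R 1.
have := intR_parts (- X) X cid ckm (fun x => rder_id x) shifted_primitive_rder.
rewrite (_ : (fun x => 1 * m x) = m); last by apply/funext => x; rewrite mul1r.
rewrite (_ : (fun x => id x * (-2 * kernelr x)) = (fun x => -2 * s1 x)); last first.
  by apply/funext => x; rewrite /s1 mulrCA kernelr_mul mul1r.
rewrite (intRZ _ _ _ cs1) => ->.
have XX : - X <= 0 by rewrite oppr_le0 ltW.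
have mX : m X = 1 + 2 * (l - 1 - intR (@kernelr R) 0 X) by rewrite shifted_primitive_at; ring.
have mXN : m (- X) = -1 + 2 * (l - intR nk (- X) 0).
  by rewrite -(mass_left XX); ring.
have t1 := intR_kernelr_tail (ltW X0) Xn (lexx X).
have nX : - n%:R <= - X by rewrite lerN2.
have t2 := intR_nk_tail (ltW X0) nX (lexx (- X)).
have := shifted_sincr_le1 (le_trans nX (le_trans XX (le_trans (ltW X0) Xn))).
rewrite -/s1 -(intR_chasles (- X) (- n%:R) n%:R cs1) -(intR_chasles X (- X) n%:R cs1).
move: h1 h2; rewrite -(intR_chasles (- X) (- n%:R) 0 cnk) -(intR_chasles X 0 n%:R ck) mX mXN.
move: t1 t2; rewrite -/nk -/s1.
move: (intR s1 (- n%:R) _) (intR s1 X _) (intR s1 (- X) X) => b1 b2 b3.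
move: (intR nk (- n%:R) _) (intR nk (- X) _) (intR (@kernelr R) X _) (intR (@kernelr R) 0 X) => a1 a2 a3 a4.
rewrite ler_norml => t1 t2 h1 /andP[h2 h3] h4.
have h1' := ler_wpM2l (ltW X0) h1; have h3' := ler_wpM2l (ltW X0) h3.
rewrite [id X]/= [id (- X)]/=.
move: dE h1' h3'; move: (e / (6 * X)) => d dE h1' h3'.
lra.
Qed.

Lemma shifted_primitive_sgn_gap : sgn_gap (shifted_primitive l) = 2%:E.
Proof.
have mM := shifted_primitive_majorant; have [_ _ Fsg _ _] := mM.
apply/eqP; rewrite eq_le majorant_gap_ge2// andbT.
apply: sgn_gap_le => // n; exact: shifted_primitive_gap_trunc.
Qed.

End ExtremalGap.

Theorem theorem1 (R : realType) :
  (forall F : R[i] -> R[i], monotone_majorant F -> (2%:E <= sgn_gap F)%E) /\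
  exists M : R[i] -> R[i],
    unique (fun G : R[i] -> R[i] =>
              monotone_majorant G /\ sgn_gap G = 2%:E) M /\
    (forall z : R[i], M z = extremal_majorant z).
Proof.
split=> [F|]; first exact: majorant_gap_ge2.
have [l [l_ub l_lub]] := @kernel_neg_integral R.
have mM := shifted_primitive_majorant l_ub l_lub.
have gM := shifted_primitive_sgn_gap l_ub l_lub.
exists (shifted_primitive l); split; last first.
  by move=> z; rewrite (extremal_majorantE l_ub l_lub).
by split=> [//|G [mG gG]]; apply/funext => z; exact: extremal_unique.
Qed.
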